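(* Let $X$ be a compact subspace of $\mathbb{R}^n$ (with the Euclidean metric) with nonzero volume $\lambda(X)$. Then $$\lim_{t \to \infty} \frac{D_{\max}(tX)}{|tX|} = 1 \qquad\text{and}\qquad \lim_{t \to \infty} \frac{D_{\max}(tX)}{t^n} = \frac{\lambda(X)}{n!\,\omega_n},$$ where $\omega_n$ is the volume of the unit ball in $\mathbb{R}^n$. Moreover, for all $q \in [0, \infty]$, $$\lim_{t \to \infty} \frac{D_q^{tX}(\widehat{\lambda_X})}{D_{\max}(tX)} = 1.$$
   Context: $\lambda$ is $n$-dimensional Lebesgue measure, $\lambda_X$ is its restriction to $X$, and $\widehat{\lambda_X} = \lambda_X/\lambda(X)$ is the normalisation of $\lambda_X$ to a probability measure on $X$. For a metric space $X = (X,d)$ and $t>0$, $tX$ is the set $X$ with the metric $t d$. $P(X)$ is the set of (Radon) probability measures on $X$. For a compact metric space $X=(X,d)$ and $\mu \in P(X)$, put $(K\mu)(x) = \int_X e^{-d(x,y)}\, d\mu(y)$. The diversity of order $q \in [0,\infty]$ of $\mu$ is $D_q^X(\mu) = \left( \int_X (K\mu)^{q-1}\, d\mu \right)^{1/(1-q)}$ for $q \neq 1,\infty$; $D_1^X(\mu) = \exp\left(-\int_X \log(K\mu)\, d\mu\right)$; $D_\infty^X(\mu) = 1/\operatorname{ess\,sup}_\mu K\mu$. For nonempty $X$, the maximum diversity is $D_{\max}(X) = \sup_{\mu \in P(X)} D_q^X(\mu)$, whose value is independent of the choice of $q \in [0,\infty]$. Thus $D_q^{tX}$ and $D_{\max}(tX)$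 are these quantities for the metric $td$, i.e. for the kernel $e^{-t d(x,y)}$. A metric space is positive definite if for every finite sequence $x_1,\dots,x_m$ of distinct points the matrix $(e^{-d(x_i,x_j)})$ is positive definite; every subset of Euclidean space is positive definite. The magnitude of a positive definite finite metric space $Y = \{x_1,\dots,x_m\}$ is $|Y| = \sum_i w_i$, where $w \in \mathbb{R}^m$ is the unique vector with $\sum_j e^{-d(x_i,x_j)} w_j = 1$ for all $i$. The magnitude of a positive definite compact metric space $X$ is $|X| = \sup\{|Y| : Y \subseteq X \text{ finite}\}$. *)

(* Defs.v *)
From HB Require Import structures.
From mathcomp Require Import all_boot all_order all_algebra.
From mathcomp Require Import all_classical all_reals all_analysis ess_sup_inf.

Set Implicit Arguments.
Unset Strict Implicit.
Unset Printing Implicit Defensive.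

Import Order.TTheory GRing.Theory Num.Theory.
Import numFieldNormedType.Exports.

Local Open Scope classical_set_scope.
Local Open Scope ring_scope.

(** R^n is ['rV[R]_n] with the Borel sigma-algebra of its library topology (the
    product topology, i.e. the topology of the Euclidean metric). *)

Definition rV_display : measure_display.
Proof. by constructor. Qed.

Section borel_rV.
Context {R : realType} {n : nat}.

Definition borel_rV : set (set 'rV[R]_n) := <<s open >>.

Let borel_rV0 : borel_rV set0.
Proof. exact: sigma_algebra0. Qed.

Let borel_rVC A : borel_rV A -> borel_rV (~` A).
Proof. exact: sigma_algebraC. Qed.

Let borel_rV_bigcup (F : (set 'rV[R]_n)^nat) :
  (forall i, borel_rV (F i)) -> borel_rV (\bigcup_i F i).
Proof. exact: sigma_algebra_bigcup. Qed.

HB.instance Definition _ :=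
  @isMeasurable.Build rV_display 'rV[R]_n borel_rV
    borel_rV0 borel_rVC borel_rV_bigcup.

Lemma open_measurable_rV (A : set 'rV[R]_n) : open A -> measurable A.
Proof. by move=> oA; exact: sub_sigma_algebra. Qed.

Lemma closed_measurable_rV (A : set 'rV[R]_n) : closed A -> measurable A.
Proof.
move=> cA; rewrite -(setCK A); apply: measurableC.
by apply: open_measurable_rV; exact: closed_openC.
Qed.

Lemma compact_measurable_rV (A : set 'rV[R]_n) : compact A -> measurable A.
Proof.
by move=> cA; apply: closed_measurable_rV; apply: compact_closed => //;
  exact: norm_hausdorff.
Qed.

Lemma measurable_coord_rV (i : 'I_n) :
  measurable_fun [set: 'rV[R]_n] (fun v => v ord0 i : measurableTypeR R).
Proof.
apply: (@measurability _ _ _ _ _ _ (@measurable_realfun.RGenOInfty.G R)).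
  exact: measurable_realfun.RGenOInfty.measurableE.
move=> _ [_ [a ->] <-].
rewrite setTI; apply: open_measurable_rV.
apply: open_comp; last exact: interval_open.
by move=> v _; exact: coord_continuous.
Qed.

Lemma measurable_fun_rVP d (T : measurableType d) (f : T -> 'rV[R]_n) :
  measurable_fun [set: T] f <->
  forall i, measurable_fun [set: T] (fun x => f x ord0 i : measurableTypeR R).
Proof.
split=> [mf i|mf].
  by apply: (@measurableT_comp _ _ _ _ _ _ (fun v : 'rV[R]_n => v ord0 i)) => //;
    exact: measurable_coord_rV.
apply: (@measurability _ _ _ _ _ _ (@open 'rV[R]_n)) => // _ [U oU <-].
rewrite setTI.
pose B (qk : 'rV[rat]_n * nat) : set 'rV[R]_n :=
  [set v | forall i, `|ratr (qk.1 ord0 i) - v ord0 i| < qk.2.+1%:R^-1].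
have -> : f @^-1` U =
    \bigcup_(qk in [set qk | B qk `<=` U]) (f @^-1` (B qk)).
  apply/seteqP; split => [x Ux|x [qk /= BU Bx]]; last exact: BU.
  have /nbhs_ballP[e /= e0 eU] : nbhs (f x) U by exact: open_nbhs_nbhs.
  have [k ke] : exists k : nat, k.+1%:R^-1 < e / 2.
    have [k _ /(_ k (leqnn k)) ke] :=
      near_infty_natSinv_lt (PosNum (divr_gt0 e0 (ltr0Sn R 1))).
    by exists k.
  have k0 : 0 < k.+1%:R^-1 :> R by rewrite invr_gt0.
  have qP i : exists q : rat, `|ratr q - f x ord0 i| < k.+1%:R^-1.
    have /rat_in_itvoo[q] : f x ord0 i - k.+1%:R^-1 < f x ord0 i + k.+1%:R^-1.
      by rewrite ltrBlDr -addrA ltrDl addr_gt0.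
    by rewrite in_itv/= => qi; exists q; rewrite distrC ltr_distlC.
  have [q qE] := choice qP.
  exists (\row_i q i, k) => /=; last by move=> i; rewrite mxE.
  move=> v /= Bv; apply: eU; split => // i j; rewrite ord1.
  rewrite /ball/= -(subrKA (ratr (q j))) (le_lt_trans (ler_normD _ _))//.
  rewrite (splitr e) ltrD// ?(lt_trans _ ke)//.
    by rewrite distrC.
  by have := Bv j; rewrite mxE.
rewrite bigcup_mkcond; apply: countable_bigcupT_measurable => [|qk]; first exact: countableP.
case: ifPn => // _.
rewrite (_ : _ @^-1` _ = \bigcap_(i in [set: 'I_n])
    [set x | `|ratr (qk.1 ord0 i) - f x ord0 i| < qk.2.+1%:R^-1]); last first.
  by apply/seteqP; split => x /= Bx i => [_|]; exact: Bx.
apply: fin_bigcap_measurable => // i _.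
rewrite (_ : mkset _ = (fun x => f x ord0 i) @^-1`
    `](ratr (qk.1 ord0 i) - qk.2.+1%:R^-1), (ratr (qk.1 ord0 i) + qk.2.+1%:R^-1)[).
  rewrite -[X in measurable X]setTI; exact: mf.
by apply/seteqP; split => x /=; rewrite in_itv/= ltr_distlC.
Qed.

End borel_rV.

(* The canonical sigma-finite structure that the library declares on [m1 \x m2]
   is shadowed by the one for subprobabilities. *)
Lemma sigma_finite_product d1 d2 (T1 : measurableType d1)
    (T2 : measurableType d2) (R : realType)
    (m1 : {sigma_finite_measure set T1 -> \bar R})
    (m2 : {sigma_finite_measure set T2 -> \bar R}) :
  sigma_finite setT (m1 \x m2)%E.
Proof.
have /sigma_finiteP[F [TF ndF Foo]] := sigma_finiteT m1.
have /sigma_finiteP[G [TG ndG Goo]] := sigma_finiteT m2.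
exists (fun k => F k `*` G k).
  rewrite -setXTT TF TG predeqE => -[x y]; split.
    move=> [/= [k _ Fkx] [l _ Gly]]; exists (maxn k l) => //; split.
    - by move: x Fkx; exact/subsetPset/ndF/leq_maxl.
    - by move: y Gly; exact/subsetPset/ndG/leq_maxr.
  by move=> [k _ []/= ? ?]; split; exists k.
move=> k; have [? ?] := Foo k; have [? ?] := Goo k.
split; first exact: measurableX.
by rewrite product_measure1E// lte_mul_pinfty// ge0_fin_numE.
Qed.

Section rV_cons.
Context {R : realType} {n : nat}.

Definition rV_cons (p : measurableTypeR R * 'rV[R]_n) : 'rV[R]_n.+1 :=
  \row_i oapp (fun j => p.2 ord0 j) p.1 (unlift ord0 i).

Lemma rV_cons0 p : rV_cons p ord0 ord0 = p.1.
Proof. by rewrite mxE unlift_none. Qed.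

Lemma rV_consS p j : rV_cons p ord0 (lift ord0 j) = p.2 ord0 j.
Proof. by rewrite mxE liftK. Qed.

Lemma measurable_rV_cons : measurable_fun setT rV_cons.
Proof.
apply/measurable_fun_rVP => i; case: (unliftP ord0 i) => [j|] ->.
- under eq_fun do rewrite rV_consS.
  exact: (measurableT_comp (measurable_coord_rV j) measurable_snd).
- under eq_fun do rewrite rV_cons0.
  exact: measurable_fst.
Qed.

Let uncons (v : 'rV[R]_n.+1) : measurableTypeR R * 'rV[R]_n :=
  (v ord0 ord0, \row_j v ord0 (lift ord0 j)).

Let rV_consK : cancel rV_cons uncons.
Proof.
move=> [x v]; rewrite /uncons rV_cons0; congr pair.
by apply/rowP => j; rewrite mxE rV_consS.
Qed.

Let measurable_uncons : measurable_fun setT uncons.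
Proof.
apply: measurable_fun_pair; first exact: measurable_coord_rV.
apply/measurable_fun_rVP => i; under eq_fun do rewrite mxE.
exact: measurable_coord_rV.
Qed.

Variable m : {sigma_finite_measure set 'rV[R]_n -> \bar R}.

Local Open Scope ereal_scope.

Definition lebesgue_cons : set 'rV[R]_n.+1 -> \bar R :=
  pushforward (lebesgue_measure \x m) rV_cons.

Let lebesgue_cons0 : lebesgue_cons set0 = 0.
Proof. by rewrite /lebesgue_cons /pushforward preimage_set0 measure0. Qed.

Let lebesgue_cons_ge0 A : 0 <= lebesgue_cons A.
Proof. by rewrite /lebesgue_cons /pushforward measure_ge0. Qed.

Let lebesgue_cons_sigma_additive : semi_sigma_additive lebesgue_cons.
Proof.
move=> F mF tF mUF; rewrite /lebesgue_cons /pushforward preimage_bigcup.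
apply: measure_semi_sigma_additive.
- by move=> k; rewrite -[X in measurable X]setTI; exact: measurable_rV_cons.
- apply/trivIsetP => /= i j _ _ ij; rewrite -preimage_setI.
  by move/trivIsetP : tF => /(_ _ _ _ _ ij) ->//; rewrite preimage_set0.
- rewrite -preimage_bigcup -[X in measurable X]setTI.
  exact: measurable_rV_cons.
Qed.

HB.instance Definition _ := isMeasure.Build _ _ _ lebesgue_cons
  lebesgue_cons0 lebesgue_cons_ge0 lebesgue_cons_sigma_additive.

Let lebesgue_cons_sigma_finite : sigma_finite setT lebesgue_cons.
Proof.
have [F TF Foo] := sigma_finite_product (@lebesgue_measure R) m.
exists (fun k => uncons @^-1` F k).
  by rewrite -preimage_bigcup -TF preimage_setT.
move=> k; have [mFk Fkoo] := Foo k; split.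
  by rewrite -[X in measurable X]setTI; exact: measurable_uncons.
rewrite /lebesgue_cons /pushforward -comp_preimage.
rewrite (_ : uncons \o rV_cons = id)// funeqE => p.
exact: rV_consK.
Qed.

HB.instance Definition _ := Measure_isSigmaFinite.Build _ _ _ lebesgue_cons
  lebesgue_cons_sigma_finite.

End rV_cons.

(** Lebesgue measure on R^n as the n-fold product of the one on R; on the
    one-point space R^0 it is the unit mass. *)
Fixpoint lebesgue_rV {R : realType} (n : nat) :
    {sigma_finite_measure set 'rV[R]_n -> \bar R} :=
  match n with
  | 0 => @dirac _ 'rV[R]_0 0 R
  | n'.+1 => lebesgue_cons (lebesgue_rV n')
  end.

Lemma lebesgue_rV_itv {R : realType} (n : nat) (a b : 'rV[R]_n) :
  (forall i, a ord0 i <= b ord0 i) ->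
  lebesgue_rV n [set v : 'rV[R]_n | forall i, a ord0 i <= v ord0 i <= b ord0 i] =
  (\prod_(i < n) (b ord0 i - a ord0 i))%:E.
Proof.
elim: n => [|n ih] in a b *.
  move=> _; rewrite big_ord0 /= diracE mem_set//=.
  by case.
move=> ab; pose tl (v : 'rV[R]_n.+1) : 'rV[R]_n := \row_j v ord0 (lift ord0 j).
rewrite -[LHS]/((lebesgue_measure \x lebesgue_rV n) (rV_cons @^-1` _))%E.
rewrite (_ : @rV_cons R n @^-1` _ = `[a ord0 ord0, b ord0 ord0]%classic `*`
  [set v : 'rV[R]_n | forall i, tl a ord0 i <= v ord0 i <= tl b ord0 i]); last first.
  apply/seteqP; split => [[x v]/= avb|[x v]/= [+ avb] i].
    split; first by have := avb ord0; rewrite rV_cons0 in_itv.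
    by move=> i; have := avb (lift ord0 i); rewrite rV_consS /tl !mxE.
  rewrite in_itv/= => axb; case: (unliftP ord0 i) => [j|] ->.
    by rewrite rV_consS/=; have := avb j; rewrite /tl !mxE.
  by rewrite rV_cons0.
rewrite product_measure1E; last 2 first.
- exact: measurable_itv.
- rewrite (_ : mkset _ = \bigcap_(i in [set: 'I_n])
      ((fun v : 'rV[R]_n => v ord0 i : measurableTypeR R) @^-1` `[tl a ord0 i, tl b ord0 i])).
    apply: fin_bigcap_measurable => // i _; rewrite -[X in measurable X]setTI.
    by apply: measurable_coord_rV => //; exact: measurable_itv.
  apply/seteqP; split => v /= avb i.
    by move=> _; rewrite /= in_itv/=.
  by have := avb i I; rewrite /= in_itv/=.
rewrite ih; last by move=> i; rewrite !mxE.
have lab : lebesgue_measure `[a ord0 ord0, b ord0 ord0]%classic =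
    (b ord0 ord0 - a ord0 ord0)%:E.
  rewrite lebesgue_measure_itv/= lte_fin; case: ltP => // ba.
  rewrite (@le_anti _ _ (a ord0 ord0) (b ord0 ord0)) ?subrr//.
  by rewrite ab.
rewrite big_ord_recl EFinM; congr (_ * _)%E; first exact: lab.
by congr EFin; apply: eq_bigr => i _; rewrite !mxE.
Qed.

Section diversity.
Local Open Scope ereal_scope.
Context {disp : measure_display} {T : measurableType disp} {R : realType}.
Variables (X : set T) (d : T -> T -> R).

(** Borel probability measures on a measurable subspace [X] of [T] are identified
    with the probability measures on [T] that give [X] full mass. On a compact
    metric space every Borel probability measure is Radon. *)
Definition prob_on : set (probability T R) := [set mu | mu X = 1].

Definition typicality (mu : probability T R) (x : T) : \bar R :=
  \int[mu]_(y in X) (expR (- d x y))%:E.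

(** The value at [q = -oo] is irrelevant: orders are in [0, +oo]. *)
Definition diversity (q : \bar R) (mu : probability T R) : \bar R :=
  match q with
  | r%:E =>
      if r == 1%R then expeR (- \int[mu]_(x in X) lne (typicality mu x))
      else (\int[mu]_(x in X) (typicality mu x `^ (r - 1))) `^ (1 - r)^-1
  | +oo => (ess_sup mu (typicality mu))^-1
  | -oo => 0
  end.

(** The value does not depend on the order [q >= 0], but that is a
    theorem, so the order is kept as a parameter. *)
Definition max_diversity (q : \bar R) : \bar R :=
  ereal_sup [set diversity q mu | mu in prob_on].

End diversity.

Section magnitude.
Context {T : Type} {R : realType}.
Variable d : T -> T -> R.

Definition similarity_mx (m : nat) (x : 'I_m -> T) : 'M[R]_m :=
  \matrix_(i, j) expR (- d (x i) (x j)).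

Definition weighting (m : nat) (x : 'I_m -> T) : set 'cV[R]_m :=
  [set w | similarity_mx x *m w = const_mx 1].

(** Meaningful when the similarity matrix is positive definite (as it is for
    distinct points of a Euclidean space), so that the weighting exists and is
    unique. *)
Definition finite_magnitude (m : nat) (x : 'I_m -> T) : R :=
  \sum_(i < m) xget 0 (weighting x) i ord0.

(** A finite subset of [X] is given by an injective enumeration of its points. *)
Definition magnitude (X : set T) : \bar R :=
  ereal_sup [set y | exists m (x : 'I_m -> T),
    [/\ injective x, forall i, X (x i) & y = (finite_magnitude x)%:E]].

End magnitude.

Definition scale_dist {T : Type} {R : realType} (t : R) (d : T -> T -> R) :
  T -> T -> R := fun x y => t * d x y.

Section euclidean.
Context {R : realType} {n : nat}.

Definition euclidean_dist (x y : 'rV[R]_n) : R :=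
  Num.sqrt (\sum_(i < n) (x ord0 i - y ord0 i) ^+ 2).

Definition unit_ball_volume : \bar R :=
  lebesgue_rV n [set x : 'rV[R]_n | euclidean_dist 0 x <= 1].

(** [\d_0] is only the default used by [mnormalize] when [X] is null (a compact
    set never has infinite volume). *)
Definition normalized_lebesgue (X : set 'rV[R]_n) (cX : compact X) :
    probability 'rV[R]_n R :=
  mnormalize (mrestr (lebesgue_rV n) (compact_measurable_rV cX))
    (@dirac _ 'rV[R]_n 0 R).

End euclidean.
Arguments unit_ball_volume : clear implicits.

(* Main.v *)
Require Import Defs.
From HB Require Import structures.
From mathcomp Require Import all_boot all_order all_algebra.
From mathcomp Require Import all_classical all_reals all_analysis.
From mathcomp Require Import measurable_realfun ess_sup_inf ring lra.

(** The kernel [e^{-|x-y|}] is a nonnegative mixture of the volumes of the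
    intersections [B(x,r) :&: B(y,r)]: in odd dimension [2l+1] the weights are
    obtained by applying [- (1/s) d/ds] repeatedly to an exponential, and an even
    dimension is a slice of the next odd one. Hence the kernel factors as
    [\int phi(x,w) phi(y,w) dw] with [phi >= 0] the indicators of balls.

    If [h >= 0] satisfies [\int phi(x,w) h(w) dw = 1] for all [x] in [X], then by
    Cauchy-Schwarz [\int h^2] bounds both [\int 1/(K mu) dmu], which dominates every
    [D_q mu], and the magnitude of every finite subset of [X]. For the metric [t d],
    take [h] proportional to the volume of the ball, restricted to balls of radius
    less than [t e] whose centre is in [t] times the [e]-neighbourhood [X_e] of [X].
    This gives the bound [t^n lambda(X_e) / (n! omega_n - o(1))].

    Conversely [K lambda_X <= n! omega_n / (t^n lambda(X))] for the normalised measure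
    [lambda_X], because the integral of [e^{-|x|}] over R^n is [n! omega_n]. This
    bounds [D_q lambda_X] from below and, after discretisation of [lambda_X], also the
    magnitude. *)

Set Implicit Arguments.
Unset Strict Implicit.
Unset Printing Implicit Defensive.

Import Order.TTheory GRing.Theory Num.Theory.
Import numFieldNormedType.Exports.

Local Open Scope classical_set_scope.
Local Open Scope ring_scope.
Local Open Scope ereal_scope.

(** Why balls and not a Fourier factorisation: the estimate of \int 1/(K mu) dmu divides by g(w) =
    \int phi(., w) dmu, so the features have to be nonnegative. The origin of h: on all of R^n the
    potential of Lebesgue measure is the constant n! omega_n, and its feature transform \int phi(y,
    (s, z)) dy is sqrt(w s) times the volume of a ball of squared radius b s. Divided by n! omega_n
    it would satisfy the dual identity exactly, but for n > 0 with \int h^2 infinite. Restricting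
    the centres to a bounded set alone would spoil the identity near its boundary. Bounding the
    radii as well confines every ball about a point of t X to the dilated neighbourhood: the
    identity stays exact, and only the constant changes, from n! omega_n to a truncated mass M. For
    fixed e the cut-off t e grows with t, so M tends to n! omega_n. For large t all quantities lie
    between L t^n and (L + eta) t^n with the same L = lambda(X) / (n! omega_n), which gives the
    three limits together. *)

(** * Affine changes of variables for Lebesgue measure *)

Lemma integral_lebesgue_affine (R : realType) (c w : R) (f : measurableTypeR R -> \bar R) :
  (0 < c)%R -> measurable_fun setT f -> (forall x, 0 <= f x) ->
  \int[lebesgue_measure]_x f (c * x + w)%R =
  (c^-1)%:E * \int[lebesgue_measure]_x f x.
Proof.
move=> c0 mf f0; pose phi : measurableTypeR R -> measurableTypeR R :=
  fun x => (c * x + w)%R.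
have mphi : measurable_fun setT phi.
  by apply: measurable_funD => //; apply: measurable_funM.
have ci0 : (0 <= c^-1)%R by rewrite invr_ge0 ltW.
have mc0 : (0 <= c)%R by rewrite ltW.
transitivity (\int[pushforward lebesgue_measure phi]_x f x).
  rewrite ge0_integral_pushforward// ?preimage_setT//.
pose pf : {measure set (measurableTypeR R) -> \bar R} :=
  measure_function_pushforward__canonical__measure_function_Measure
    lebesgue_measure mphi.
(* [c] times the image measure agrees with Lebesgue measure on half-open intervals, hence on all
   measurable sets. *)
pose nu := mscale (NngNum mc0) pf.
have nuE A : measurable A -> lebesgue_measure A = nu A.
  apply: lebesgue_measure_unique => _ [[a b] _ <-] /=.
  rewrite /nu /mscale/= /pf /pushforward/=.
  rewrite (_ : phi @^-1` _ = `]((a - w) / c)%R, ((b - w) / c)%R]%classic); last first.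
    apply/seteqP; split => x /=; rewrite !in_itv/= /phi.
      by rewrite ltr_pdivrMr// ler_pdivlMr// [(x * c)%R]mulrC ltrBlDr lerBrDr.
    by rewrite ltr_pdivrMr// ler_pdivlMr// [(x * c)%R]mulrC ltrBlDr lerBrDr.
  rewrite !lebesgue_measure_itv/= !lte_fin ltr_pM2r ?invr_gt0// ltrD2r.
  case: ifPn => _; last by rewrite mule0.
  rewrite -!EFinD -EFinM; congr EFin.
  by field; rewrite gt_eqF.
have -> : \int[lebesgue_measure]_x f x = \int[nu]_x f x.
  by apply: eq_measure_integral => A mA _; exact: nuE.
rewrite ge0_integral_mscale//= muleA -EFinM mulVf ?gt_eqF// mul1e.
done.
Qed.

Section lebesgue_rV_integral.
Context {R : realType}.

Lemma ge0_integral_rV_cons (n : nat) (f : 'rV[R]_n.+1 -> \bar R) :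
  measurable_fun setT f -> (forall x, 0 <= f x) ->
  \int[lebesgue_rV n.+1]_v f v =
  \int[lebesgue_measure]_u \int[lebesgue_rV n]_z f (rV_cons (u, z)).
Proof.
move=> mf f0.
rewrite -[LHS]/(\int[pushforward (lebesgue_measure \x lebesgue_rV n) (@rV_cons R n)]_v f v).
rewrite ge0_integral_pushforward//; last exact: measurable_rV_cons.
rewrite preimage_setT fubini_tonelli1//.
  exact: (measurableT_comp mf measurable_rV_cons).
by move=> x; exact: f0.
Qed.

Lemma measurable_rV_affine n (c : R) (w : 'rV[R]_n) :
  measurable_fun setT (fun v : 'rV[R]_n => (c *: v + w)%R).
Proof.
apply/measurable_fun_rVP => i; under eq_fun do rewrite !mxE.
apply: measurable_funD => //; apply: measurable_funM => //.
exact: measurable_coord_rV.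
Qed.

Lemma ge0_integral_rV_affine (n : nat) (c : R) (w : 'rV[R]_n)
    (f : 'rV[R]_n -> \bar R) :
  (0 < c)%R -> measurable_fun setT f -> (forall x, 0 <= f x) ->
  \int[lebesgue_rV n]_v f (c *: v + w)%R =
  (c ^- n)%:E * \int[lebesgue_rV n]_v f v.
Proof.
move=> c0; elim: n => [|n ih] in w f *.
  move=> mf f0; rewrite expr0 invr1 mul1e; apply: eq_integral => v _.
  by congr f; apply/rowP => -[].
move=> mf f0; pose tl : 'rV[R]_n := \row_j w ord0 (lift ord0 j).
rewrite !ge0_integral_rV_cons//; last first.
  by apply: (measurableT_comp mf); exact: measurable_rV_affine.
have consE u z : (c *: rV_cons (u, z) + w = rV_cons (c * u + w ord0 ord0, c *: z + tl))%R.
  apply/rowP => i; rewrite !mxE; case: unliftP => [j|] ->.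
    by rewrite /= !mxE.
  by [].
have mfu u : measurable_fun setT (fun z => f (rV_cons (u, z))).
  by apply: (measurableT_comp mf); exact: (measurableT_comp measurable_rV_cons).
under eq_integral do under eq_integral do rewrite consE.
under eq_integral => u _ do rewrite (ih _ (fun z => f (rV_cons (_, z))))//.
have mF := @measurable_fun_fubini_tonelli_F _ _ (measurableTypeR R) _ R (lebesgue_rV n)
  (f \o @rV_cons R n) (measurableT_comp mf measurable_rV_cons) (fun=> f0 _).
have maff : measurable_fun [set: measurableTypeR R]
    (fun u => c * u + w ord0 ord0 : measurableTypeR R)%R.
  by apply: measurable_funD => //; exact: measurable_funM.
rewrite ge0_integralZl_EFin//; first last.
- by rewrite invr_ge0 exprn_ge0// ltW.
- exact: (measurableT_comp mF maff).
- by move=> u _; exact: integral_ge0.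
rewrite (@integral_lebesgue_affine R c (w ord0 ord0)
  (fun u => \int[lebesgue_rV n]_z f (rV_cons (u, z))))//; last first.
  by move=> u; exact: integral_ge0.
by rewrite muleA -EFinM exprS invfM mulrC.
Qed.

End lebesgue_rV_integral.

(** * Balls, boxes and linear isometries of R^n *)

Section sqn.
Context {R : realType}.

Definition sqn n (v : 'rV[R]_n) : R := (\sum_i v ord0 i ^+ 2)%R.

(** The parameter [b] is the squared radius: slicing a ball at height u replaces [b] by b - u^2,
    which may be negative, and then the slice is empty. *)
Definition sball n (x : 'rV[R]_n) (b : R) : set 'rV[R]_n :=
  [set z | (sqn (z - x) <= b)%R].

Lemma sqn_ge0 n (v : 'rV[R]_n) : (0 <= sqn v)%R.
Proof. by apply: sumr_ge0 => i _; exact: sqr_ge0. Qed.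

Lemma sqn0 n : sqn (0 : 'rV[R]_n) = 0%R.
Proof. by apply: big1 => i _; rewrite mxE expr0n. Qed.

Lemma sqnN n (v : 'rV[R]_n) : sqn (- v) = sqn v.
Proof. by apply: eq_bigr => i _; rewrite mxE sqrrN. Qed.

Lemma sqnZ n c (v : 'rV[R]_n) : sqn (c *: v) = (c ^+ 2 * sqn v)%R.
Proof.
by rewrite /sqn big_distrr/=; apply: eq_bigr => i _; rewrite mxE exprMn.
Qed.

Lemma sqn_eq0 n (v : 'rV[R]_n) : (sqn v == 0%R) = (v == 0%R).
Proof.
apply/eqP/eqP => [|->]; last exact: sqn0.
move=> /eqP; rewrite psumr_eq0; last by move=> i _; exact: sqr_ge0.
move=> /allP v0; apply/rowP => i; rewrite mxE; apply/eqP.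
by have := v0 i (mem_index_enum _); rewrite /= sqrf_eq0.
Qed.

Lemma sqn_rV_cons n (p : measurableTypeR R * 'rV[R]_n) :
  sqn (rV_cons p) = (p.1 ^+ 2 + sqn p.2)%R.
Proof.
rewrite /sqn big_ord_recl rV_cons0; congr (_ + _)%R.
by apply: eq_bigr => i _; rewrite rV_consS.
Qed.

Lemma euclidean_distE n (x y : 'rV[R]_n) : euclidean_dist x y = Num.sqrt (sqn (x - y)).
Proof. by congr Num.sqrt; apply: eq_bigr => i _; rewrite !mxE. Qed.

Lemma measurable_sqn d (T : measurableType d) n (f : T -> 'rV[R]_n) :
  measurable_fun setT f -> measurable_fun setT (fun t => sqn (f t) : measurableTypeR R).
Proof.
move=> mf; apply: measurable_sum => i; apply: measurable_funX.
exact: (measurableT_comp (measurable_coord_rV i) mf).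
Qed.

Lemma measurable_rVD d (T : measurableType d) n (f g : T -> 'rV[R]_n) :
  measurable_fun setT f -> measurable_fun setT g ->
  measurable_fun setT (fun t => f t + g t)%R.
Proof.
move=> mf mg; apply/measurable_fun_rVP => i; under eq_fun do rewrite mxE.
by apply: measurable_funD; [exact: (measurableT_comp (measurable_coord_rV i) mf)|
   exact: (measurableT_comp (measurable_coord_rV i) mg)].
Qed.

Lemma measurable_rVZ d (T : measurableType d) n (c : R) (f : T -> 'rV[R]_n) :
  measurable_fun setT f ->
  measurable_fun setT (fun t => c *: f t)%R.
Proof.
move=> mf; apply/measurable_fun_rVP => i; under eq_fun do rewrite mxE.
by apply: measurable_funM => //; exact: (measurableT_comp (measurable_coord_rV i) mf).
Qed.

Lemma measurable_rVN d (T : measurableType d) n (f : T -> 'rV[R]_n) :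
  measurable_fun setT f -> measurable_fun setT (fun t => - f t)%R.
Proof.
by move=> mf; under eq_fun do rewrite -scaleN1r; exact: measurable_rVZ.
Qed.

Lemma measurable_rVB d (T : measurableType d) n (f g : T -> 'rV[R]_n) :
  measurable_fun setT f -> measurable_fun setT g ->
  measurable_fun setT (fun t => f t - g t)%R.
Proof. by move=> mf mg; apply: measurable_rVD => //; exact: measurable_rVN. Qed.

Lemma measurable_le_set d (T : measurableType d) (f g : T -> measurableTypeR R) :
  measurable_fun setT f -> measurable_fun setT g ->
  measurable [set t | (f t <= g t)%R].
Proof.
move=> mf mg; rewrite -[X in measurable X]setTI.
have := measurable_fun_ler mf mg => /(_ measurableT [set true]).
exact.
Qed.

Lemma measurable_sball n (x : 'rV[R]_n) b : measurable (sball x b).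
Proof.
by apply: measurable_le_set => //; apply: measurable_sqn; apply: measurable_rVB.
Qed.

Lemma measurable_preimT d1 d2 (T1 : measurableType d1) (T2 : measurableType d2)
    (f : T1 -> T2) A : measurable_fun setT f -> measurable A -> measurable (f @^-1` A).
Proof. by move=> mf mA; rewrite -[X in measurable X]setTI; exact: mf. Qed.

Lemma lebesgue_rV_affine n (c : R) (w : 'rV[R]_n) A : (0 < c)%R -> measurable A ->
  lebesgue_rV n [set v | A (c *: v + w)%R] = (c ^- n)%:E * lebesgue_rV n A.
Proof.
move=> c0 mA.
have mA' : measurable [set v | A (c *: v + w)%R].
  exact: (measurable_preimT (measurable_rV_affine c w) mA).
have lamE B : measurable B -> lebesgue_rV n B = \int[lebesgue_rV n]_x (\1_B x)%:E.
  by move=> mB; rewrite integral_indic// setIT.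
rewrite !lamE//.
rewrite -(@ge0_integral_rV_affine R n c w (EFin \o \1_A) c0)//.
- by apply/measurable_EFinP; exact: measurable_indic.
- by move=> x; rewrite lee_fin.
Qed.

Definition ballvol n : \bar R := lebesgue_rV n (sball 0 1).

Lemma unit_ball_volumeE n : unit_ball_volume R n = ballvol n.
Proof.
congr (lebesgue_rV n _); apply/seteqP; split => x /=.
  rewrite /sball/= euclidean_distE sub0r sqnN subr0 => x1.
  by rewrite -(sqr_sqrtr (sqn_ge0 x)) -(expr1n _ 2) ler_sqr ?nnegrE ?sqrtr_ge0.
rewrite /sball/= euclidean_distE sub0r sqnN subr0 => x1.
by rewrite -[leRHS]sqrtr1 ler_wsqrtr.
Qed.

(** Boxes have an explicit volume. A ball lies between two of them, so [ballvol] is finite and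
    positive. *)
Definition rbox n (x : 'rV[R]_n) (r : R) :=
  [set v : 'rV[R]_n | forall i, (x - const_mx r)%R ord0 i <= v ord0 i <= (x + const_mx r)%R ord0 i]%R.

Lemma lebesgue_rbox n (x : 'rV[R]_n) (r : R) : (0 <= r)%R ->
  lebesgue_rV n (rbox x r) = ((2 * r) ^+ n)%:E.
Proof.
move=> r0; rewrite lebesgue_rV_itv; last first.
  by move=> i; rewrite !mxE lerD2l ge0_cp.
rewrite -[X in (_ ^+ X)%R](card_ord n) -prodr_const; congr EFin.
by apply: eq_bigr => i _; rewrite !mxE; ring.
Qed.

Lemma measurable_rbox n (x : 'rV[R]_n) (r : R) : measurable (rbox x r).
Proof.
rewrite (_ : rbox x r = \bigcap_(i in [set: 'I_n])
  ((fun v : 'rV[R]_n => v ord0 i : measurableTypeR R) @^-1`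
     `[((x - const_mx r)%R ord0 i), ((x + const_mx r)%R ord0 i)])).
  apply: fin_bigcap_measurable => // i _; apply: measurable_preimT.
    exact: measurable_coord_rV.
  exact: measurable_itv.
apply/seteqP; split => v /= avb i.
  by move=> _; rewrite /= in_itv/=.
by have := avb i I; rewrite /= in_itv/=.
Qed.

Lemma sball_sub_rbox n (x : 'rV[R]_n) (r : R) : (0 <= r)%R ->
  sball x (r ^+ 2) `<=` rbox x r.
Proof.
move=> r0 v; rewrite /sball/= => vr i.
have : ((v - x) ord0 i ^+ 2 <= r ^+ 2)%R.
  apply: le_trans vr; rewrite /sqn (bigD1 i)//= lerDl.
  by apply: sumr_ge0 => j _; exact: sqr_ge0.
rewrite -[leLHS]real_normK ?num_real// ler_sqr ?nnegrE// ler_norml !mxE => /andP[].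
by move=> h1 h2; apply/andP; split; lra.
Qed.

Lemma rbox_sub_sball n (x : 'rV[R]_n) (r : R) : (0 <= r)%R ->
  rbox x r `<=` sball x (n%:R * r ^+ 2).
Proof.
move=> r0 v vr; rewrite /sball/= /sqn -[X in X%:R](card_ord n) mulr_natl -sumr_const.
apply: ler_sum => i _.
rewrite -[leLHS]real_normK ?num_real// ler_sqr ?nnegrE// ler_norml.
have := vr i; rewrite !mxE => /andP[h1 h2].
by apply/andP; split; lra.
Qed.

Lemma ballvol_fin_num n : ballvol n \is a fin_num.
Proof.
rewrite ge0_fin_numE//; apply: (@le_lt_trans _ _ (lebesgue_rV n (rbox 0 1))).
  apply: le_measure; rewrite ?inE; [exact: measurable_sball|exact: measurable_rbox|].
  by have := @sball_sub_rbox n 0 1 ler01; rewrite expr1n.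
by rewrite lebesgue_rbox// ltry.
Qed.

Lemma ballvol_gt0 n : 0 < ballvol n.
Proof.
(* The box of half-side 1/(n+1) fits into the unit ball since n/(n+1)^2 <= 1; n+1 in place of n
   covers dimension 0. *)
have r0 : (0 < n.+1%:R^-1 :> R)%R by rewrite invr_gt0.
apply: (@lt_le_trans _ _ (lebesgue_rV n (rbox 0 n.+1%:R^-1))).
  by rewrite lebesgue_rbox 1?ltW// lte_fin exprn_gt0// mulr_gt0.
apply: le_measure; rewrite ?inE; [exact: measurable_rbox|exact: measurable_sball|].
apply: subset_trans (rbox_sub_sball (ltW r0)) _ => v; rewrite /sball/= => /le_trans; apply.
rewrite expr2 mulrA -ler_pdivlMr// invrK mul1r ler_pdivrMr//.
rewrite -natrM ler_nat.
by rewrite (leq_trans (leqnSn n))// leq_pmulr.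
Qed.

Lemma lebesgue_sball n (x : 'rV[R]_n) b : (0 <= b)%R ->
  lebesgue_rV n (sball x b) = (Num.sqrt b ^+ n)%:E * ballvol n.
Proof.
(* At b = 0 the dilation by sqrt b degenerates; the ball is then a box of volume 0^n, which is 1 for
   n = 0. *)
rewrite le_eqVlt => /predU1P[<-|b0].
  rewrite (_ : sball x 0 = rbox x 0).
    rewrite lebesgue_rbox// mulr0 sqrtr0; case: n x => [|n] x; last by rewrite expr0n mul0e.
    rewrite expr0 mul1e /ballvol.
    have := @lebesgue_rbox 0 0 0 (lexx _); rewrite expr0 => <-.
    congr (lebesgue_rV _ _); apply/seteqP; split => v //= _.
      by rewrite /sball /= /sqn big_ord0.
    by move=> [].
  apply/seteqP; split => v.
    by move=> v0; apply: sball_sub_rbox => //; rewrite expr0n.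
  by move=> /(rbox_sub_sball (lexx _)); rewrite expr0n/= mulr0.
have s0 : (0 < Num.sqrt b)%R by rewrite sqrtr_gt0.
have := @lebesgue_rV_affine n (Num.sqrt b) x _ s0 (measurable_sball x b).
rewrite (_ : [set v | _] = sball 0 1).
  move=> h; rewrite /ballvol h muleA -EFinM mulfV ?mul1e//.
  by rewrite expf_neq0// gt_eqF.
have E (s : R) : (b * s <= b)%R = (s <= 1)%R by rewrite -{2}[b]mulr1 ler_pM2l.
by apply/seteqP; split => v /=;
  rewrite /sball/= addrK sqnZ subr0 sqr_sqrtr ?(ltW b0)// E.
Qed.

Lemma sball_neg n (x : 'rV[R]_n) b : (b < 0)%R -> sball x b = set0.
Proof.
move=> b0; apply/seteqP; split => v //=; rewrite /sball/= => h.
by have := le_lt_trans (le_trans (sqn_ge0 _) h) b0; rewrite ltxx.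
Qed.

Section isometry.
Variables (n : nat) (H : 'rV[R]_n -> 'rV[R]_n).
Hypotheses (mH : measurable_fun setT H) (HB : {morph H : x y / x - y >-> x - y}%R).
Hypotheses (HK : involutive H) (Hsqn : forall x, sqn (H x) = sqn x).

(* Haar-type uniqueness: Tonelli applied to [1_A (H x) * 1_B (y + H x)], with [B] the
   unit ball, which [H] preserves. *)
Lemma lebesgue_rV_isometry_opp A : measurable A ->
  lebesgue_rV n (H @^-1` A) = lebesgue_rV n [set v | A (- v)%R].
Proof.
move=> mA; pose B : set 'rV[R]_n := sball 0 1.
have mB : measurable B by exact: measurable_sball.
pose f (p : 'rV[R]_n * 'rV[R]_n) : \bar R := (\1_A (H p.1) * \1_B (p.2 + H p.1))%:E.
have mind C (mC : measurable C) (d : measure_display) (T : measurableType d) (g : T -> 'rV[R]_n) :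
    measurable_fun setT g -> measurable_fun setT (fun t => \1_C (g t) : R).
  by move=> mg; exact: (measurableT_comp (measurable_indic mC) mg).
have mf : measurable_fun setT f.
  apply/measurable_EFinP; apply: measurable_funM; apply: mind => //.
    exact: (measurableT_comp mH measurable_fst).
  apply: measurable_rVD; first exact: measurable_snd.
  exact: (measurableT_comp mH measurable_fst).
have f0 p : 0 <= f p by rewrite lee_fin mulr_ge0.
have lamE C : measurable C ->
    \int[lebesgue_rV n]_x (\1_C x : R)%:E = lebesgue_rV n C.
  by move=> mC; rewrite integral_indic// setIT.
have trE (g : 'rV[R]_n -> R) w : measurable_fun setT g -> (forall v, 0 <= g v)%R ->
    \int[lebesgue_rV n]_v (g (v + w)%R)%:E = \int[lebesgue_rV n]_v (g v)%:E.
  move=> mg g0; have := @ge0_integral_rV_affine R n 1 w (EFin \o g) ltr01.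
  under eq_integral do rewrite scale1r.
  rewrite expr1n invr1 mul1e; apply; first exact/measurable_EFinP.
  by move=> x; rewrite lee_fin.
have I1 : \int[lebesgue_rV n]_x \int[lebesgue_rV n]_y f (x, y) =
    lebesgue_rV n (H @^-1` A) * lebesgue_rV n B.
  under eq_integral.
    move=> x _; rewrite /f/=; under eq_integral do rewrite EFinM.
    rewrite ge0_integralZl_EFin//; last first.
      by apply/measurable_EFinP; apply: mind => //; exact: measurable_rVD.
    rewrite (@trE \1_B (H x) (measurable_indic mB))// lamE//; over.
  rewrite ge0_integralZr//; last first.
    by apply/measurable_EFinP; exact: mind.
  by rewrite -(lamE (H @^-1` A))//; exact: measurable_preimT.
have I2 : \int[lebesgue_rV n]_x \int[lebesgue_rV n]_y f (x, y) =
    lebesgue_rV n [set v | A (- v)%R] * lebesgue_rV n B.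
  rewrite (fubini_tonelli f)//.
  pose g (p : 'rV[R]_n * 'rV[R]_n) : \bar R := (\1_A (H p.1 - p.2) * \1_B (H p.1))%:E.
  have mg : measurable_fun setT g.
    apply/measurable_EFinP; apply: measurable_funM; apply: mind => //.
      apply: measurable_rVB; last exact: measurable_snd.
      exact: (measurableT_comp mH measurable_fst).
    exact: (measurableT_comp mH measurable_fst).
  have g0 p : 0 <= g p by rewrite lee_fin mulr_ge0.
  transitivity (\int[lebesgue_rV n]_y \int[lebesgue_rV n]_x g (x, y)).
    apply: eq_integral => y _.
    (* Translating x by - H y turns H x into H x - y, because H (H y) = y; then y + H x becomes H
       x. *)
    rewrite -(@trE (fun x => \1_A (H x) * \1_B (y + H x))%R (- H y)%R)//.
    - apply: eq_integral => x _; rewrite /g/= HB HK.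
      by rewrite addrCA subrr addr0.
    - apply: measurable_funM; apply: mind => //.
      exact: measurable_rVD.
  rewrite -(fubini_tonelli g)//.
  under eq_integral.
    move=> x _; rewrite /g/=; under eq_integral do rewrite EFinM.
    rewrite ge0_integralZr//; last first.
      by apply/measurable_EFinP; apply: mind => //; exact: measurable_rVB.
    rewrite (_ : \int[lebesgue_rV n]_y (\1_A (H x - y))%:E =
       \int[lebesgue_rV n]_y (\1_A (- y))%:E); last first.
      rewrite -[RHS](@trE (fun y => \1_A (- y)%R) (- H x)%R)//.
        by apply: eq_integral => y _; rewrite opprB.
      by apply: mind => //; exact: measurable_rVN.
    rewrite (_ : \1_B (H x) = \1_B x); last first.
      by rewrite !indicE; congr ((_ : bool)%:R); apply/idP/idP; rewrite !inE /B /sball/= !subr0 Hsqn.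
    over.
  rewrite ge0_integralZl//; last first.
    - by apply: integral_ge0 => x _; rewrite lee_fin.
    - by apply/measurable_EFinP; exact: measurable_indic.
  congr (_ * _); last exact: lamE.
  apply: (lamE [set v | A (- v)%R]).
  by apply: (measurable_preimT _ mA); exact: measurable_rVN.
have leE := lee_pmul2r (ballvol_fin_num n) (ballvol_gt0 n).
have E : lebesgue_rV n (H @^-1` A) * ballvol n =
    lebesgue_rV n [set v | A (- v)%R] * ballvol n.
  by rewrite -[ballvol n]/(lebesgue_rV n B) -I1.
by apply/le_anti/andP; split; rewrite -leE E.
Qed.

End isometry.

(** The preimage of [A] under any admissible [H] has the volume of the reflected set -A. The
    identity is admissible too, so -A has the volume of [A]. *)
Lemma lebesgue_rV_isometry n (H : 'rV[R]_n -> 'rV[R]_n) A :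
  measurable_fun setT H -> {morph H : x y / x - y >-> x - y}%R ->
  involutive H -> (forall x, sqn (H x) = sqn x) -> measurable A ->
  lebesgue_rV n (H @^-1` A) = lebesgue_rV n A.
Proof.
move=> mH HB HK Hs mA; rewrite lebesgue_rV_isometry_opp//.
by rewrite -(@lebesgue_rV_isometry_opp n id).
Qed.

Definition householder n (w v : 'rV[R]_n) : 'rV[R]_n :=
  (v - (2 * (\sum_i v ord0 i * w ord0 i) / sqn w) *: w)%R.

(** The Householder reflection along x - y fixes 0 and swaps two vectors of equal norm. Hence the
    volume depends only on the norm of x, and x may be moved to the first axis, where the
    intersection can be sliced. *)
Lemma lebesgue_sballI n (x y : 'rV[R]_n) b : sqn x = sqn y ->
  lebesgue_rV n (sball 0 b `&` sball x b) = lebesgue_rV n (sball 0 b `&` sball y b).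
Proof.
move=> xy; have [->//|nxy] := eqVneq x y.
pose w := (x - y)%R; pose dot (u v : 'rV[R]_n) := (\sum_i u ord0 i * v ord0 i)%R.
have w0 : sqn w != 0%R by rewrite sqn_eq0 subr_eq0.
pose H := householder w.
have dotB u v z : dot (u - v)%R z = (dot u z - dot v z)%R.
  by rewrite /dot -sumrB; apply: eq_bigr => i _; rewrite !mxE mulrBl.
have dotZ c v z : dot (c *: v)%R z = (c * dot v z)%R.
  by rewrite /dot big_distrr/=; apply: eq_bigr => i _; rewrite !mxE mulrA.
have dotZr c v z : dot v (c *: z)%R = (c * dot v z)%R.
  by rewrite /dot big_distrr/=; apply: eq_bigr => i _; rewrite !mxE mulrCA.
have dotww : dot w w = sqn w by apply: eq_bigr => i _; rewrite expr2.
have sqnB u v : sqn (u - v)%R = (sqn u - 2 * dot u v + sqn v)%R.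
  rewrite /sqn /dot big_distrr/= -sumrB -big_split; apply: eq_bigr => i _.
  by rewrite !mxE/=; ring.
have HB : {morph H : u v / u - v >-> u - v}%R.
  move=> u v; rewrite /H /householder -!/(dot _ _) dotB.
  by apply/rowP => i; rewrite !mxE; ring.
have HK : involutive H.
  move=> v; rewrite /H /householder -!/(dot _ _) dotB dotZ dotww.
  by apply/rowP => i; rewrite !mxE; field.
have Hs v : sqn (H v) = sqn v.
  rewrite /H /householder -!/(dot _ _) sqnB sqnZ.
  by rewrite dotZr; field.
have mH : measurable_fun setT H.
  apply: measurable_rVB => //; apply/measurable_fun_rVP => i.
  under eq_fun do rewrite mxE.
  apply: measurable_funM => //; apply: measurable_funM => //; apply: measurable_funM => //.
  by apply: measurable_sum => j; apply: measurable_funM => //; exact: measurable_coord_rV.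
have Hx : H x = y.
  have : (2 * dot x w = sqn w)%R.
    have := sqnB x w; rewrite /w opprB addrCA subrr addr0 -xy -/w => h.
    by lra.
  rewrite /H /householder -!/(dot _ _) => ->; rewrite divff// scale1r /w.
  by rewrite opprB addrCA subrr addr0.
have Hy : H y = x by rewrite -Hx HK.
have H0 : H 0%R = 0%R by rewrite -[in LHS](subrr (0 : 'rV[R]_n)%R) HB subrr.
rewrite -[RHS](@lebesgue_rV_isometry n H)//; last by apply: measurableI; exact: measurable_sball.
congr (lebesgue_rV n _); rewrite preimage_setI; congr (_ `&` _).
  apply/seteqP; split => v; rewrite /sball/= !subr0 Hs//.
by apply/seteqP; split => v; rewrite /sball/= -Hx -HB Hs.
Qed.

End sqn.

(** * Weights of the mixture and one-dimensional exponential integrals *)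

Section bessel.
Local Open Scope ring_scope.
Context {R : realType}.

(* Reverse Bessel polynomials: [bessel_exp 0 s = e^{-2s}] and
   [bessel_exp j.+1 s = - (bessel_exp j)' s / s] (see [is_derive_bessel_exp]). *)
Fixpoint bessel_poly (j : nat) : {poly R} :=
  if j is j'.+1 then ('X * (2%:P * bessel_poly j') + 'X^3 * (bessel_poly j')^`())%R else 1%R.

Definition bessel_exp j (s : R) : R := expR (- 2 * s) * (bessel_poly j).[s^-1].

(** Up to a constant, the volume of a 2j-dimensional ball of squared radius s^2 - u^2. The constant
    makes the derivative in s of the (j+1)-st function equal to s times the j-th one. *)
Definition sqdiff_pow (u : R) j (s : R) : R := (s ^+ 2 - u ^+ 2) ^+ j / (2 ^+ j * j`!%:R).

(** The recursion only adds, differentiates and multiplies by powers of X and by 2. The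
    nonnegativity of the mixture weights rests on this. *)
Lemma bessel_poly_coef_ge0 j i : 0 <= (bessel_poly j)`_i.
Proof.
elim: j i => [|j ih] i /=; first by rewrite coef1; case: eqP.
rewrite coefD coefXM coefCM coefXnM coef_deriv addr_ge0//.
  by case: ifP => // _; rewrite mulr_ge0.
by case: ifP => // _; rewrite mulrn_wge0.
Qed.

Lemma bessel_poly_ge0 j x : 0 <= x -> 0 <= (bessel_poly j).[x].
Proof.
move=> x0; rewrite horner_coef; apply: sumr_ge0 => i _.
by rewrite mulr_ge0 ?bessel_poly_coef_ge0// exprn_ge0.
Qed.

Lemma bessel_poly_le j x y : 0 <= x -> x <= y -> (bessel_poly j).[x] <= (bessel_poly j).[y].
Proof.
move=> x0 xy; rewrite !horner_coef; apply: ler_sum => i _.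
by rewrite ler_wpM2l ?bessel_poly_coef_ge0// lerXn2r// ?nnegrE// (le_trans x0).
Qed.

Lemma bessel_exp_ge0 j s : 0 <= s -> 0 <= bessel_exp j s.
Proof. by move=> s0; rewrite mulr_ge0 ?expR_ge0// bessel_poly_ge0// invr_ge0. Qed.

Implicit Types f g : R -> R.

Let drvM f g (x df dg : R) : is_derive x (1:R) f df -> is_derive x (1:R) g dg ->
  is_derive x (1:R) (fun y => f y * g y) (df * g x + f x * dg).
Proof.
move=> fx gx; apply: (is_derive_eq (is_deriveM fx gx)).
by rewrite /GRing.scale/= addrC [df * _]mulrC.
Qed.

Let drvMl c g (x dg : R) : is_derive x (1:R) g dg ->
  is_derive x (1:R) (fun y => c * g y) (c * dg).
Proof. by move=> gx; have := drvM (is_derive_cst c x 1) gx; rewrite mul0r add0r. Qed.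

Let drvc f g (x df dg : R) : is_derive (g x) (1:R) f df -> is_derive x (1:R) g dg ->
  is_derive x (1:R) (fun y => f (g y)) (df * dg).
Proof. by move=> fx gx; exact: is_derive1_comp. Qed.

Let drvid (x : R) : is_derive x (1:R) (fun y : R => y) 1.
Proof. exact: is_derive_id. Qed.

Lemma is_derive_bessel_exp j s : s != 0 -> is_derive s (1:R) (bessel_exp j) (- s * bessel_exp j.+1 s).
Proof.
move=> s0.
have di : is_derive s (1:R) (fun x : R => x^-1) (- s ^- 2).
  by have := is_deriveV s0 (drvid s); rewrite /GRing.scale/= mulr1.
have dh := drvc (is_derive_poly (bessel_poly j) s^-1) di.
have de := drvc (is_derive_expR (- 2 * s)) (drvMl (- 2) (drvid s)).
apply: (is_derive_eq (drvM de dh)).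
rewrite /bessel_exp /= !hornerE/=.
by field.
Qed.

Lemma is_derive_sqdiff_pow u j s : is_derive s (1:R) (sqdiff_pow u j.+1) (s * sqdiff_pow u j s).
Proof.
have dX := drvc (is_derive_poly 'X^(j.+1) ('X^2 - (u ^+ 2)%:P).[s])
  (is_derive_poly ('X^2 - (u ^+ 2)%:P) s).
have := drvMl (2 ^+ j.+1 * j.+1`!%:R)^-1 dX.
rewrite (_ : (fun _ => _) = sqdiff_pow u j.+1); last first.
  by apply/funext => y; rewrite /sqdiff_pow !hornerE/= mulrC.
move=> h; apply: (is_derive_eq h).
rewrite /sqdiff_pow derivB !derivXn derivC !hornerE/= factS natrM exprS !hornerMn !hornerXn !hornerE/=.
rewrite -mulr_natl; field.
by rewrite nat1r !pnatr_eq0 -lt0n fact_gt0 expf_neq0// mulr1 pnatr_eq0.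
Qed.


Let G u l s := \sum_(j < l.+1) sqdiff_pow u j s * bessel_exp j s.

Let is_derive_G u l s : s != 0 ->
  is_derive s (1:R) (G u l) (- (s * sqdiff_pow u l s * bessel_exp l.+1 s)).
Proof.
move=> s0; elim: l => [|l ih].
  rewrite (_ : G u 0 = bessel_exp 0); last first.
    by apply/funext => y; rewrite /G big_ord1 /sqdiff_pow expr0 fact0 mul1r expr0 mul1r invr1 mul1r.
  apply: (is_derive_eq (is_derive_bessel_exp 0 s0)).
  by rewrite /sqdiff_pow expr0 fact0 expr0 !mul1r invr1 mulr1 mulNr.
rewrite (_ : G u l.+1 = (fun y => G u l y + sqdiff_pow u l.+1 y * bessel_exp l.+1 y)); last first.
  by apply/funext => y; rewrite /G big_ord_recr.
have := is_deriveD ih (drvM (is_derive_sqdiff_pow u l s) (is_derive_bessel_exp l.+1 s0)).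
move=> h; apply: (is_derive_eq h); ring.
Qed.

Lemma exprM_expRN_cvg0 k : s ^+ k * expR (- s) @[s --> +oo] --> (0 : R).
Proof.
(* The majorant comes from s^(k+1) / (k+1)! <= e^s. *)
apply: (@squeeze_cvgr _ _ _ _ (fun=> 0) (fun s : R => k.+1`!%:R * s^-1)).
- near=> s; have s0 : 0 < s by near: s; apply: nbhs_pinfty_gt; rewrite num_real.
  rewrite mulr_ge0 ?exprn_ge0 ?expR_ge0 ?(ltW s0)//=.
  rewrite expRN ler_pdivrMr ?expR_gt0//.
  rewrite mulrAC ler_pdivlMr// -exprSr mulrC -ler_pdivrMr ?ltr0n ?fact_gt0//.
  by apply: le_trans (expR_ge1Dxn k (ltW s0)); rewrite lerDr.
- exact: cvg_cst.
- rewrite -[X in _ --> X](mulr0 (k.+1`!%:R)); apply: cvgMl_tmp.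
  apply/(@gtr0_cvgV0 R _ _ _ id); last exact: cvg_id.
  by near=> s; near: s; apply: nbhs_pinfty_gt; rewrite num_real.
Unshelve. all: by end_near. Qed.

Let term_cvg u j : sqdiff_pow u j s * bessel_exp j s @[s --> +oo] --> (0 : R).
Proof.
(* For s >= 1 a polynomial in 1/s with nonnegative coefficients is at most its value at 1, and
   e^{-2s} <= e^{-s}. *)
pose c : R := (bessel_poly j).[1] / (2 ^+ j * j`!%:R).
apply: (@squeeze_cvgr _ _ _ _ (fun=> 0) (fun s : R => c * (s ^+ (2 * j) * expR (- s)))).
- near=> s.
  have s1 : 1 <= s by near: s; apply: nbhs_pinfty_ge; rewrite num_real.
  have us : `|u| <= s by near: s; apply: nbhs_pinfty_ge; rewrite num_real.
  have s0 : 0 <= s by rewrite (le_trans _ s1).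
  have u2s : u ^+ 2 <= s ^+ 2 by rewrite -[leLHS]real_normK ?num_real// lerXn2r ?nnegrE.
  have f0 : 0 <= (2 ^+ j * j`!%:R)^-1 :> R by rewrite invr_ge0 mulr_ge0// exprn_ge0.
  have p0 : 0 <= (s ^+ 2 - u ^+ 2) ^+ j by rewrite exprn_ge0// subr_ge0.
  rewrite !mulr_ge0 ?expR_ge0 ?bessel_poly_ge0 ?invr_ge0//=.
  rewrite [leRHS](_ : _ = (s ^+ 2) ^+ j / (2 ^+ j * j`!%:R) * (expR (- s) * (bessel_poly j).[1])); last first.
    by rewrite -exprM /c; ring.
  apply: ler_pM.
  + by rewrite mulr_ge0.
  + by rewrite mulr_ge0 ?expR_ge0 ?bessel_poly_ge0 ?invr_ge0.
  + by rewrite ler_wpM2r// lerXn2r ?nnegrE ?subr_ge0 ?sqr_ge0// gerBl sqr_ge0.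
  + apply: ler_pM; rewrite ?expR_ge0 ?bessel_poly_ge0 ?invr_ge0//.
      by rewrite ler_expR; lra.
    by apply: bessel_poly_le; rewrite ?invr_ge0// invf_le1// (lt_le_trans ltr01).
- exact: cvg_cst.
- by rewrite -[X in _ --> X](mulr0 c); apply: cvgMl_tmp; exact: exprM_expRN_cvg0.
Unshelve. all: by end_near. Qed.

Let G_cvg u l : G u l s @[s --> +oo] --> (0 : R).
Proof.
elim: l => [|l ih].
  rewrite (_ : G u 0 = (fun y => sqdiff_pow u 0 y * bessel_exp 0 y)); first exact: term_cvg.
  by apply/funext => y; rewrite /G big_ord1.
rewrite (_ : G u l.+1 = (fun y => G u l y + sqdiff_pow u l.+1 y * bessel_exp l.+1 y)); last first.
  by apply/funext => y; rewrite /G big_ord_recr.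
by rewrite -[X in _ --> X](addr0 (0:R)); apply: cvgD => //; exact: term_cvg.
Qed.

(* An antiderivative of the integrand is [- \sum_(j <= l) sqdiff_pow u j * bessel_exp j],
   whose derivative telescopes. *)
Lemma integral_sqdiff_pow_bessel_exp u l : 0 < u ->
  (\int[lebesgue_measure]_(s in `[u, +oo[) (s * sqdiff_pow u l s * bessel_exp l.+1 s)%:E =
  (expR (- 2 * u))%:E)%E.
Proof.
move=> u0.
have GE : G u l u = expR (- 2 * u).
  rewrite /G big_ord_recl big1 => [|i _].
    by rewrite /sqdiff_pow/= expr0 fact0 expr0 !mul1r invr1 mul1r /bessel_exp -[bessel_poly 0]/1 !hornerE.
  by rewrite /sqdiff_pow /= subrr expr0n/= !mul0r.
have dF s : s != 0 -> is_derive s (1:R) (fun y => - G u l y) (s * sqdiff_pow u l s * bessel_exp l.+1 s).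
  by move=> s0; have := is_deriveN (is_derive_G u l s0); rewrite opprK.
have gt0 s : u <= s -> s != 0 by move=> us; rewrite gt_eqF// (lt_le_trans u0).
have cF s : s != 0 -> {for s, continuous (fun y => - G u l y)}.
  by move=> /dF ?; apply/differentiable_continuous/derivable1_diffP; exact: ex_derive.
rewrite (@ge0_continuous_FTC2y _ _ (fun y => - G u l y) u 0).
- by rewrite GE sub0e -EFinN opprK.
- move=> s us; rewrite !mulr_ge0//.
  + by rewrite (le_trans _ us)// ltW.
  + rewrite exprn_ge0// subr_ge0 lerXn2r// ?nnegrE ?(ltW u0)//.
    by rewrite (le_trans _ us)// ltW.
  + by rewrite bessel_poly_ge0// invr_ge0 (le_trans _ us)// ltW.
- apply: continuous_in_subspaceT => s; rewrite inE/= in_itv/= andbT => us.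
  have s0 := gt0 _ us.
  have [d dpw] : exists d, is_derive s (1:R) (sqdiff_pow u l) d.
    case: (l) => [|l']; last by eexists; exact: is_derive_sqdiff_pow.
    exists 0; rewrite (_ : sqdiff_pow u 0 = cst 1); first exact: is_derive_cst.
    by apply/funext => y; rewrite /sqdiff_pow expr0 fact0 expr0 !mul1r invr1.
  have ? := drvM (drvM (drvid s) dpw) (is_derive_bessel_exp l.+1 s0).
  by apply/differentiable_continuous/derivable1_diffP; exact: ex_derive.
- by rewrite -oppr0; apply: cvgN; exact: G_cvg.
- by move=> s us; have ? := dF s (gt0 s (ltW us)); exact: ex_derive.
- by apply: cvg_at_right_filter; apply: cF; exact: gt0.
- move=> s; rewrite in_itv/= andbT => us; rewrite derive1E.
  by have ? := dF s (gt0 s (ltW us)); exact: derive_val.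
Qed.


(** The upper incomplete gamma function Gamma(n+1, s), the integral of x^n e^{-x} over [s, +oo[, by
    the recursion that integration by parts yields. *)
Fixpoint igamma n (s : R) : R :=
  if n is n'.+1 then n%:R * igamma n' s + s ^+ n * expR (- s) else expR (- s).

Let drvXn n (s : R) : is_derive s (1:R) (fun y => y ^+ n) (n%:R * s ^+ n.-1).
Proof.
rewrite (_ : (fun y => _) = horner 'X^n); last first.
  by apply/funext => y; rewrite hornerXn.
by apply: (is_derive_eq (is_derive_poly 'X^n s)); rewrite derivXn hornerMn hornerXn mulr_natl.
Qed.

Let drv_expRN (s : R) : is_derive s (1:R) (fun y => expR (- y)) (- expR (- s)).
Proof.
rewrite (_ : (fun y => _) = (fun y => expR (-1 * y))); last by apply/funext => y; rewrite mulN1r.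
apply: (is_derive_eq (drvc (is_derive_expR (- 1 * s)) (drvMl (- 1) (drvid s)))).
by rewrite mulr1 mulrN1 mulN1r.
Qed.

Lemma is_derive_igamma n s : is_derive s (1:R) (igamma n) (- (s ^+ n * expR (- s))).
Proof.
elim: n => [|n ih]; first by rewrite expr0 mul1r; exact: drv_expRN.
have h := is_deriveD (drvMl n.+1%:R ih) (drvM (drvXn n.+1 s) (drv_expRN s)).
by apply: (is_derive_eq h); rewrite /=; ring.
Qed.

Lemma igamma_cvg0 n : igamma n s @[s --> +oo] --> (0 : R).
Proof.
elim: n => [|n ih] /=; first exact: cvgr_expR.
rewrite -[X in _ --> X](addr0 (0:R)); apply: cvgD; last exact: exprM_expRN_cvg0.
by rewrite -[X in _ --> X](mulr0 n.+1%:R); exact: cvgMl_tmp.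
Qed.

Lemma integral_gamma n :
  (\int[lebesgue_measure]_(s in `[0%R, +oo[) (s ^+ n * expR (- s))%:E = (n`!%:R : R)%:E)%E.
Proof.
have dF s : is_derive s (1:R) (fun y => - igamma n y) (s ^+ n * expR (- s)).
  by have := is_deriveN (is_derive_igamma n s); rewrite opprK.
have cF s : {for s, continuous (fun y => - igamma n y)}.
  by have ? := dF s; apply/differentiable_continuous/derivable1_diffP; exact: ex_derive.
rewrite (@ge0_continuous_FTC2y _ _ (fun y => - igamma n y) 0 0).
- rewrite sub0e -EFinN opprK; congr EFin.
  elim: (n) => [|m ih]; first by rewrite /= oppr0 expR0.
  by rewrite /= ih expr0n/= mul0r addr0 factS natrM.
- by move=> s s0; rewrite mulr_ge0 ?exprn_ge0 ?expR_ge0.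
- apply: continuous_subspaceT => s.
  have ? := drvM (drvXn n s) (drv_expRN s).
  by apply/differentiable_continuous/derivable1_diffP; exact: ex_derive.
- by rewrite -oppr0; apply: cvgN; exact: igamma_cvg0.
- by move=> s _; have ? := dF s; exact: ex_derive.
- by apply: cvg_at_right_filter; exact: cF.
- by move=> s _; rewrite derive1E; have ? := dF s; exact: derive_val.
Qed.

Lemma integral_expR_itv (r : R) : 0 <= r ->
  (\int[lebesgue_measure]_(s in `[r, +oo[) (expR (- s))%:E = (expR (- r))%:E)%E.
Proof.
move=> r0.
have dF s : is_derive s (1:R) (fun y => - expR (- y)) (expR (- s)).
  by have := is_deriveN (drv_expRN s); rewrite opprK.
have cF s : {for s, continuous (fun y => - expR (- y) : R)}.
  by have ? := dF s; apply/differentiable_continuous/derivable1_diffP; exact: ex_derive.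
rewrite (@ge0_continuous_FTC2y _ _ (fun y => - expR (- y)) r 0).
- by rewrite sub0e -EFinN opprK.
- by move=> s _; rewrite expR_ge0.
- apply: continuous_subspaceT => s; have ? := drv_expRN s.
  by apply/differentiable_continuous/derivable1_diffP; exact: ex_derive.
- by rewrite -oppr0; apply: cvgN; exact: cvgr_expR.
- by move=> s _; have ? := dF s; exact: ex_derive.
- by apply: cvg_at_right_filter; exact: cF.
- by move=> s _; rewrite derive1E; have ? := dF s; exact: derive_val.
Qed.

(** In [integral_hat_weight] the slice at distance |v| from the midpoint contributes e^{-r}
    e^{-2|v|}. This normalisation leaves exactly e^{-r}. *)
Lemma integral_expR_norm :
  (\int[lebesgue_measure]_(v in [set: R]) (expR (- (2 * `|v|)))%:E = 1)%E.
Proof.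
have cf : continuous (fun v : R => expR (- (2 * `|v|))).
  move=> v; apply: continuous_comp; last exact: continuous_expR.
  apply: continuousN; apply: continuousM; [exact: cvg_cst|exact: norm_continuous].
rewrite ge0_symfun_integralT//; last by move=> v; rewrite /= normrN.
have dF s : is_derive s (1:R) (fun y => - 2^-1 * expR (-2 * y)) (expR (- (2 * s))).
  apply: (is_derive_eq (drvMl (- 2^-1) (drvc (is_derive_expR (-2 * s)) (drvMl (-2) (drvid s))))).
  by rewrite mulr1 mulrCA mulrNN mulVf ?mulr1 ?pnatr_eq0// mulNr.
have cF (s : R) : {for s, continuous (fun y : R => - 2^-1 * expR (-2 * y))}.
  by have ? := dF s; apply/differentiable_continuous/derivable1_diffP; exact: ex_derive.
have -> : [set x : R | 0 <= x] = `[0, +oo[%classic by apply/seteqP; split => v /=; rewrite in_itv/= andbT.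
under eq_integral => v.
  rewrite inE/= in_itv/= andbT => v0; rewrite ger0_norm//; over.
rewrite (@ge0_continuous_FTC2y _ _ (fun y => - 2^-1 * expR (- 2 * y)) 0 0).
- by rewrite mulr0 expR0 mulr1 sub0e -EFinN opprK -EFinM mulfV ?pnatr_eq0.
- by move=> s _; rewrite expR_ge0.
- apply: continuous_subspaceT => s.
  have ? := drvc (is_derive_expR (-2 * s)) (drvMl (-2) (drvid s)).
  rewrite (_ : (fun v => _) = (fun y => expR (-2 * y))); last by apply/funext => y; rewrite mulNr.
  by apply/differentiable_continuous/derivable1_diffP; exact: ex_derive.
- rewrite -[X in _ --> X](mulr0 (- 2^-1)); apply: cvgMl_tmp.
  apply: (@squeeze_cvgr _ _ _ _ (fun=> 0) (fun s : R => expR (- s))).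
  + near=> s; rewrite expR_ge0/= ler_expR.
    by have : 0 <= s by [near: s; apply: nbhs_pinfty_ge; rewrite num_real]; lra.
  + exact: cvg_cst.
  + exact: cvgr_expR.
- by move=> s _; have ? := dF s; exact: ex_derive.
- by apply: cvg_at_right_filter; exact: cF.
- by move=> s _; rewrite derive1E; have ? := dF s; exact: derive_val.
Unshelve. all: by end_near. Qed.

End bessel.

(** * Product measures as sigma-finite measures *)

Section sfprod.
Context d1 d2 (T1 : measurableType d1) (T2 : measurableType d2) (R : realType).
Variables (m1 : {sigma_finite_measure set T1 -> \bar R})
          (m2 : {sigma_finite_measure set T2 -> \bar R}).

(** A name for the product measure to which its sigma-finite structure is attached, so that a
    product can again be the index space of a mixture or a feature space. *)
Definition sfprod : set (T1 * T2) -> \bar R := m1 \x m2.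

HB.instance Definition _ := Measure.on sfprod.
HB.instance Definition _ := Measure_isSigmaFinite.Build _ _ _ sfprod
  (sigma_finite_product m1 m2).

Lemma ge0_integral_sfprod (f : T1 * T2 -> \bar R) : measurable_fun setT f ->
  (forall x, 0 <= f x) ->
  \int[sfprod]_p f p = \int[m1]_x \int[m2]_y f (x, y).
Proof. by move=> mf f0; exact: (fubini_tonelli1 f). Qed.

End sfprod.

(** * The exponential kernel as a mixture of ball intersections *)

Section hat.
Context {R : realType}.

Lemma integralT_indic d (T : measurableType d) (m : {measure set T -> \bar R}) A :
  measurable A -> \int[m]_x (\1_A x : R)%:E = m A.
Proof. by move=> mA; rewrite integral_indic// setIT. Qed.

Definition cballvol n (y : R) : \bar R := lebesgue_rV n (sball 0 y).

Lemma measurable_section_measure d (T : measurableType d) d2 (T2 : measurableType d2) (m : {sigma_finite_measure set T2 -> \bar R})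
  (A : set (T * T2)) : measurable A -> measurable_fun setT (fun t => m [set z | A (t, z)]).
Proof.
move=> mA; have := @measurable_fun_xsection _ _ T T2 R m A mA.
rewrite (_ : _ \o _ = (fun t => m [set z | A (t, z)]))//.
by apply/funext => t /=; rewrite xsectionE.
Qed.

Lemma measurable_cballvol n : measurable_fun setT (cballvol n : measurableTypeR R -> _).
Proof.
have := @measurable_section_measure _ (measurableTypeR R) _ _ (lebesgue_rV n)
  [set p | (sqn p.2 <= p.1)%R].
rewrite (_ : (fun _ => _) = cballvol n); last first.
  apply/funext => y; congr (lebesgue_rV n _).
  by apply/seteqP; split => z; rewrite /sball/= subr0.
apply; apply: measurable_le_set => //; apply: measurable_sqn; exact: measurable_snd.
Qed.

(** The slice at height u is a ball of squared radius b - max(u^2, (u - r)^2). Measured from the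
    midpoint, u = v + r/2, the maximum becomes (|v| + r/2)^2. *)
Lemma lebesgue_sballI_rV_cons n (r b : R) : (0 <= r)%R ->
  lebesgue_rV n.+1 (sball 0 b `&` sball (rV_cons (r, 0%R)) b) =
  \int[lebesgue_measure]_v cballvol n (b - (`|v| + r / 2) ^+ 2)%R.
Proof.
move=> r0; set A := (X in lebesgue_rV _ X).
have mA : measurable A by apply: measurableI; exact: measurable_sball.
rewrite -integralT_indic// ge0_integral_rV_cons//; last first.
- by apply/measurable_EFinP; exact: measurable_indic.
pose f (u : R) : \bar R := cballvol n (b - Num.max (u ^+ 2) ((u - r) ^+ 2))%R.
transitivity (\int[lebesgue_measure]_u f u).
  apply: eq_integral => u _; rewrite /f /cballvol.
  rewrite -[RHS]integralT_indic; last exact: measurable_sball.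
  apply: eq_integral => z _; rewrite !indicE; congr ((_ : bool)%:R%:E).
  rewrite /A /sball.
  have E1 : sqn (rV_cons (u, z) - 0)%R = (u ^+ 2 + sqn z)%R by rewrite subr0 sqn_rV_cons.
  have E2 : sqn (rV_cons (u, z) - rV_cons (r, 0%R))%R = ((u - r) ^+ 2 + sqn z)%R.
    rewrite (_ : _ - _ = rV_cons (u - r, z))%R ?sqn_rV_cons//.
    by apply/rowP => i; rewrite !mxE; case: unliftP => [j|] _ /=; rewrite ?mxE ?subr0.
  apply/idP/idP; rewrite !inE/= E1 E2 subr0.
    move=> [h1 h2]; rewrite lerBrDr -lerBrDl ge_max; apply/andP; split; lra.
  rewrite lerBrDr -lerBrDl ge_max => /andP[h1 h2]; split; lra.
have mf : measurable_fun setT (f : measurableTypeR R -> _).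
  apply: (measurableT_comp (@measurable_cballvol n)).
  apply: measurable_funB => //; apply: measurable_maxr.
    by apply: measurable_funX.
  by apply: measurable_funX; exact: measurable_funB.
have := @integral_lebesgue_affine R 1 (r / 2) f ltr01 mf (fun=> measure_ge0 _ _).
rewrite invr1 mul1e => <-; apply: eq_integral => v _; rewrite /f mul1r; congr cballvol.
congr (_ - _)%R; have [v0|v0] := leP 0%R v.
  rewrite ger0_norm// max_l//; have : (0 <= v * r)%R by rewrite mulr_ge0.
  by nra.
rewrite ltr0_norm// max_r; first by field.
have : (0 <= - v * r)%R by rewrite mulr_ge0// oppr_ge0 ltW.
by nra.
Qed.

(** With [c] the volume of the unit ball in dimension 2l, the product of this weight and the ball
    volume c (s^2 - u^2)^l is the integrand of [integral_sqdiff_pow_bessel_exp]. *)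
Definition hat_weight (l : nat) (c : R) (s : R) : R :=
  (if 0 < s then s * bessel_exp l.+1 s / (2 ^+ l * l`!%:R * c) else 0)%R.

Lemma hat_weight_ge0 l c s : (0 < c)%R -> (0 <= hat_weight l c s)%R.
Proof.
move=> c0; rewrite /hat_weight; case: ifPn => // s0.
rewrite divr_ge0//; first by rewrite mulr_ge0 ?bessel_exp_ge0 ?(ltW s0).
by rewrite !mulr_ge0 ?(ltW c0)// exprn_ge0.
Qed.

Lemma measurable_hat_weight l c : measurable_fun setT (hat_weight l c : measurableTypeR R -> measurableTypeR R).
Proof.
rewrite (_ : hat_weight l c = (fun s => s * bessel_exp l.+1 s / (2 ^+ l * l`!%:R * c))%R \_ `]0%R, +oo[); last first.
  apply/funext => s; rewrite patchE /hat_weight; case: ifPn => s0.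
    by rewrite mem_set//= in_itv/= s0.
  by rewrite memNset//= in_itv/= andbT; exact/negP.
apply/(measurable_restrictT _ _).1.
  exact: measurable_itv.
apply: open_continuous_measurable_fun; first exact: interval_open.
move=> s; rewrite inE/= in_itv/= andbT => s0.
have sn0 : s != 0%R by rewrite gt_eqF.
have ? := is_derive_bessel_exp l.+1 sn0.
have ch : bessel_exp l.+1 x @[x --> s] --> bessel_exp l.+1 s.
  by apply/differentiable_continuous/derivable1_diffP; exact: ex_derive.
by apply: cvgMr_tmp; apply: (cvgM _ ch); exact: cvg_id.
Qed.

Lemma integral_hat_weight_cballvol m (l : nat) (u : R) : m = l.*2 -> (0 < u)%R ->
  \int[lebesgue_measure]_s ((hat_weight l (fine (ballvol m)) s)%:E * cballvol m (s ^+ 2 - u ^+ 2)%R) =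
  (expR (- (2 * u)))%:E.
Proof.
move=> mE u0; set c := fine _.
have cE : ballvol m = c%:E by rewrite fineK// ballvol_fin_num.
have c0 : (0 < c)%R by rewrite -lte_fin -cE ballvol_gt0.
rewrite -(mulNr 2%R u) -(integral_sqdiff_pow_bessel_exp l u0) [RHS]integral_mkcond; apply: eq_integral => s _.
rewrite patchE; case: ifPn => us.
  move: us; rewrite inE/= in_itv/= andbT => us.
  have s0 : (0 < s)%R by rewrite (lt_le_trans u0).
  have us2 : (u ^+ 2 <= s ^+ 2)%R by rewrite lerXn2r ?nnegrE ?(ltW s0) ?(ltW u0).
  rewrite /hat_weight s0 /cballvol lebesgue_sball ?subr_ge0// cE mE -EFinM -mul2n exprM.
  rewrite sqr_sqrtr ?subr_ge0// /sqdiff_pow; congr EFin.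
  by field; rewrite !gt_eqF// ?ltr0n ?fact_gt0 ?exprn_gt0.
rewrite /hat_weight; case: ifPn => s0; last by rewrite mul0e.
rewrite /cballvol sball_neg ?measure0 ?mule0// subr_lt0.
rewrite notin_setE/= in_itv/= andbT in us; move/negP : us; rewrite -ltNge => us.
by rewrite ltrXn2r ?nnegrE ?(ltW s0) ?(ltW u0).
Qed.

Lemma integral_hat_weight m (l : nat) (r : R) : m = l.*2 -> (0 <= r)%R ->
  \int[lebesgue_measure]_s ((hat_weight l (fine (ballvol m)) s)%:E *
     \int[lebesgue_measure]_v cballvol m (s ^+ 2 - (`|v| + r / 2) ^+ 2)%R) =
  (expR (- r))%:E.
Proof.
move=> mE r0; set c := fine _.
have c0 : (0 < c)%R by rewrite fine_gt0// ballvol_gt0 /= -ge0_fin_numE ?ballvol_fin_num ?measure_ge0.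
pose f (p : measurableTypeR R * measurableTypeR R) : \bar R :=
  (hat_weight l c p.1)%:E * cballvol m (p.1 ^+ 2 - (`|p.2| + r / 2) ^+ 2)%R.
have mp : measurable_fun setT (fun p : measurableTypeR R * measurableTypeR R =>
    cballvol m (p.1 ^+ 2 - (`|p.2| + r / 2) ^+ 2)%R).
  apply: (measurableT_comp (@measurable_cballvol m)).
  apply: measurable_funB; apply: measurable_funX; first exact: measurable_fst.
  apply: measurable_funD => //; apply: measurableT_comp => //.
have mf : measurable_fun setT f.
  apply: emeasurable_funM => //.
  apply/measurable_EFinP; apply: (measurableT_comp (measurable_hat_weight l c)).
  exact: measurable_fst.
have f0 p : 0 <= f p by rewrite mule_ge0 ?lee_fin ?hat_weight_ge0 ?measure_ge0.
transitivity (\int[lebesgue_measure]_s \int[lebesgue_measure]_v f (s, v)).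
  apply: eq_integral => s _; rewrite /f/= ge0_integralZl_EFin//.
  - exact: (measurableT_comp mp (measurable_pair1 s)).
  - exact: hat_weight_ge0.
rewrite (fubini_tonelli f)//.
have mexp : measurable_fun setT
    (fun v : measurableTypeR R => expR (- (2 * `|v|)) : measurableTypeR R)%R.
  apply: measurableT_comp => //; apply: measurableT_comp => //.
  by apply: measurable_funM => //; exact: measurableT_comp.
transitivity (\int[lebesgue_measure]_(v in [set: measurableTypeR R]) ((expR (- r))%:E * (expR (- (2 * `|v|)))%:E)).
  apply: ae_eq_integral => //.
  - exact: measurable_fun_fubini_tonelli_G.
  - by apply/measurable_EFinP; apply: measurable_funM => //; exact: mexp.
  (* [integral_hat_weight_cballvol] requires |v| + r/2 > 0, which fails at v = 0 when r = 0; the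
     integrands are therefore compared almost everywhere. *)
  - exists [set 0%R]; split => //.
    + exact: lebesgue_measure_set1.
    + move=> v /=; apply: contra_notP => v0 _.
      rewrite /fubini_G /f (@integral_hat_weight_cballvol m l (`|v| + r / 2)%R mE).
        by rewrite -EFinM -expRD; congr (expR _)%:E; field.
      by rewrite ltr_wpDr ?divr_ge0// normr_gt0; exact/eqP.
rewrite ge0_integralZl_EFin ?expR_ge0//.
- by have := @integral_expR_norm R => ->; rewrite mule1.

- by apply/measurable_EFinP.
Qed.

(* [e^{-|x-y|}] is a mixture over [s] of the volumes of intersections of two balls of
   squared radius [b s]; [b s] may be negative, and then the balls are empty. *)
Definition hat_mixture n : Prop :=
  exists (d : measure_display) (S : measurableType d)
    (m : {sigma_finite_measure set S -> \bar R}) (w b : S -> R),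
  [/\ measurable_fun setT w, measurable_fun setT b, forall s, (0 <= w s)%R &
   forall x y : 'rV[R]_n, (expR (- euclidean_dist x y))%:E =
     \int[m]_s ((w s)%:E * lebesgue_rV n (sball x (b s) `&` sball y (b s)))].

Lemma sballI_translate n (x y : 'rV[R]_n) b :
  lebesgue_rV n (sball x b `&` sball y b) =
  lebesgue_rV n (sball 0 b `&` sball (y - x)%R b).
Proof.
have := @lebesgue_rV_affine R n 1 x (sball x b `&` sball y b) ltr01.
rewrite expr1n invr1 mul1e => <-; last by apply: measurableI; exact: measurable_sball.
congr (lebesgue_rV n _); apply/seteqP; split => v /=;
  by rewrite /sball/= scale1r addrK subr0 opprB addrA.
Qed.

(** Rotate y - x onto the first axis and slice along it. The slices are balls of even dimension 2l,
    whose volume is a polynomial in the squared radius; this is why odd dimensions are treated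
    directly. *)
Lemma hat_mixture_odd l : hat_mixture l.*2.+1.
Proof.
exists _, (measurableTypeR R), lebesgue_measure, (hat_weight l (fine (ballvol l.*2))),
  (fun s => s ^+ 2)%R; split.
- exact: measurable_hat_weight.
- exact: measurable_funX.
- move=> s; apply: hat_weight_ge0.
  by rewrite fine_gt0// ballvol_gt0 /= -ge0_fin_numE ?ballvol_fin_num ?measure_ge0.
move=> x y; rewrite -(@integral_hat_weight l.*2 l _ erefl (sqrtr_ge0 _)); apply: eq_integral => s _.
rewrite -(@lebesgue_sballI_rV_cons _ (euclidean_dist x y) _ (sqrtr_ge0 _)).
rewrite [X in _ = _ * X]sballI_translate.
rewrite (@lebesgue_sballI _ _ (y - x)%R (rV_cons (euclidean_dist x y, 0%R)))//.
rewrite sqn_rV_cons sqn0 addr0/= euclidean_distE sqr_sqrtr ?sqn_ge0//.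
by rewrite -sqnN opprB.
Qed.

(* Slice the balls of R^(n+1) along the first coordinate. *)
Lemma hat_mixture_pred n : hat_mixture n.+1 -> hat_mixture n.
Proof.
move=> [d [S [m [w [b [mw mb w0 wb]]]]]].
exists _, (S * measurableTypeR R)%type, (sfprod m lebesgue_measure),
  (w \o fst), (fun p => b p.1 - p.2 ^+ 2)%R.
have mw1 : measurable_fun setT (w \o fst : S * measurableTypeR R -> R).
  exact: measurableT_comp.
have mb1 : measurable_fun setT (fun p : S * measurableTypeR R => b p.1 - p.2 ^+ 2)%R.
  apply: measurable_funB; first exact: measurableT_comp.
  by apply: measurable_funX; exact: measurable_snd.
split => //.
  by move=> p; exact: w0.
move=> x y.
have mA : measurable_fun setT (fun p : S * measurableTypeR R =>
    lebesgue_rV n (sball x (b p.1 - p.2 ^+ 2)%R `&` sball y (b p.1 - p.2 ^+ 2)%R)).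
  pose A : set ((S * measurableTypeR R) * 'rV[R]_n) :=
    [set q | (sqn (q.2 - x) <= b q.1.1 - q.1.2 ^+ 2)%R] `&`
    [set q | (sqn (q.2 - y) <= b q.1.1 - q.1.2 ^+ 2)%R].
  apply: (@measurable_section_measure _ _ _ _ (lebesgue_rV n) A).
  apply: measurableI; apply: measurable_le_set.
  - by apply: measurable_sqn; apply: measurable_rVB => //; exact: measurable_snd.
  - exact: (measurableT_comp mb1 measurable_fst).
  - by apply: measurable_sqn; apply: measurable_rVB => //; exact: measurable_snd.
  - exact: (measurableT_comp mb1 measurable_fst).
rewrite ge0_integral_sfprod; last 2 first.
- by apply: emeasurable_funM => //; exact/measurable_EFinP.
- by move=> p; rewrite mule_ge0 ?lee_fin ?w0 ?measure_ge0.
transitivity (expR (- euclidean_dist (rV_cons (0%R, x)) (rV_cons (0%R, y))))%:E.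
  congr (expR (- _))%:E; rewrite !euclidean_distE; congr Num.sqrt.
  rewrite (_ : rV_cons (0%R, x) - rV_cons (0%R, y) = rV_cons (0, x - y))%R.
    by rewrite sqn_rV_cons/= expr0n add0r.
  by apply/rowP => i; rewrite !mxE; case: unliftP => [j|] _ /=; rewrite ?mxE ?subr0.
rewrite wb; apply: eq_integral => s _ /=.
rewrite ge0_integralZl_EFin//; last exact: (measurableT_comp mA (measurable_pair1 s)).
congr (_ * _); set A := (X in lebesgue_rV _ X).
have mAA : measurable A by apply: measurableI; exact: measurable_sball.
rewrite -integralT_indic// ge0_integral_rV_cons//; last first.
  by apply/measurable_EFinP; exact: measurable_indic.
apply: eq_integral => u _.
rewrite -[RHS]integralT_indic; last by apply: measurableI; exact: measurable_sball.
apply: eq_integral => z _; rewrite !indicE; congr ((_ : bool)%:R%:E).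
have E v : sqn (rV_cons (u, z) - rV_cons (0%R, v))%R = (u ^+ 2 + sqn (z - v))%R.
  rewrite (_ : _ - _ = rV_cons (u, z - v))%R ?sqn_rV_cons//.
  by apply/rowP => i; rewrite !mxE; case: unliftP => [j|] _ /=; rewrite ?mxE ?subr0.
apply/idP/idP; rewrite !inE /A /sball/= !E => -[h1 h2]; split; lra.
Qed.

Lemma hat_mixtureT n : hat_mixture n.
Proof.
case: (boolP (odd n)) => on.
  by rewrite -(odd_double_half n) on; exact: hat_mixture_odd.
apply: hat_mixture_pred; rewrite -(odd_double_half n) (negbTE on).
exact: hat_mixture_odd.
Qed.

End hat.

(** * Duality bound for the integral of the inverse typicality *)

Lemma emeasurable_funV d (T : measurableType d) (R : realType) (f : T -> \bar R) :
  measurable_fun setT f -> (forall t, 0 <= f t) ->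
  measurable_fun setT (fun t => (f t)^-1).
Proof.
move=> mf f0.
rewrite (_ : (fun t => _) = (fun t => if f t == 0 then +oo else
  if f t == +oo then 0 else (fine (f t) `^ (-1))%:E)); last first.
  apply/funext => t; have := f0 t; case: (f t) => [r| |]//= r0.
  - rewrite inver; case: ifPn => [/eqP ->|rn0]; first by rewrite eqxx.
    by rewrite eqe (negbTE rn0) powR_inv1.
apply: measurable_fun_ifT => //; first exact: measurable_fun_eqe.
apply: measurable_fun_ifT => //; first exact: measurable_fun_eqe.
apply/measurable_EFinP.
by apply: (@measurableT_comp _ _ _ _ _ _ (@powR R ^~ (-1)%R)) => //;
  exact: measurableT_comp.
Qed.

Section feature.
Context d (T : measurableType d) d' (O : measurableType d') (R : realType).
Variables (X : set T) (m : {sigma_finite_measure set O -> \bar R}).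
Variables (phi : T * O -> R) (h : O -> R).
Hypotheses (mX : measurable X) (mphi : measurable_fun setT phi) (phi0 : forall p, (0 <= phi p)%R).
Hypotheses (mh : measurable_fun setT h) (h0 : forall w, (0 <= h w)%R).
Hypothesis phi_h : forall x, X x -> \int[m]_w (phi (x, w) * h w)%:E = 1.

(** Cauchy-Schwarz in pointwise, linearised form: the difference of the sides is (a/g) (c g - b)^2.
    The extended value [g] may be 0, with inverse +oo, or +oo, with inverse 0. *)
Let amgm (a b c : R) (g : \bar R) : (0 <= a)%R -> (0 <= b)%R -> (0 < c)%R -> 0 <= g ->
  (2 * c * (a * b))%:E <= (c ^+ 2)%:E * (a%:E * g) + a%:E * ((b ^+ 2)%:E * g^-1).
Proof.
move=> a0 b0 c0 g0.
have c20 : (0 < c ^+ 2)%R by rewrite exprn_gt0.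
move: a0; rewrite le_eqVlt => /predU1P[<-|a0].
  by rewrite mul0r mulr0 !mul0e mule0 adde0.
move: b0; rewrite le_eqVlt => /predU1P[<-|b0].
  by rewrite !mulr0 expr0n/= mul0e mule0 adde0 !mule_ge0// lee_fin ltW.
case: g g0 => [g| |]//= g0; last first.
  rewrite !gt0_muley ?lte_fin//.
  rewrite addye ?leey// invey mule0 mule0//.
move: g0; rewrite lee_fin le_eqVlt => /predU1P[<-|g0].
  by rewrite inve0 gt0_muley ?lte_fin ?exprn_gt0// gt0_muley ?lte_fin// addey ?leey// mule0 mule0.
rewrite inver gt_eqF// -!EFinM -EFinD lee_fin -subr_ge0.
rewrite (_ : (_ - _)%R = a / g * (c * g - b) ^+ 2)%R; last by field; rewrite gt_eqF.
by rewrite mulr_ge0 ?sqr_ge0// divr_ge0 ?ltW.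
Qed.

Variables (mu : {sigma_finite_measure set T -> \bar R}) (k : T -> R).
Let g w := \int[mu]_(x in X) (phi (x, w))%:E.
Hypotheses (mk : measurable_fun setT k) (k0 : forall x, (0 < k x)%R).
Hypothesis kE : forall x, X x -> (k x)%:E = \int[m]_w ((phi (x, w))%:E * g w).

Let phiX p := (phi p * \1_X p.1)%R.

Let mphiX : measurable_fun setT phiX.
Proof.
apply: measurable_funM => //; apply: (measurableT_comp (measurable_indic mX)).
exact: measurable_fst.
Qed.

Let phiX0 p : 0 <= (phiX p)%:E.
Proof. by rewrite lee_fin mulr_ge0. Qed.

Let integralX (f : T -> \bar R) :
  \int[mu]_(x in X) f x = \int[mu]_x ((\1_X x)%:E * f x).
Proof.
rewrite integral_mkcond; apply: eq_integral => x _; rewrite patchE indicE.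
by case: ifPn => _; rewrite ?mul1e ?mul0e.
Qed.

Let gE w : g w = \int[mu]_x (phiX (x, w))%:E.
Proof.
by rewrite /g integralX; apply: eq_integral => x _; rewrite -EFinM mulrC.
Qed.

Let mg : measurable_fun setT g.
Proof.
rewrite (_ : g = fubini_G mu (EFin \o phiX)); last by apply/funext => w; rewrite gE.
by apply: measurable_fun_fubini_tonelli_G => //; exact/measurable_EFinP.
Qed.

Let g0 w : 0 <= g w.
Proof. by apply: integral_ge0 => x _; rewrite lee_fin. Qed.

(* Cauchy-Schwarz gives [1 / K(x) <= \int phi(x, .) h^2 / g]; integrate over [x], using
   [\int phi(., w) dmu = g w]. *)
Lemma integral_inv_typicality_le :
  \int[mu]_(x in X) ((k x)^-1)%:E <= \int[m]_w (h w ^+ 2)%:E.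
Proof.
have mgV := emeasurable_funV mg g0.
have gV0 w : 0 <= (g w)^-1 by rewrite inve_ge0.
have mh2 : measurable_fun setT (fun w => (h w ^+ 2)%:E).
  by apply/measurable_EFinP; exact: measurable_funX.
have h20 w : 0 <= (h w ^+ 2)%:E by rewrite lee_fin sqr_ge0.
have mF : measurable_fun setT (fun w => (h w ^+ 2)%:E * (g w)^-1).
  exact: emeasurable_funM.
have F0 w : 0 <= (h w ^+ 2)%:E * (g w)^-1 by rewrite mule_ge0.
pose f (p : T * O) := (phiX p)%:E * ((h p.2 ^+ 2)%:E * (g p.2)^-1).
have mf : measurable_fun setT f.
  apply: emeasurable_funM; first exact/measurable_EFinP.
  exact: (measurableT_comp mF measurable_snd).
have f0 p : 0 <= f p by rewrite mule_ge0.
apply: (@le_trans _ _ (\int[mu]_x \int[m]_w f (x, w))).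
  rewrite integralX; apply: ge0_le_integral => //.
  - move=> x _; rewrite indicE; case: (boolP (x \in X)) => [|_]; last by rewrite mul0e.
    by rewrite inE => Xx; rewrite mul1e lee_fin invr_ge0 ltW// k0.
  - apply: emeasurable_funM; first by apply/measurable_EFinP; exact: measurable_indic.
    apply/measurable_EFinP; rewrite (_ : (fun x => _) = (fun x => k x `^ (-1)))%R.
      exact: (@measurableT_comp _ _ _ _ _ _ (@powR R ^~ (-1)%R)).
    by apply/funext => x; rewrite powR_inv1// ltW.
  - exact: measurable_fun_fubini_tonelli_F.
  - move=> x _; rewrite indicE; case: (boolP (x \in X)) => xX; last first.
      by rewrite mul0e integral_ge0.
    move: (xX); rewrite inE => Xx; rewrite mul1e.
    (* The optimal parameter: integrating [amgm] gives 2 c <= c^2 K(x) + \int phi h^2 / g, and c^2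
       K(x) = c. *)
    pose c := (k x)^-1%R; have c0 : (0 < c)%R by rewrite invr_gt0 k0.
    have mphix : measurable_fun setT (fun w => phi (x, w)).
      exact: (measurableT_comp mphi (measurable_pair1 x)).
    have mpg : measurable_fun setT (fun w => (phi (x, w))%:E * g w).
      by apply: emeasurable_funM => //; exact/measurable_EFinP.
    have : \int[m]_w ((2 * c)%:E * (phi (x, w) * h w)%:E) <=
        \int[m]_w ((c ^+ 2)%:E * ((phi (x, w))%:E * g w) + f (x, w)).
      apply: ge0_le_integral => //.
      - by move=> w _; rewrite -EFinM lee_fin !mulr_ge0// ltW.
      - apply: emeasurable_funM => //; apply/measurable_EFinP.
        exact: measurable_funM.
      - apply: emeasurable_funD; first exact: emeasurable_funM.
        exact: (measurableT_comp mf (measurable_pair1 x)).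
      - move=> w _; rewrite -EFinM /f /phiX/= indicE xX mulr1.
        by rewrite amgm.
    rewrite ge0_integralZl_EFin//; last 3 first.
      by move=> w _; rewrite lee_fin mulr_ge0.
      by apply/measurable_EFinP; exact: measurable_funM.
      by rewrite mulr_ge0// ltW.
    rewrite phi_h// mule1 ge0_integralD//; last 3 first.
      by move=> w _; rewrite !mule_ge0// lee_fin ?sqr_ge0.
      exact: emeasurable_funM.
      exact: (measurableT_comp mf (measurable_pair1 x)).
    rewrite ge0_integralZl_EFin ?sqr_ge0//; last first.
      by move=> w _; rewrite mule_ge0// lee_fin.
    rewrite -kE// -EFinM (_ : (c ^+ 2 * k x)%R = c); last first.
      by rewrite /c; field; rewrite gt_eqF// k0.
    rewrite (_ : (2 * c)%:E = c%:E + c%:E); last by rewrite -EFinD; congr EFin; ring.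
    by rewrite leeD2lE.
rewrite (fubini_tonelli f)//; apply: ge0_le_integral => //.
- by move=> w _; exact: integral_ge0.
- exact: measurable_fun_fubini_tonelli_G.
move=> w _; rewrite /f/=.
rewrite ge0_integralZr//; last first.
  by apply/measurable_EFinP; exact: (measurableT_comp mphiX (measurable_pair2 w)).
rewrite -gE muleCA.
(* The factor g * g^-1 is at most 1; it vanishes where g is 0 or +oo. *)
rewrite -[leRHS]mule1 lee_wpmul2l//.
have := g0 w; case: (g w) => [r| |]//= r0; last by rewrite invey mule0.
move: r0; rewrite lee_fin le_eqVlt => /predU1P[<-|r0]; first by rewrite mul0e.
by rewrite inver gt_eqF// -EFinM mulfV ?gt_eqF.
Qed.

End feature.

(** * Quadratic forms of Gram matrices *)

Section gram.
Context d' (O : measurableType d') (R : realType) (m : {measure set O -> \bar R}).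

(** The form is the integral of the square of [\sum_i a i * f i]. Nonnegativity of the [f i] turns
    the finite values [G i j] into integrability of the products. *)
Lemma gram_ge0 (M : nat) (f : 'I_M -> O -> R) (G : 'I_M -> 'I_M -> R) (a : 'I_M -> R) :
  (forall i, measurable_fun setT (f i)) -> (forall i w, 0 <= f i w)%R ->
  (forall i j, \int[m]_w (f i w * f j w)%:E = (G i j)%:E) ->
  (0 <= \sum_i \sum_j a i * a j * G i j)%R.
Proof.
move=> mf f0 fG; rewrite -lee_fin.
have iff i j : m.-integrable setT (fun w => (f i w * f j w)%:E).
  apply/integrableP; split; first by apply/measurable_EFinP; exact: measurable_funM.
  under eq_integral do rewrite gee0_abs ?lee_fin ?mulr_ge0//.
  by rewrite fG ltry.
rewrite [leRHS](_ : _ = \int[m]_w ((\sum_i a i * f i w) ^+ 2)%R%:E).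
  by apply: integral_ge0 => w _; rewrite lee_fin sqr_ge0.
under eq_integral => w _.
  rewrite expr2 big_distrlr/= -sumEFin.
  under eq_bigr => i _.
    rewrite -sumEFin; under eq_bigr => j _ do rewrite mulrACA EFinM.
    over.
  over.
rewrite integral_sum//; last first.
  by move=> i; apply: integrable_sum => // j _; exact: integrableZl.
rewrite -sumEFin; apply: eq_bigr => i _.
rewrite integral_sum//; last by move=> j; exact: integrableZl.
rewrite -sumEFin; apply: eq_bigr => j _.
by rewrite integralZl// fG.
Qed.

(** Cauchy-Schwarz for F = \sum_i v_i f_i and [h]: their inner product is \sum_i v_i. It is obtained
    from [gram_ge0] for the family enlarged by [h] at index 0, with the minimising coefficient -
    (\sum_i v_i) / C. *)
Lemma sqr_sum_le_gram (M : nat) (f : 'I_M -> O -> R) (h : O -> R) (G : 'I_M -> 'I_M -> R)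
    (C : R) (v : 'I_M -> R) :
  (forall i, measurable_fun setT (f i)) -> (forall i w, 0 <= f i w)%R ->
  measurable_fun setT h -> (forall w, 0 <= h w)%R ->
  (forall i j, \int[m]_w (f i w * f j w)%:E = (G i j)%:E) ->
  (forall i, \int[m]_w (f i w * h w)%:E = 1) ->
  \int[m]_w (h w ^+ 2)%:E = C%:E -> (0 < C)%R ->
  ((\sum_i v i) ^+ 2 <= C * \sum_i \sum_j v i * v j * G i j)%R.
Proof.
move=> mf f0 mh h0 fG fh hC C0.
pose F (i : 'I_M.+1) := oapp f h (unlift ord0 i).
pose GG (i j : 'I_M.+1) := match unlift ord0 i, unlift ord0 j with
  | Some i', Some j' => G i' j' | None, None => C | _, _ => 1%R end.
pose a (i : 'I_M.+1) := oapp v (- (\sum_i v i) / C)%R (unlift ord0 i).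
have := @gram_ge0 M.+1 F GG a.
have -> : (\sum_i \sum_j a i * a j * GG i j =
   (\sum_i \sum_j v i * v j * G i j) - (\sum_i v i) ^+ 2 / C)%R.
  pose a0 := (- (\sum_i v i) / C)%R.
  have S1 : (\sum_j a ord0 * a j * GG ord0 j = a0 * a0 * C + a0 * \sum_j v j)%R.
    rewrite big_ord_recl /a /GG unlift_none/= big_distrr/=; congr (_ + _)%R.
    by apply: eq_bigr => j _; rewrite liftK/= mulr1.
  have S2 i : (\sum_j a (lift ord0 i) * a j * GG (lift ord0 i) j =
      v i * a0 + \sum_j v i * v j * G i j)%R.
    rewrite big_ord_recl /a /GG unlift_none/= liftK/= mulr1; congr (_ + _)%R.
    by apply: eq_bigr => j _; rewrite liftK.
  rewrite big_ord_recl S1; under [X in (_ + X = _)%R]eq_bigr do rewrite S2.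
  rewrite big_split/= -big_distrl/= /a0.
  by field; rewrite gt_eqF.
rewrite subr_ge0 ler_pdivrMr// [leRHS]mulrC; apply.
- by move=> i; rewrite /F; case: unliftP => [j|] _ /=.
- by move=> i w; rewrite /F; case: unliftP => [j|] _ /=.
- move=> i j; rewrite /F /GG; case: unliftP => [i'|] _ /=; case: unliftP => [j'|] _ //=.
  by rewrite -[RHS](fh j'); apply: eq_integral => w _; rewrite mulrC.
Qed.

End gram.

(** * Total mass of the kernel and of the mixture *)

Section total_mass.
Context {R : realType}.

Lemma measurable_sqrtr : measurable_fun setT (@Num.sqrt R : measurableTypeR R -> measurableTypeR R).
Proof. by apply: continuous_measurable_fun; exact: sqrt_continuous. Qed.

Lemma measurable_enorm d (T : measurableType d) n (f : T -> 'rV[R]_n) :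
  measurable_fun setT f ->
  measurable_fun setT (fun t => Num.sqrt (sqn (f t)) : measurableTypeR R).
Proof. by move=> mf; apply: (measurableT_comp measurable_sqrtr); exact: measurable_sqn. Qed.

(** Layer cake: e^{-|y|} is the integral of e^{-s} over s >= |y|. After exchanging the integrals,
    the ball of radius s contributes s^n, and the gamma integral produces n!. *)
Lemma integral_expR_enorm n :
  \int[lebesgue_rV n]_y (expR (- Num.sqrt (sqn y)))%:E = (n`!%:R : R)%:E * ballvol n.
Proof.
pose A : set ('rV[R]_n * measurableTypeR R) := [set p | (Num.sqrt (sqn p.1) <= p.2)%R].
have mA : measurable A.
  apply: measurable_le_set; last exact: measurable_snd.
  by apply: measurable_enorm; exact: measurable_fst.
pose f (p : 'rV[R]_n * measurableTypeR R) : \bar R := (expR (- p.2) * \1_A p)%:E.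
have mexp : measurable_fun setT (fun s : measurableTypeR R => expR (- s) : measurableTypeR R)%R.
  by apply: measurableT_comp => //; exact: measurableT_comp.
have mf : measurable_fun setT f.
  apply/measurable_EFinP; apply: measurable_funM; last exact: measurable_indic.
  exact: (measurableT_comp mexp measurable_snd).
have f0 p : 0 <= f p by rewrite lee_fin mulr_ge0 ?expR_ge0.
transitivity (\int[lebesgue_rV n]_y \int[lebesgue_measure]_s f (y, s)).
  apply: eq_integral => y _; rewrite -(@integral_expR_itv R _ (sqrtr_ge0 _)).
  rewrite integral_mkcond; apply: eq_integral => s _.
  rewrite patchE /f indicE/=.
  have -> : ((y, s) \in A) = (s \in `[Num.sqrt (sqn y), +oo[%classic).
    by apply/idP/idP; rewrite !inE /A/= in_itv/= andbT.
  by case: ifPn; rewrite ?mulr1 ?mulr0.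
rewrite (fubini_tonelli f)//.
transitivity (\int[lebesgue_measure]_(s in `[(0 : R)%R, +oo[) (ballvol n * (s ^+ n * expR (- s) : R)%:E)).
  rewrite [RHS]integral_mkcond; apply: eq_integral => s _.
  rewrite /f/= patchE; under eq_integral do rewrite EFinM.
  have mAs : measurable [set y | A (y, s)].
    by apply: (measurable_preimT _ mA); exact: measurable_pair2.
  rewrite ge0_integralZl_EFin ?expR_ge0//; last first.
    by apply/measurable_EFinP; exact: (measurableT_comp (measurable_indic mA) (measurable_pair2 s)).
  rewrite (_ : \int[lebesgue_rV n]_x (\1_A (x, s) : R)%:E = lebesgue_rV n [set y | A (y, s)]); last first.
    by rewrite -integralT_indic.
  case: ifPn => [|]; rewrite ?inE ?notin_setE/= in_itv/= andbT => s0.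
    rewrite (_ : [set y | A (y, s)] = sball 0 (s ^+ 2)).
      rewrite lebesgue_sball ?sqr_ge0// sqrtr_sqr ger0_norm// EFinM.
      by rewrite [RHS]muleC muleA [X in X * _ = _]muleC.
    apply/seteqP; split => y; rewrite /A /sball/= subr0 => h.
      by rewrite -(sqr_sqrtr (sqn_ge0 y)) lerXn2r ?nnegrE ?sqrtr_ge0.
    by rewrite -(ger0_norm s0) -sqrtr_sqr ler_wsqrtr.
  rewrite (_ : [set y | _] = set0) ?measure0 ?mule0//.
  apply/seteqP; split => y //; rewrite /A/= => h; apply: s0.
  exact: le_trans (sqrtr_ge0 _) h.
rewrite ge0_integralZl//.
- by rewrite integral_gamma muleC.
- apply/measurable_EFinP; apply: measurable_funTS.
  by apply: measurable_funM => //; exact: measurable_funX.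
- by move=> s; rewrite /= in_itv/= andbT => s0; rewrite lee_fin mulr_ge0 ?expR_ge0 ?exprn_ge0.
Qed.

Lemma integral_expR_dist n (t : R) (x : 'rV[R]_n) : (0 < t)%R ->
  \int[lebesgue_rV n]_y (expR (- scale_dist t (@euclidean_dist R n) x y))%:E =
  (t ^- n)%:E * ((n`!%:R)%:E * ballvol n).
Proof.
move=> t0; rewrite -integral_expR_enorm.
pose f (z : 'rV[R]_n) := (expR (- Num.sqrt (sqn z)))%:E.
rewrite -[RHS](@ge0_integral_rV_affine R n t (- (t *: x))%R f t0).
- apply: eq_integral => y _; rewrite /f /scale_dist euclidean_distE; congr (expR (- _))%:E.
  rewrite -scalerBr sqnZ sqrtrM ?sqr_ge0// sqrtr_sqr ger0_norm ?(ltW t0)//.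
  by rewrite -sqnN opprB.
- apply/measurable_EFinP; apply: measurableT_comp => //; apply: measurableT_comp => //.
  exact: measurable_enorm.
- by move=> z; rewrite lee_fin expR_ge0.
Qed.

Section mixture.
Variables (n : nat) (d : measure_display) (S : measurableType d).
Variables (m : {sigma_finite_measure set S -> \bar R}) (w b : S -> R).
Hypotheses (mw : measurable_fun setT w) (mb : measurable_fun setT b) (w0 : forall s, (0 <= w s)%R).
Hypothesis wb : forall x y : 'rV[R]_n, (expR (- euclidean_dist x y))%:E =
     \int[m]_s ((w s)%:E * lebesgue_rV n (sball x (b s) `&` sball y (b s))).

(** The integrand is the autocorrelation of the indicator of a ball, whose total integral is the
    square of the volume. *)
Lemma integral_lebesgue_sballI (c : R) :
  \int[lebesgue_rV n]_y lebesgue_rV n (sball 0 c `&` sball y c) =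
  cballvol n c * cballvol n c.
Proof.
pose B0 : set 'rV[R]_n := sball 0 c.
pose A : set ('rV[R]_n * 'rV[R]_n) := [set p | (sqn (p.2 - p.1) <= c)%R].
have mA : measurable A.
  apply: measurable_le_set => //; apply: measurable_sqn; apply: measurable_rVB.
    exact: measurable_snd.
  exact: measurable_fst.
have mB0 : measurable B0 by exact: measurable_sball.
pose f (p : 'rV[R]_n * 'rV[R]_n) : \bar R := (\1_B0 p.2 * \1_A p)%:E.
have mf : measurable_fun setT f.
  apply/measurable_EFinP; apply: measurable_funM; last exact: measurable_indic.
  exact: (measurableT_comp (measurable_indic mB0) measurable_snd).
have f0 p : 0 <= f p by rewrite lee_fin mulr_ge0.
transitivity (\int[lebesgue_rV n]_y \int[lebesgue_rV n]_z f (y, z)).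
  apply: eq_integral => y _.
  rewrite -integralT_indic; last by apply: measurableI; exact: measurable_sball.
  by apply: eq_integral => z _; rewrite /f/= indicI/=.
rewrite (fubini_tonelli f)//.
transitivity (\int[lebesgue_rV n]_z ((\1_B0 z)%:E * cballvol n c)).
  apply: eq_integral => z _; rewrite /f/=; under eq_integral do rewrite EFinM.
  rewrite ge0_integralZl_EFin//; last first.
    by apply/measurable_EFinP; exact: (measurableT_comp (measurable_indic mA) (measurable_pair2 z)).
  congr (_ * _).
  transitivity (lebesgue_rV n (sball z c)); last first.
    have [c0|c0] := leP 0%R c; first by rewrite /cballvol !lebesgue_sball.
    by rewrite /cballvol !sball_neg.
  rewrite -integralT_indic; last exact: measurable_sball.
  apply: eq_integral => y _; rewrite !indicE; congr ((_ : bool)%:R%:E).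
  by apply/idP/idP; rewrite !inE /A /sball/= -sqnN opprB.
rewrite ge0_integralZr ?measure_ge0//; last by apply/measurable_EFinP; exact: measurable_indic.
by rewrite integralT_indic.
Qed.

Lemma measurable_cballvolb : measurable_fun setT (fun s => cballvol n (b s)).
Proof. exact: (measurableT_comp (@measurable_cballvol R n) mb). Qed.

(** The mixture formula for e^{-|y|}, integrated over y in R^n. This is the mass that normalises the
    dual function before truncation. *)
Lemma mixture_mass :
  \int[m]_s ((w s)%:E * (cballvol n (b s) * cballvol n (b s))) =
  (n`!%:R : R)%:E * ballvol n.
Proof.
have mA : measurable_fun setT (fun p : S * 'rV[R]_n =>
    lebesgue_rV n (sball 0 (b p.1) `&` sball p.2 (b p.1))).
  pose A : set ((S * 'rV[R]_n) * 'rV[R]_n) :=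
    [set q | (sqn (q.2 - 0) <= b q.1.1)%R] `&` [set q | (sqn (q.2 - q.1.2) <= b q.1.1)%R].
  have mb1 : measurable_fun setT (fun q : (S * 'rV[R]_n) * 'rV[R]_n => b q.1.1).
    by apply: (measurableT_comp mb); exact: (measurableT_comp measurable_fst measurable_fst).
  apply: (@measurable_section_measure _ _ _ _ _ (lebesgue_rV n) A).
  have m2 : measurable_fun setT (fun q : (S * 'rV[R]_n) * 'rV[R]_n => q.2).
    exact: measurable_snd.
  have m12 : measurable_fun setT (fun q : (S * 'rV[R]_n) * 'rV[R]_n => q.1.2).
    exact: (measurableT_comp measurable_snd measurable_fst).
  apply: measurableI; apply: measurable_le_set => //; apply: measurable_sqn.
    exact: measurable_rVB.
  exact: measurable_rVB.
pose f (p : S * 'rV[R]_n) := (w p.1)%:E * lebesgue_rV n (sball 0 (b p.1) `&` sball p.2 (b p.1)).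
have mf : measurable_fun setT f.
  by apply: emeasurable_funM => //; apply/measurable_EFinP; exact: (measurableT_comp mw measurable_fst).
have f0 p : 0 <= f p by rewrite mule_ge0 ?lee_fin ?w0 ?measure_ge0.
rewrite -integral_expR_enorm.
transitivity (\int[m]_s \int[lebesgue_rV n]_y f (s, y)).
  apply: eq_integral => s _; rewrite /f/= ge0_integralZl_EFin//.
    by rewrite integral_lebesgue_sballI.
  exact: (measurableT_comp mA (measurable_pair1 s)).
rewrite (fubini_tonelli f)//; apply: eq_integral => y _.
by rewrite -wb euclidean_distE sub0r sqnN.
Qed.

End mixture.
End total_mass.

(** * Typicality as a positive, finite, measurable function *)

Section typicality.
Context {R : realType} {n : nat}.
Variables (X : set 'rV[R]_n) (t : R) (mu : probability 'rV[R]_n R).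
Hypotheses (mX : measurable X) (muX : mu X = 1) (t0 : (0 < t)%R).
Local Notation dist := (scale_dist t (@euclidean_dist R n)).

Lemma measurable_expR_dist d (T : measurableType d) (f g : T -> 'rV[R]_n) :
  measurable_fun setT f -> measurable_fun setT g ->
  measurable_fun setT (fun p => expR (- dist (f p) (g p)) : measurableTypeR R).
Proof.
move=> mf mg; apply: measurableT_comp => //; apply: measurableT_comp => //.
apply: measurable_funM => //; under eq_fun do rewrite euclidean_distE.
by apply: measurable_enorm; exact: measurable_rVB.
Qed.

Lemma expR_dist_le1 x y : (expR (- dist x y) <= 1)%R.
Proof. by rewrite expR_le1 oppr_le0 mulr_ge0 ?sqrtr_ge0 ?(ltW t0). Qed.

Lemma typicality_le1 x : typicality X dist mu x <= 1.
Proof.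
rewrite -[leRHS]muX -[leRHS]mul1e -integral_cst//.
apply: ge0_le_integral => //.
- by apply/measurable_EFinP; apply: measurable_funTS; exact: measurable_expR_dist.
- by move=> y _; rewrite lee_fin expR_dist_le1.
Qed.

Lemma typicality_gt0 x : 0 < typicality X dist mu x.
Proof.
rewrite lt_neqAle integral_ge0 ?andbT; last by move=> y _; rewrite lee_fin expR_ge0.
apply/negP => /eqP/esym K0.
have mf : measurable_fun X (fun y => (expR (- dist x y))%:E).
  by apply/measurable_EFinP; apply: measurable_funTS; exact: measurable_expR_dist.
have /(ae_eq_integral_abs mu mX mf) [N [mN N0 XN]] :
    \int[mu]_(y in X) `|(expR (- dist x y))%:E| = 0.
  by rewrite -[RHS]K0; apply: eq_integral => y _; rewrite gee0_abs// lee_fin expR_ge0.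
have : mu X <= mu N.
  apply: le_measure; rewrite ?inE// => y Xy; apply: XN => /= /(_ Xy).
  by case=> /eqP; rewrite gt_eqF// expR_gt0.
by rewrite muX N0 leNgt lte_fin ltr01.
Qed.

Lemma typicality_fin_num x : typicality X dist mu x \is a fin_num.
Proof.
rewrite ge0_fin_numE; last exact/ltW/typicality_gt0.
by rewrite (le_lt_trans (typicality_le1 x))// ltry.
Qed.

Definition rtypicality x := fine (typicality X dist mu x).

Lemma typicalityE x : typicality X dist mu x = (rtypicality x)%:E.
Proof. by rewrite fineK// typicality_fin_num. Qed.

Lemma rtypicality_gt0 x : (0 < rtypicality x)%R.
Proof. by rewrite -lte_fin -typicalityE typicality_gt0. Qed.

Lemma measurable_typicality : measurable_fun setT (typicality X dist mu).
Proof.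
pose f (p : 'rV[R]_n * 'rV[R]_n) : \bar R := (expR (- dist p.1 p.2) * \1_X p.2)%:E.
rewrite (_ : typicality _ _ _ = fubini_F mu f); last first.
  apply/funext => x; rewrite /typicality integral_mkcond; apply: eq_integral => y _.
  by rewrite patchE /f/= indicE; case: ifPn => _; rewrite ?mulr1 ?mulr0.
apply: measurable_fun_fubini_tonelli_F => [|p]; last by rewrite lee_fin mulr_ge0 ?expR_ge0.
apply/measurable_EFinP; apply: measurable_funM; first exact: measurable_expR_dist.
exact: (measurableT_comp (measurable_indic mX) measurable_snd).
Qed.

Lemma measurable_rtypicality : measurable_fun setT (rtypicality : _ -> measurableTypeR R).
Proof. by apply: measurableT_comp => //; exact: measurable_typicality. Qed.

End typicality.

(** * Features of the scaled kernel and their dual function *)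

Section features.
Context {R : realType} {n : nat}.
Variables (d : measure_display) (S : measurableType d).
Variables (m : {sigma_finite_measure set S -> \bar R}) (w b : S -> R).
Hypotheses (mw : measurable_fun setT w) (mb : measurable_fun setT b) (w0 : forall s, (0 <= w s)%R).
Hypothesis wb : forall x y : 'rV[R]_n, (expR (- euclidean_dist x y))%:E =
     \int[m]_s ((w s)%:E * lebesgue_rV n (sball x (b s) `&` sball y (b s))).
Variables (t T : R) (X Y : set 'rV[R]_n).
Hypotheses (t0 : (0 < t)%R) (mY : measurable Y).
Hypothesis XY : forall x z, X x -> (sqn (z - t *: x) < T)%R -> Y z.
Local Notation dist := (scale_dist t (@euclidean_dist R n)).

Let O := (S * 'rV[R]_n)%type.
Let mO : {sigma_finite_measure set O -> \bar R} := sfprod m (lebesgue_rV n).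

Let phiset : set ('rV[R]_n * O) := [set p | (sqn (p.2.2 - t *: p.1) <= b p.2.1)%R].

(** The scale is put on the points, since t |x - y| = |t x - t y|, so one mixture serves every [t].
    The square root splits the weight evenly between the two features of a product. *)
Definition feature (p : 'rV[R]_n * O) : R := (Num.sqrt (w p.2.1) * \1_phiset p)%R.

Let cvol s : R := fine (cballvol n (b s)).

Let cvolE s : cballvol n (b s) = (cvol s)%:E.
Proof.
rewrite fineK//; have [b0|b0] := leP 0%R (b s).
  by rewrite /cballvol lebesgue_sball// fin_numM// ballvol_fin_num.
by rewrite /cballvol sball_neg// measure0.
Qed.

Let cvol0 s : (0 <= cvol s)%R. Proof. by rewrite fine_ge0// measure_ge0. Qed.

Let mcvol : measurable_fun setT (cvol : S -> measurableTypeR R).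
Proof. by apply: measurableT_comp => //; exact: (@measurable_cballvolb R n _ _ _ mb). Qed.

Let trunc : set S := [set s | (b s < T)%R].

Let mtrunc : measurable trunc.
Proof.
rewrite (_ : trunc = ~` [set s | (T <= b s)%R]).
  by apply: measurableC; exact: measurable_le_set.
by apply/seteqP; split => s; rewrite /trunc/= ltNge => /negP.
Qed.

(** The mass in [mixture_mass], restricted to squared radii below [T]; [M] below is its value and
    replaces n! omega_n as the normaliser. *)
Definition trunc_mass := \int[m]_s (w s * cvol s ^+ 2 * \1_trunc s)%:E.

Variable M : R.
Hypotheses (M0 : (0 < M)%R) (ME : trunc_mass = M%:E).

(* The constraint on [b] keeps the balls around [t *: X] inside [Y], so that the dual
   identity [integral_feature_dual] holds exactly on [X]. *)
Definition feature_dual (o : O) : R :=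
  (Num.sqrt (w o.1) * (cvol o.1 * \1_trunc o.1 / M) * \1_Y o.2)%R.

Let mphiset : measurable phiset.
Proof.
have m1 : measurable_fun setT (fun p : 'rV[R]_n * O => t *: p.1)%R.
  by apply: measurable_rVZ; exact: measurable_fst.
have m22 : measurable_fun setT (fun p : 'rV[R]_n * O => p.2.2).
  exact: (measurableT_comp measurable_snd measurable_snd).
apply: measurable_le_set; first by apply: measurable_sqn; exact: measurable_rVB.
exact: (measurableT_comp mb (measurableT_comp measurable_fst measurable_snd)).
Qed.

Let msqrtw : measurable_fun setT (fun s => Num.sqrt (w s) : measurableTypeR R).
Proof. exact: (measurableT_comp measurable_sqrtr mw). Qed.

Lemma measurable_feature : measurable_fun setT (feature : _ -> measurableTypeR R).
Proof.
apply: measurable_funM; last exact: measurable_indic.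
exact: (measurableT_comp msqrtw (measurableT_comp measurable_fst measurable_snd)).
Qed.

Lemma feature_ge0 p : (0 <= feature p)%R.
Proof. by rewrite mulr_ge0 ?sqrtr_ge0. Qed.

Let mcoef : measurable_fun setT (fun s => cvol s * \1_trunc s / M : measurableTypeR R)%R.
Proof.
apply: measurable_funM => //; apply: measurable_funM => //; exact: measurable_indic.
Qed.

Lemma measurable_feature_dual : measurable_fun setT (feature_dual : _ -> measurableTypeR R).
Proof.
apply: measurable_funM; last exact: (measurableT_comp (measurable_indic mY) measurable_snd).
apply: measurable_funM; first exact: (measurableT_comp msqrtw measurable_fst).
exact: (measurableT_comp mcoef measurable_fst).
Qed.

Lemma feature_dual_ge0 o : (0 <= feature_dual o)%R.
Proof. by rewrite !mulr_ge0 ?sqrtr_ge0 ?invr_ge0 ?(ltW M0). Qed.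

Let phisetE x s z : ((x, (s, z)) \in phiset) = (z \in sball (t *: x)%R (b s)).
Proof. by apply/idP/idP; rewrite !inE. Qed.

Lemma integral_feature_feature x y :
  \int[mO]_o (feature (x, o) * feature (y, o))%:E = (expR (- dist x y))%:E.
Proof.
have mf x' : measurable_fun setT (fun o => feature (x', o) : measurableTypeR R).
  exact: (measurableT_comp measurable_feature (measurable_pair1 x')).
rewrite ge0_integral_sfprod; last 2 first.
- by apply/measurable_EFinP; exact: (measurable_funM (mf x) (mf y)).
- by move=> o; rewrite lee_fin mulr_ge0 ?feature_ge0.
have -> : dist x y = euclidean_dist (t *: x)%R (t *: y)%R.
  rewrite /scale_dist !euclidean_distE -scalerBr sqnZ sqrtrM ?sqr_ge0//.
  by rewrite sqrtr_sqr ger0_norm// ltW.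
rewrite wb; apply: eq_integral => s _.
rewrite -integralT_indic; last by apply: measurableI; exact: measurable_sball.
rewrite -ge0_integralZl_EFin//; last first.
  by apply/measurable_EFinP; apply: measurable_indic; apply: measurableI; exact: measurable_sball.
apply: eq_integral => z _; rewrite /feature/= -EFinM indicI/= !indicE !phisetE.
by rewrite mulrACA -expr2 sqr_sqrtr.
Qed.

Lemma integral_feature_dual x : X x -> \int[mO]_o (feature (x, o) * feature_dual o)%:E = 1.
Proof.
move=> Xx.
have mf : measurable_fun setT (fun o => feature (x, o) : measurableTypeR R).
  exact: (measurableT_comp measurable_feature (measurable_pair1 x)).
rewrite ge0_integral_sfprod; last 2 first.
- by apply/measurable_EFinP; apply: measurable_funM => //; exact: measurable_feature_dual.
- by move=> o; rewrite lee_fin mulr_ge0 ?feature_ge0 ?feature_dual_ge0.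
transitivity (\int[m]_s ((M^-1)%:E * (w s * cvol s ^+ 2 * \1_trunc s)%:E)); last first.
  rewrite ge0_integralZl_EFin ?invr_ge0 ?(ltW M0)//.
  - by rewrite -/trunc_mass ME -EFinM mulVf// gt_eqF.
  - by move=> s _; rewrite lee_fin !mulr_ge0// sqr_ge0.
  - apply/measurable_EFinP; apply: measurable_funM; last exact: measurable_indic.
    by apply: measurable_funM => //; exact: measurable_funX.
apply: eq_integral => s _.
transitivity (\int[lebesgue_rV n]_z ((w s * (cvol s * \1_trunc s / M))%:E *
    (\1_(sball (t *: x)%R (b s) `&` Y) z)%:E)).
  apply: eq_integral => z _; rewrite /feature /feature_dual/= -EFinM indicI/= !indicE !phisetE.
  congr EFin; rewrite -[X in _ = (X * _ * _)%R](sqr_sqrtr (w0 s)).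
  by ring.
have mBY : measurable (sball (t *: x)%R (b s) `&` Y).
  by apply: measurableI => //; exact: measurable_sball.
rewrite ge0_integralZl_EFin//; last 2 first.
- by apply/measurable_EFinP; exact: measurable_indic.
- by rewrite !mulr_ge0// invr_ge0 ltW.
rewrite integralT_indic// indicE; case: (boolP (s \in trunc)) => [|_]; last first.
  by rewrite mulr0 mul0r !mulr0 mul0e mule0.
rewrite inE => sT; rewrite (_ : _ `&` Y = sball (t *: x)%R (b s)).
  rewrite [X in _ * X](_ : _ = (cvol s)%:E); last first.
    rewrite -cvolE -[LHS]/(lebesgue_rV n (sball (t *: x)%R (b s))); have [c0|c0] := leP 0%R (b s); first by rewrite /cballvol !lebesgue_sball.
    by rewrite /cballvol !sball_neg.
  by rewrite -!EFinM; congr EFin; ring.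
by apply/setIidPl => z zB; apply: (XY Xx); rewrite (le_lt_trans zB).
Qed.

(** The normaliser enters squared and the integral over the radii gives back one factor [M]. For [Y]
    a dilated neighbourhood of X this is the asymptotic upper bound. *)
Lemma integral_feature_dual_sqr :
  \int[mO]_o (feature_dual o ^+ 2)%:E = (M^-1)%:E * lebesgue_rV n Y.
Proof.
rewrite ge0_integral_sfprod; last 2 first.
- by apply/measurable_EFinP; apply: measurable_funX; exact: measurable_feature_dual.
- by move=> o; rewrite lee_fin sqr_ge0.
transitivity (\int[m]_s ((w s * cvol s ^+ 2 * \1_trunc s)%:E * ((M ^- 2)%:E * lebesgue_rV n Y))).
  apply: eq_integral => s _; rewrite muleA -EFinM -integralT_indic//.
  rewrite -ge0_integralZl_EFin//; last 2 first.
  - by apply/measurable_EFinP; exact: measurable_indic.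
  - by rewrite !mulr_ge0// ?sqr_ge0// invr_ge0 exprn_ge0// ltW.
  apply: eq_integral => z _; rewrite /feature_dual/= -EFinM; congr EFin.
  rewrite !exprMn sqr_sqrtr// exprVn !indicE.
  by case: (_ \in trunc); case: (_ \in Y); rewrite ?expr1n ?expr0n/= ?mulr1 ?mulr0 ?mul0r ?mulr0// mulrA.
rewrite ge0_integralZr//; last 3 first.
- apply/measurable_EFinP; apply: measurable_funM; last exact: measurable_indic.
  by apply: measurable_funM => //; exact: measurable_funX.
- by move=> s _; rewrite lee_fin !mulr_ge0// sqr_ge0.
- by rewrite mule_ge0// lee_fin invr_ge0 exprn_ge0// ltW.
by rewrite -/trunc_mass ME muleA -EFinM; congr (_%:E * _); field; rewrite gt_eqF.
Qed.

Hypothesis mX : measurable X.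

Lemma integral_rtypicality_inv_le (mu : probability 'rV[R]_n R) : mu X = 1 ->
  \int[mu]_(x in X) ((rtypicality X t mu x)^-1)%:E <= (M^-1)%:E * lebesgue_rV n Y.
Proof.
move=> muX; rewrite -integral_feature_dual_sqr.
apply: (@integral_inv_typicality_le _ _ _ _ _ X mO feature feature_dual).
- exact: mX.
- exact: measurable_feature.
- exact: feature_ge0.
- exact: measurable_feature_dual.
- exact: feature_dual_ge0.
- exact: integral_feature_dual.
- exact: measurable_rtypicality.
- by move=> x; exact: rtypicality_gt0.
(* What remains is K(x) = \int phi(x, o) g(o) do: expand the kernel by [integral_feature_feature]
   and exchange the integrals over [mu] and the feature space. *)
move=> x Xx; rewrite -typicalityE//.
pose f (p : 'rV[R]_n * O) := (feature (x, p.2) * (feature p * \1_X p.1))%:E.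
have mfx : measurable_fun setT (fun p : 'rV[R]_n * O => feature (x, p.2) : measurableTypeR R).
  exact: (measurableT_comp (measurableT_comp measurable_feature (measurable_pair1 x)) measurable_snd).
have mf : measurable_fun setT f.
  apply/measurable_EFinP; apply: measurable_funM => //; apply: measurable_funM.
    exact: measurable_feature.
  exact: (measurableT_comp (measurable_indic mX) measurable_fst).
have f0 p : 0 <= f p by rewrite lee_fin !mulr_ge0 ?feature_ge0.
transitivity (\int[mu]_y \int[mO]_o f (y, o)).
  rewrite /typicality integral_mkcond; apply: eq_integral => y _.
  rewrite patchE -integral_feature_feature /f/= indicE.
  case: ifPn => _; first by under [RHS]eq_integral do rewrite mulr1.
  by rewrite integral0_eq// => o _; rewrite !mulr0.
rewrite (fubini_tonelli f)//; apply: eq_integral => o _.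
rewrite [X in _ = _ * X]integral_mkcond -ge0_integralZl_EFin ?feature_ge0//.
- apply: eq_integral => y _; rewrite /f/= patchE indicE.
  by case: ifPn => _; rewrite ?mulr1 ?mulr0 ?mule0 -?EFinM.
- by move=> y _; rewrite patchE; case: ifPn => // _; rewrite lee_fin feature_ge0.
- apply/(measurable_restrictT _ _).1 => //; apply: measurable_funTS.
  by apply/measurable_EFinP; exact: (measurableT_comp measurable_feature (measurable_pair2 o)).
Qed.

Lemma sqr_sum_le_similarity (C : R) (N : nat) (x : 'I_N -> 'rV[R]_n) (v : 'I_N -> R) :
  (forall i, X (x i)) -> lebesgue_rV n Y = C%:E -> (0 < C)%R ->
  ((\sum_i v i) ^+ 2 <= C / M * \sum_i \sum_j v i * v j * expR (- dist (x i) (x j)))%R.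
Proof.
move=> Xx YC C0.
apply: (@sqr_sum_le_gram _ _ _ mO _ (fun i o => feature (x i, o)) feature_dual).
- by move=> i; exact: (measurableT_comp measurable_feature (measurable_pair1 (x i))).
- by move=> i o; exact: feature_ge0.
- exact: measurable_feature_dual.
- exact: feature_dual_ge0.
- by move=> i j; exact: integral_feature_feature.
- by move=> i; exact: integral_feature_dual.
- by rewrite integral_feature_dual_sqr YC -EFinM mulrC.
- by rewrite divr_gt0.
Qed.

End features.

(** * Bounds on the diversity of every order *)

Lemma expR_convex1 (R : realType) (a y : R) : (0 <= a <= 1)%R ->
  (expR (a * y) <= 1 - a + a * expR y)%R.
Proof.
move=> /andP[a0 a1].
(* The tangent of exp at a y lies below exp at y ([h1]) and at 0 ([h2]); the two are combined with
   weights a and 1 - a. *)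
have h1 : (expR (a * y) * (1 + (1 - a) * y) <= expR y)%R.
  rewrite [leRHS](_ : _ = expR (a * y) * expR ((1 - a) * y))%R.
    by rewrite ler_pM2l ?expR_gt0// expR_ge1Dx.
  by rewrite -expRD; congr expR; ring.
have h2 : (expR (a * y) * (1 + - (a * y)) <= 1)%R.
  rewrite [leRHS](_ : _ = expR (a * y) * expR (- (a * y)))%R.
    by rewrite ler_pM2l ?expR_gt0// expR_ge1Dx.
  by rewrite -expRD subrr expR0.
have a1' : (0 <= 1 - a)%R by rewrite subr_ge0.
have := lerD (ler_wpM2l a0 h1) (ler_wpM2l a1' h2).
by rewrite (_ : (a * _ + _)%R = expR (a * y))%R; [lra|ring].
Qed.

Section diversity_bounds.
Context d (T : measurableType d) (R : realType).
Variables (X : set T) (dist : T -> T -> R) (mu : probability T R) (k : T -> R) (kmin : R).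
Hypotheses (mX : measurable X) (muX : mu X = 1) (mk : measurable_fun setT k).
Hypotheses (k0 : forall x, (0 < k x)%R) (k1 : forall x, (k x <= 1)%R).
Hypotheses (kmin0 : (0 < kmin)%R) (kminX : forall x, X x -> (kmin <= k x)%R).
Hypothesis kE : forall x, typicality X dist mu x = (k x)%:E.

(** On X the logarithm is bounded, as kmin <= k <= 1, so every power of [k] is the exponential of a
    bounded function and all the averages below are finite. *)
Let l x := ln (k x).
Let L := (- ln kmin)%R.

Let ml : measurable_fun setT (l : T -> measurableTypeR R).
Proof. exact: (measurableT_comp (@measurable_ln R)). Qed.

Let kl x : k x = expR (l x).
Proof. by rewrite lnK// posrE. Qed.

Let lL x : X x -> (- L <= l x <= 0)%R.
Proof.
move=> Xx; rewrite /L opprK ler_ln ?posrE ?kminX//=.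
by rewrite ln_le0.
Qed.

Let L0 : (0 <= L)%R.
Proof.
have [x Xx] : X !=set0.
  apply/set0P/eqP => X0; move: muX; rewrite X0 measure0 => /esym/eqP.
  by rewrite onee_eq0.
by have /andP[? ?] := lL Xx; lra.
Qed.

Let al x a : X x -> (`|a * l x| <= `|a| * L)%R.
Proof.
move=> Xx; rewrite normrM ler_wpM2l// ler_norml.
by have /andP[-> h] := lL Xx; rewrite (le_trans h).
Qed.

Local Notation avg f := (\int[mu]_(x in X) (f x))%R.

Let bint (f : T -> R) (c : R) : measurable_fun setT f -> (forall x, X x -> `|f x| <= c)%R ->
  mu.-integrable X (EFin \o f).
Proof.
move=> mf fc; apply: measurable_bounded_integrable => //.
- by rewrite (le_lt_trans (probability_le1 _ _))// ltry.
- exact: measurable_funTS.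
- exists c; split; first by rewrite num_real.
  by move=> M cM x /= Xx; rewrite (le_trans (fc _ Xx))// ltW.
Qed.

Let avg_cst (c : R) : avg (fun=> c) = c.
Proof. by rewrite Rintegral_cst// /= muX mulr1. Qed.

Let icst (c : R) : mu.-integrable X (EFin \o (fun=> c)).
Proof. exact: finite_measure_integrable_cst. Qed.

Let iexp a : mu.-integrable X (EFin \o (fun x => expR (a * l x))%R).
Proof.
apply: (@bint _ (expR (`|a| * L))).
  by apply: measurableT_comp => //; apply: measurable_funM.
move=> x Xx; rewrite ger0_norm ?expR_ge0// ler_expR (le_trans _ (al a Xx))//.
exact: ler_norm.
Qed.

Let il : mu.-integrable X (EFin \o l).
Proof.
apply: (@bint _ L) => // x Xx; have /andP[? ?] := lL Xx.
by rewrite ler_norml; apply/andP; split => //; have := L0; lra.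
Qed.

Let avgE (f : T -> R) : mu.-integrable X (EFin \o f) ->
  \int[mu]_(x in X) (f x)%:E = (avg f)%:E.
Proof. by move=> fi; rewrite /Rintegral fineK//; exact: integrable_fin_num. Qed.

Let avg_gt0 a : (0 < avg (fun x => expR (a * l x)))%R.
Proof.
apply: (@lt_le_trans _ _ (avg (fun=> expR (- (`|a| * L)))))%R.
  by rewrite avg_cst expR_gt0.
apply: le_Rintegral => // x Xx; rewrite ler_expR lerNl (le_trans _ (al a Xx))//.
by rewrite -normrN ler_norm.
Qed.

Let diversityE (r : R) : r != 1%R ->
  diversity X dist r%:E mu = (expR ((1 - r)^-1 * ln (avg (fun x => expR ((r - 1) * l x)))))%:E.
Proof.
move=> r1; rewrite /diversity (negbTE r1).
under eq_integral => x _.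
  rewrite kE poweR_EFin /powR gt_eqF//; over.
by rewrite avgE// poweR_EFin /powR gt_eqF// avg_gt0.
Qed.

Let diversity1E :
  diversity X dist 1%:E mu = (expR (- avg l))%:E.
Proof.
rewrite /diversity eqxx.
under eq_integral => x _ do rewrite kE lne_EFin//.
by rewrite avgE.
Qed.

Let ess_le (y : \bar R) : (ess_sup mu (typicality X dist mu) <= y) <->
  {ae mu, forall x, X x -> (k x)%:E <= y}.
Proof.
have muXC : mu (~` X) = 0.
  by rewrite probability_setC// muX subee.
split.
  move=> /ess_supP; apply: filterS => x /= + _.
  by rewrite kE.
move=> H; apply/ess_supP.
have aeX : {ae mu, forall x, X x} by exists (~` X); split => //; exact: measurableC.
by apply: filterS2 H aeX => x /= H Xx; rewrite kE H.
Qed.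

(** Both the comparison of k^(r-1) with C^(r-1) and the sign of the outer exponent 1/(1-r) change at
    r = 1, so the two ranges give the same inequality. *)
Lemma diversity_ge (C : R) (q : \bar R) : (0 < C)%R -> (forall x, X x -> (k x <= C)%R) ->
  0 <= q -> (C^-1)%:E <= diversity X dist q mu.
Proof.
move=> C0 kC; case: q => [r| |]// _.
  have lC x : X x -> (l x <= ln C)%R by move=> Xx; rewrite ler_ln ?posrE ?kC.
  have -> : (C^-1 = expR (- ln C))%R by rewrite expRN lnK ?posrE.
  have [->|r1] := eqVneq r 1%R.
    rewrite diversity1E lee_fin ler_expR lerN2 -[leRHS]avg_cst.
    exact: le_Rintegral.
  rewrite diversityE// lee_fin ler_expR.
  case: (ltgtP r 1%R) => [r1'|r1'|rE]; last by rewrite rE eqxx in r1.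
    rewrite ler_pdivlMl ?subr_gt0// -[leLHS]expRK ler_ln ?posrE ?expR_gt0//.
    rewrite -[leLHS]avg_cst; apply: le_Rintegral => // x Xx.
    rewrite ler_expR; have := lC _ Xx; nra.
  rewrite ler_ndivlMl ?subr_lt0// -[leRHS]expRK ler_ln ?posrE ?expR_gt0//.
  rewrite -[leRHS]avg_cst; apply: le_Rintegral => // x Xx.
  rewrite ler_expR; have := lC _ Xx; nra.
rewrite /diversity -[leLHS]inveK.
have e0 : 0 <= ess_sup mu (typicality X dist mu).
  apply: ess_sup_gee; last by apply: aeW => x; rewrite kE lee_fin ltW.
  by have := probability_setT mu => /= ->.
rewrite lee_pV2 ?inE ?inve_ge0 ?lee_fin ?invr_ge0 ?(ltW C0)//.
rewrite inver gt_eqF ?invr_gt0// invrK; apply/ess_le.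
by apply: aeW => x Xx; rewrite lee_fin kC.
Qed.

(** The hypothesis bounds the diversity of order 0, and diversity decreases with the order. For
    finite orders, the integrand is compared pointwise with an affine function of 1/k that touches
    it at k = 1/C, which is Jensen's inequality in tangent form. *)
Lemma diversity_le (C : R) (q : \bar R) : (0 < C)%R ->
  \int[mu]_(x in X) ((k x)^-1)%:E <= C%:E ->
  0 <= q -> diversity X dist q mu <= C%:E.
Proof.
move=> C0 kC.
have kVE x : ((k x)^-1 = expR (- 1 * l x))%R by rewrite mulN1r expRN -kl.
have kC' : (avg (fun x => expR (- 1 * l x)) <= C)%R.
  rewrite -lee_fin -avgE//; apply: le_trans kC.
  by under [leRHS]eq_integral do rewrite kVE.
pose c := ln C; have CE : C = expR c by rewrite lnK ?posrE.
pose A := avg (fun x => expR (- 1 * l x)); have AC : (expR (- c) * A <= 1)%R.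
  by rewrite expRN -CE ler_pdivrMl// mulr1.
have affi (a' b' : R) : mu.-integrable X (EFin \o (fun x => a' + b' * expR (- 1 * l x))%R).
  apply: (@bint _ (`|a'| + `|b'| * expR L)%R).
    apply: measurable_funD => //; apply: measurable_funM => //.
    by apply: measurableT_comp => //; exact: measurable_funM.
  move=> x Xx; rewrite (le_trans (ler_normD _ _))// lerD2l normrM ler_wpM2l//.
  rewrite ger0_norm ?expR_ge0// ler_expR (le_trans (ler_norm _))//.
  by rewrite (le_trans (al _ Xx))// normrN1 mul1r.
have affE (a' b' : R) : avg (fun x => a' + b' * expR (- 1 * l x))%R = (a' + b' * A)%R.
  have ib : mu.-integrable X (EFin \o (fun x => b' * expR (- 1 * l x))%R).
    exact: (integrableZl mX b' (iexp (- 1))).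
  rewrite (RintegralD mX (icst a') ib).
  rewrite avg_cst; congr (_ + _)%R.
  by rewrite RintegralZl.
case: q => [r| |]// r0.
  rewrite CE.
  have [->|r1] := eqVneq r 1%R.
    rewrite diversity1E lee_fin ler_expR lerNl.
    apply: (@le_trans _ _ ((1 - c) + - expR (- c) * A)%R); first by lra.
    rewrite -affE; apply: le_Rintegral => // x Xx.
    have := expR_ge1Dx (- (c + l x)); rewrite opprD expRD mulN1r; lra.
  rewrite diversityE// lee_fin ler_expR.
  case: (ltgtP r 1%R) => [r1'|r1'|rE]; last by rewrite rE eqxx in r1.
    rewrite ler_pdivrMl ?subr_gt0// -[leRHS]expRK ler_ln ?posrE ?expR_gt0//.
    pose a := (1 - r)%R; pose e := expR (a * c); have e0 : (0 < e)%R by exact: expR_gt0.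
    have a0 : (0 < a)%R by rewrite /a subr_gt0.
    apply: (@le_trans _ _ (e * (1 - a) + e * a * expR (- c) * A)%R).
      rewrite -affE; apply: le_Rintegral => // x Xx.
      (* The order being nonnegative means a = 1 - r <= 1, the range in which the chord of exp lies
         above its graph. *)
      have a01 : (0 <= a <= 1)%R by rewrite ltW//= /a gerBl -lee_fin.
      have := ler_wpM2l (ltW e0) (expR_convex1 (- c - l x)%R a01).
      rewrite {1}/e -expRD (_ : (a * c + _)%R = ((r - 1) * l x)%R); last by rewrite /a; ring.
      by rewrite expRD mulN1r => /le_trans; apply; rewrite le_eqVlt; apply/orP; left; apply/eqP; ring.
    have ea0 : (0 <= e * a)%R by rewrite mulr_ge0 ?ltW.
    by have := ler_wpM2l ea0 AC; rewrite -/a -/e; lra.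
  rewrite ler_ndivrMl ?subr_lt0// -[leLHS]expRK ler_ln ?posrE ?expR_gt0//.
  pose a := (r - 1)%R; pose e := expR ((1 - r) * c); have e0 : (0 < e)%R by exact: expR_gt0.
  have a0 : (0 < a)%R by rewrite /a subr_gt0.
  apply: (@le_trans _ _ (e * (1 + a) + - (e * a * expR (- c)) * A)%R).
    have ea0 : (0 <= e * a)%R by rewrite mulr_ge0 ?ltW.
    by have := ler_wpM2l ea0 AC; rewrite -/e; lra.
  rewrite -affE; apply: le_Rintegral => // x Xx; rewrite -/a.
  have h1 := expR_ge1Dx (- c - l x)%R.
  have h2 := expR_ge1Dx (- (a * (- c - l x)))%R.
  have -> : expR (a * l x) = (e * expR (- (a * (- c - l x))))%R.
    by rewrite -expRD; congr expR; rewrite /a; ring.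
  apply: (@le_trans _ _ (e * (1 + - (a * (- c - l x)))))%R; last by rewrite ler_pM2l.
  rewrite [leLHS](_ : _ = (e * (1 - a * (expR (- c - l x) - 1)))%R); last first.
    by rewrite expRD mulN1r; ring.
  by rewrite ler_pM2l// lerD2l lerN2 ler_pM2l//; lra.
rewrite /diversity -[leRHS]inveK.
have e0 : 0 <= ess_sup mu (typicality X dist mu).
  apply: ess_sup_gee; last by apply: aeW => x; rewrite kE lee_fin ltW.
  by have := probability_setT mu => /= ->.
rewrite lee_pV2 ?inE ?inve_ge0 ?lee_fin ?(ltW C0)// inver gt_eqF//.
rewrite leNgt; apply/negP => EC.
have : (ess_sup mu (typicality X dist mu)) \is a fin_num.
  by rewrite ge0_fin_numE// (lt_trans EC)// ltry.
move: EC e0; case eE : (ess_sup mu (typicality X dist mu)) => [e| |]//.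
rewrite lte_fin lee_fin => eC e0 _.
(* If the essential supremum e were below 1/C, then almost everywhere 1/k >= 1/e' > C, against the
   integral bound. The midpoint is positive even for e = 0. *)
pose e' := ((e + C^-1) / 2)%R.
have e'0 : (0 < e')%R by rewrite divr_gt0// ltr_wpDl// invr_gt0.
have e'C : (C < e'^-1)%R.
  by rewrite -[ltLHS]invrK ltf_pV2 ?posrE ?invr_gt0// /e' ltr_pdivrMr//; lra.
have : (e'^-1)%:E <= C%:E.
  apply: le_trans kC; rewrite -[leLHS]mule1 -muX -integral_cst//.
  apply: ae_ge0_le_integral => //.
  - by move=> x _; rewrite lee_fin invr_ge0 ltW.
  - by move=> x _; rewrite lee_fin invr_ge0 ltW.
  - apply/measurable_EFinP; apply: measurable_funTS.
    rewrite (_ : (fun x => _) = (fun x => expR (- 1 * l x)))%R; last exact/funext.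
    by apply: measurableT_comp => //; exact: measurable_funM.
  have /ess_le : ess_sup mu (typicality X dist mu) <= e%:E by rewrite eE.
  apply: filterS => x ke Xx; rewrite lee_fin lef_pV2 ?posrE//.
  by have := ke Xx; rewrite lee_fin /e' ler_pdivlMr//; lra.
by rewrite lee_fin leNgt e'C.
Qed.

End diversity_bounds.

(** * Magnitude of a finite set from its quadratic form *)

Section weighting.
Context {T : Type} {R : realType}.
Variables (d : T -> T -> R) (N : nat) (x : 'I_N -> T) (C : R).
Hypotheses (dC : forall a b, d a b = d b a) (C0 : (0 < C)%R).
Let Z i j := expR (- d (x i) (x j)).
Hypothesis quad : forall v : 'I_N -> R,
  ((\sum_i v i) ^+ 2 <= C * \sum_i \sum_j v i * v j * Z i j)%R.

(* The all-ones vector is orthogonal to the kernel of the symmetric matrix [Z], so no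
   strict definiteness is needed. *)
Let weighting_exists : exists w, weighting d x w.
Proof.
have : ((const_mx 1%R : 'rV[R]_N) <= similarity_mx d x)%MS.
  rewrite submxE; apply/eqP/rowP => k; rewrite !mxE.
  pose u i := cokermx (similarity_mx d x) i k.
  have Zu i : (\sum_j Z i j * u j = 0)%R.
    have := congr1 (fun A : 'M[R]_(N, N) => A i k) (mulmx_coker (similarity_mx d x)).
    by rewrite !mxE => h; rewrite -[RHS]h; apply: eq_bigr => j _; rewrite mxE.
  have := quad u.
  rewrite [X in (_ * X)%R]big1 ?mulr0; last first.
    move=> i _; transitivity (u i * \sum_j Z i j * u j)%R; last by rewrite Zu mulr0.
    rewrite big_distrr/=; by apply: eq_bigr => j _; ring.
  rewrite real_exprn_even_le0 ?num_real//= => /eqP h; rewrite -[RHS]h.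
  by apply: eq_bigr => i _; rewrite mxE mul1r.
move=> /submxP[D DE]; exists D^T; rewrite /weighting/=.
apply/trmx_inj; rewrite trmx_mul trmxK (_ : (similarity_mx d x)^T = similarity_mx d x).
  by rewrite -DE; apply/matrixP => i j; rewrite !mxE.
by apply/matrixP => i j; rewrite !mxE dC.
Qed.

Let w := xget 0%R (weighting d x).
Let mag := finite_magnitude d x.

Let wE i : (\sum_j Z i j * w j ord0 = 1)%R.
Proof.
have [w' w'P] := weighting_exists.
have : weighting d x w by exact: xgetI w'P.
move=> /(congr1 (fun A : 'cV[R]_N => A i ord0)); rewrite !mxE => h; rewrite -[RHS]h.
by apply: eq_bigr => j _; rewrite mxE.
Qed.

Let Zw (v : 'I_N -> R) : (\sum_i \sum_j v i * w j ord0 * Z i j = \sum_i v i)%R.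
Proof.
apply: eq_bigr => i _; rewrite -[RHS]mulr1 -(wE i) big_distrr/=.
by apply: eq_bigr => j _; ring.
Qed.

(** Apply [quad] to the weighting: its energy w^T Z w equals its sum, so mag^2 <= C mag. *)
Lemma finite_magnitude_le : (mag <= C)%R.
Proof.
have := quad (fun i => w i ord0); rewrite Zw -/mag => h.
have [//|Cm] := leP mag C.
have m0 : (0 < mag)%R by rewrite (lt_trans C0).
by move: h; rewrite expr2 ler_pM2r// leNgt Cm.
Qed.

(** By [quad] the form is nonnegative, and V' > 0. Its value at v - V' w is V'^2 mag - V', hence
    1/V' <= mag. *)
Lemma finite_magnitude_ge (v : 'I_N -> R) (V : R) : (\sum_i v i = 1)%R ->
  (\sum_i \sum_j v i * v j * Z i j <= V)%R -> (V^-1 <= mag)%R.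
Proof.
move=> v1; set V' := (\sum_i _)%R => V'V.
have V'0 : (0 < V')%R.
  have := quad v; rewrite v1 expr1n -/V' => h.
  have : (0 < C * V')%R by rewrite (lt_le_trans _ h).
  by rewrite pmulr_rgt0.
have V0 : (0 < V)%R by rewrite (lt_le_trans V'0).
have : (0 <= C * \sum_i \sum_j (v i - V' * w i ord0) * (v j - V' * w j ord0) * Z i j)%R.
  by rewrite (le_trans _ (quad _))// sqr_ge0.
rewrite pmulr_rge0//.
have -> : (\sum_i \sum_j (v i - V' * w i ord0) * (v j - V' * w j ord0) * Z i j =
  V' - V' * \sum_i \sum_j v i * w j ord0 * Z i j - V' * \sum_i \sum_j w i ord0 * v j * Z i j
   + V' ^+ 2 * \sum_i \sum_j w i ord0 * w j ord0 * Z i j)%R.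
  rewrite !big_distrr/= -!sumrB -big_split/=; apply: eq_bigr => i _.
  rewrite !big_distrr/= -!sumrB -big_split/=; apply: eq_bigr => j _.
  by ring.
have -> : (\sum_i \sum_j w i ord0 * v j * Z i j = \sum_i \sum_j v i * w j ord0 * Z i j)%R.
  rewrite exchange_big/=; apply: eq_bigr => i _; apply: eq_bigr => j _.
  by rewrite /Z dC; ring.
have magE : mag = (\sum_i w i ord0)%R by [].
rewrite !Zw v1 -magE => h.
have {}h : (1 <= V' * mag)%R by rewrite -(ler_pM2l V'0); lra.
apply: (@le_trans _ _ V'^-1)%R; first by rewrite lef_pV2 ?posrE.
by rewrite -div1r ler_pdivrMr// mulrC.
Qed.

End weighting.

(** * Partitions of a compact set into pieces of small diameter *)

Section partition.
Context {R : realType} {n : nat}.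

Lemma euclidean_dist_triangle (a b c : 'rV[R]_n) :
  (euclidean_dist a c <= euclidean_dist a b + euclidean_dist b c)%R.
Proof.
rewrite !euclidean_distE; set u := (a - b)%R; set v := (b - c)%R.
have -> : (a - c = u + v)%R by rewrite /u /v addrA subrK.
clearbody u v.
pose p := Num.sqrt (sqn u); pose q := Num.sqrt (sqn v).
have p0 : (0 <= p)%R by exact: sqrtr_ge0.
have q0 : (0 <= q)%R by exact: sqrtr_ge0.
have pE : (p ^+ 2 = sqn u)%R by rewrite sqr_sqrtr ?sqn_ge0.
have qE : (q ^+ 2 = sqn v)%R by rewrite sqr_sqrtr ?sqn_ge0.
pose dot := (\sum_i u ord0 i * v ord0 i)%R.
have sqnE (c1 c2 : R) : sqn (c1 *: u + c2 *: v)%R = (c1 ^+ 2 * sqn u + 2 * c1 * c2 * dot + c2 ^+ 2 * sqn v)%R.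
  rewrite /sqn /dot !big_distrr/= -!big_split; apply: eq_bigr => i _.
  by rewrite !mxE/=; ring.
have dotpq : (dot <= p * q)%R.
  have [p00|p00] := eqVneq p 0%R.
    have : u = 0%R by apply/eqP; rewrite -sqn_eq0 -pE p00 expr0n.
    move=> u0; rewrite p00 mul0r /dot big1// => i _; by rewrite u0 mxE mul0r.
  have [q00|q00] := eqVneq q 0%R.
    have : v = 0%R by apply/eqP; rewrite -sqn_eq0 -qE q00 expr0n.
    move=> v0; rewrite /dot big1 => [|i _]; first by rewrite q00 mulr0.
    by rewrite v0 mxE mulr0.
  have pp : (0 < p)%R by rewrite lt_neqAle eq_sym p00.
  have qp : (0 < q)%R by rewrite lt_neqAle eq_sym q00.
  (* Cauchy-Schwarz: with p = |u| and q = |v|, the square of |q u - p v| expands to 2 p q (p q - <u,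
     v>). *)
  have := sqn_ge0 (q *: u + - p *: v)%R; rewrite sqnE -pE -qE => h.
  have pq : (0 < p * q)%R by rewrite mulr_gt0.
  rewrite -(ler_pM2l pq); lra.
rewrite -(ler_sqr (x := Num.sqrt _)) ?nnegrE ?sqrtr_ge0 ?addr_ge0// sqr_sqrtr ?sqn_ge0//.
have := sqnE 1%R 1%R; rewrite !scale1r => ->; rewrite -/p -/q -pE -qE.
have : (dot <= p * q)%R by []. lra.
Qed.

Lemma euclidean_distC (a b : 'rV[R]_n) : euclidean_dist a b = euclidean_dist b a.
Proof. by rewrite !euclidean_distE -sqnN opprB. Qed.

(** [ball] is a sup-norm ball: two of its points differ by at most e/(n+1) in each coordinate, and
    sqrt n / (n+1) <= 1. *)
Lemma euclidean_dist_ball (c y z : 'rV[R]_n) (e : R) : (0 < e)%R ->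
  ball c (e / (2 * n.+1%:R))%R y -> ball c (e / (2 * n.+1%:R))%R z ->
  (euclidean_dist y z <= e)%R.
Proof.
set q := (e / _)%R => e0 cy cz.
pose r := (e / n.+1%:R)%R; have r0 : (0 < r)%R by rewrite divr_gt0.
have : sball y (n%:R * r ^+ 2)%R z.
  apply: rbox_sub_sball => [|i]; first exact: ltW.
  move: cy cz => [_ /(_ ord0 i) +] [_ /(_ ord0 i)]; rewrite /ball/= !ltr_distl => /andP[h1 h2] /andP[h3 h4].
  have rE : (r = q + q)%R.
    by rewrite /r /q; field; rewrite addrC natr1 pnatr_eq0.
  by rewrite !mxE rE; apply/andP; split; lra.
rewrite /sball/= => h; rewrite euclidean_distC euclidean_distE.
rewrite -[leRHS](ger0_norm (ltW e0)) -sqrtr_sqr ler_wsqrtr// (le_trans h)//.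
rewrite /r expr_div_n mulrCA ler_piMr ?sqr_ge0//.
rewrite ler_pdivrMr ?exprn_gt0// mul1r -natrX ler_nat.
by rewrite (leq_trans (leqnSn n))// expnS expn1 leq_pmulr.
Qed.

(** A finite subcover of X by small balls, cut down to X and made disjoint. *)
Lemma compact_partition (X : set 'rV[R]_n) (e : R) : compact X -> (0 < e)%R ->
  exists N (A : 'I_N -> set 'rV[R]_n),
  [/\ forall i, measurable (A i), forall i j, i != j -> A i `&` A j = set0,
    forall i, A i !=set0, \bigcup_(i in [set: 'I_N]) A i = X &
    forall i y z, A i y -> A i z -> (euclidean_dist y z <= e)%R].
Proof.
move=> cX e0; pose r := (e / (2 * n.+1%:R))%R.
have r0 : (0 < r)%R by rewrite divr_gt0.
have mX := compact_measurable_rV cX.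
have mball (c : 'rV[R]_n) : measurable (ball c r) by apply: open_measurable_rV; exact: ball_open.
have : compact X by []. rewrite compact_cover => /(_ _ X (fun c => ball c r)).
case=> [c _|x Xx|D' _ XD'].
- exact: ball_open.
- by exists x => //; exact: ballxx.
pose s : seq 'rV[R]_n := finmap.enum_fset D'.
pose F k := if (k < size s)%N then X `&` ball (nth 0%R s k) r else set0.
pose B k := seqDU F k.
have mF k : measurable (F k) by rewrite /F; case: ifP => // _; exact: measurableI.
have mB k : measurable (B k).
  by rewrite /B /seqDU; apply: measurableD => //; exact: bigsetU_measurable.
have tB := @trivIset_seqDU _ F.
have UB : \bigcup_k B k = X.
  rewrite /B -seqDU_bigcup_eq; apply/seteqP; split => [x [k _]|x Xx].
    by rewrite /F; case: ifP => // _ [].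
  have [c /= cD' cx] := XD' _ Xx.
  exists (index c s) => //; rewrite /F index_mem; have -> : c \in s by exact: cD'.
  by rewrite nth_index.
have Bsub k : B k `<=` F k by move=> x [].
(* Only nonempty pieces are kept, since each one has to supply a sample point; disjointness then
   makes the sample points distinct. *)
pose S : {set 'I_(size s)} := finset (fun i : 'I_(size s) => `[< B i !=set0 >]).
exists #|S|, (fun j : 'I_#|S| => B (enum_val j : 'I_(size s))); split.
- by move=> i.
- move=> i j ij; move/trivIsetP : tB => /(_ (enum_val i) (enum_val j) I I); apply.
  by apply: contra ij => /eqP /val_inj /enum_val_inj ->.
- by move=> i; have := enum_valP i; rewrite inE => /asboolP.
- rewrite -UB; apply/seteqP; split => [x [i _ Bx]|x [k _ Bx]]; first by exists (enum_val i).
  have ks : (k < size s)%N by have := Bsub _ _ Bx; rewrite /F; case: ifP.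
  have kS : Ordinal ks \in S by rewrite inE; apply/asboolP; exists x.
  by exists (enum_rank_in kS (Ordinal ks)) => //; rewrite enum_rankK_in.
- move=> i y z /Bsub + /Bsub; rewrite /F ltn_ord => -[_ h1] [_ h2].
  exact: euclidean_dist_ball h1 h2.
Qed.

End partition.

(** * Bounds on the magnitude of a compact set *)

Section magnitude_bounds.
Context {R : realType} {n : nat}.
Variables (X : set 'rV[R]_n) (t C : R).
Hypotheses (cX : compact X) (t0 : (0 < t)%R) (C0 : (0 < C)%R).
Local Notation dist := (scale_dist t (@euclidean_dist R n)).
Hypothesis quad : forall N (x : 'I_N -> 'rV[R]_n) (v : 'I_N -> R), (forall i, X (x i)) ->
  ((\sum_i v i) ^+ 2 <= C * \sum_i \sum_j v i * v j * expR (- dist (x i) (x j)))%R.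

Let distC a b : dist a b = dist b a.
Proof. by rewrite /scale_dist euclidean_distC. Qed.

Lemma magnitude_le : magnitude dist X <= C%:E.
Proof.
apply: ge_ereal_sup => _ [N [x [_ Xx ->]]]; rewrite lee_fin.
by apply: finite_magnitude_le => // v; exact: quad.
Qed.

(** Concentrate [mu] at sample points of a partition of mesh e/t. Scaled distances change by at most
    e, so the row sums of the discrete kernel are at most e^e B, and [finite_magnitude_ge] applies
    to the weights mu(A_i). *)
Lemma magnitude_ge (mu : probability 'rV[R]_n R) (B : R) : mu X = 1 -> (0 < B)%R ->
  (forall x, typicality X dist mu x <= B%:E) -> (B^-1)%:E <= magnitude dist X.
Proof.
move=> muX B0 typB.
have mX := compact_measurable_rV cX.
suff H (e : R) : (0 < e)%R -> ((expR e * B)^-1)%:E <= magnitude dist X.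
  apply/lee_addgt0Pr => e e0.
  (* The claim is used at e B, because e^{-eB} / B >= (1 - e B) / B = 1/B - e. *)
  have eB0 : (0 < e * B)%R by rewrite mulr_gt0.
  rewrite -leeBlDr// -EFinB; apply: le_trans (H _ eB0); rewrite lee_fin.
  rewrite invfM -expRN lerBlDr.
  have h := expR_ge1Dx (- (e * B))%R.
  have Bi : (0 <= B^-1)%R by rewrite invr_ge0 ltW.
  have := ler_wpM2r Bi h; rewrite mulrDl mul1r mulNr mulfK ?gt_eqF//.
  by lra.
move=> e0; have et0 : (0 < e / t)%R by rewrite divr_gt0.
have [N [A [mA tA A0 UA Ae]]] := compact_partition cX et0.
have [x xA] := choice A0.
pose v i := fine (mu (A i)).
have vE i : mu (A i) = (v i)%:E by rewrite fineK// fin_num_measure.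
have v0 i : (0 <= v i)%R by rewrite fine_ge0// measure_ge0.
have tA' : trivIset setT A by apply/trivIsetP => i j _ _; exact: tA.
have UA' : X = \big[setU/set0]_(i < N) A i.
  rewrite -UA -bigcup_seq; apply: eq_bigcupl; split => i //= _.
  exact: mem_index_enum.
have v1 : (\sum_i v i = 1)%R.
  apply: EFin_inj; rewrite -muX UA' measure_bigsetU_ord//.
  by rewrite -sumEFin; apply: eq_bigr => i _; rewrite -vE.
have Xx i : X (x i) by rewrite -UA; exists i.
have injx : injective x.
  move=> i j xij; apply/eqP; apply/negPn/negP => ij.
  by have : (A i `&` A j) (x i); [split => //; rewrite xij|rewrite tA].
apply: (@le_trans _ _ (finite_magnitude dist x)%:E); last first.
  by apply: ereal_sup_ubound; exists N, x; split.
rewrite lee_fin; apply: (finite_magnitude_ge distC C0 _ v1) => [u|]; first exact: quad.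
have row i : (\sum_j v j * expR (- dist (x i) (x j)) <= expR e * B)%R.
  rewrite -lee_fin -sumEFin.
  apply: (@le_trans _ _ ((expR e)%:E * typicality X dist mu (x i))); last first.
    by rewrite EFinM lee_pmul2l// lte_fin expR_gt0.
  have mf : measurable_fun setT (fun y => (expR (- dist (x i) y))%:E).
    by apply/measurable_EFinP; exact: measurable_expR_dist.
  rewrite /typicality UA' ge0_integral_bigsetU//; last 3 first.
  - exact: index_enum_uniq.
  - exact: sub_trivIset tA'.
  - exact: measurable_funTS.
  rewrite ge0_sume_distrr; last by move=> j _; apply: integral_ge0 => y _; rewrite lee_fin expR_ge0.
  apply: lee_sum => j _.
  rewrite EFinM -vE muleC -integral_cst// -ge0_integralZl_EFin ?expR_ge0//; last exact: measurable_funTS.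
  apply: ge0_le_integral => //.
  - by move=> y _; rewrite /= lee_fin expR_ge0.
  - by apply: measurable_funTS; apply: emeasurable_funM.
  move=> y Ay; rewrite -EFinM lee_fin -expRD ler_expR.
  rewrite lerNl opprD opprK addrC lerBlDr /scale_dist.
  have h1 := euclidean_dist_triangle (x i) (x j) y.
  have h2 := Ae j _ _ (xA j) Ay.
  rewrite -ler_pdivlMl// mulrDr mulKf ?gt_eqF//.
  rewrite (le_trans h1)// lerD2l (le_trans h2)// mulrC.
  done.
apply: (@le_trans _ _ (\sum_i v i * (expR e * B))%R).
  apply: ler_sum => i _; under eq_bigr do rewrite -mulrA.
  by rewrite -big_distrr/= ler_wpM2l.
by rewrite -big_distrl/= v1 mul1r.
Qed.

End magnitude_bounds.

(** * Typicality of normalised Lebesgue measure *)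

Lemma mnormalizeE d (T : measurableType d) (R : realType)
    (m : {measure set T -> \bar R}) (P : probability T R) (V : R) (A : set T) :
  (0 < V)%R -> m setT = V%:E -> mnormalize m P A = (V^-1)%:E * m A.
Proof. by move=> V0 mV; rewrite /mnormalize mV eqe gt_eqF//= muleC. Qed.

Section normalized.
Context {R : realType} {n : nat}.
Variables (X : set 'rV[R]_n) (cX : compact X) (V : R).
Hypotheses (V0 : (0 < V)%R) (XV : lebesgue_rV n X = V%:E).

Lemma normalized_lebesgueE A : measurable A ->
  normalized_lebesgue cX A = (V^-1)%:E * lebesgue_rV n (A `&` X).
Proof.
move=> mA; apply: (mnormalizeE _ _ V0).
by rewrite -XV -[X in lebesgue_rV n X]setTI.
Qed.

Lemma normalized_lebesgue1 : normalized_lebesgue cX X = 1.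
Proof.
rewrite normalized_lebesgueE; last exact: compact_measurable_rV.
by rewrite setIid XV -EFinM mulVf// gt_eqF.
Qed.

(** Enlarge the domain of integration from X to R^n, where the integral of the kernel is known. *)
Lemma typicality_normalized_le t x : (0 < t)%R ->
  typicality X (scale_dist t (@euclidean_dist R n)) (normalized_lebesgue cX) x <=
  (V^-1)%:E * ((t ^- n)%:E * ((n`!%:R)%:E * ballvol n)).
Proof.
move=> t0; have mX := compact_measurable_rV cX.
have Vi : (0 <= V^-1)%R by rewrite invr_ge0 ltW.
rewrite /typicality (eq_measure_integral (mscale (NngNum Vi) (lebesgue_rV n))); last first.
  move=> A mA AX; rewrite -[LHS]/(normalized_lebesgue cX A) normalized_lebesgueE// /mscale/= (_ : A `&` X = A)//.
  exact/setIidPl.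
rewrite ge0_integral_mscale//=; last first.
  by apply/measurable_EFinP; apply: measurable_funTS; exact: measurable_expR_dist.
rewrite lee_wpmul2l// -(integral_expR_dist x t0).
apply: ge0_subset_integral => //.
by apply/measurable_EFinP; exact: measurable_expR_dist.
Qed.

End normalized.

(** * Shrinking neighbourhoods of X and growing truncations *)

Section asymptotics.
Context {R : realType} {n : nat}.
Variable X : set 'rV[R]_n.
Hypothesis cX : compact X.

(** The balls are those of the sup norm; they contain the Euclidean open balls of the same radius,
    as the features require. *)
Definition thicken (e : R) : set 'rV[R]_n := \bigcup_(x in X) ball x e.

Lemma open_thicken e : (0 < e)%R -> open (thicken e).
Proof. by move=> e0; apply: bigcup_open => x _; exact: ball_open. Qed.

Lemma measurable_thicken e : (0 < e)%R -> measurable (thicken e).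
Proof. by move=> e0; apply: open_measurable_rV; exact: open_thicken. Qed.

Lemma compact_sub_rbox : exists r : R, (0 < r)%R /\ X `<=` rbox 0 r.
Proof.
have [M [Mr XM]] := compact_bounded cX.
exists (`|M| + 1)%R; split; first by rewrite ltr_wpDl.
move=> x Xx i.
have : (`|x| <= `|M| + 1)%R by apply: (XM (`|M| + 1)%R _ _ Xx); rewrite (le_lt_trans (ler_norm _))// ltrDl.
have : (`|x ord0 i| <= `|x|)%R.
  rewrite [leRHS]mx_normrE; exact: (le_bigmax _ (fun ij => `|x ij.1 ij.2|%R) (ord0, i)).
move=> /le_trans h /h; rewrite ler_norml !mxE => /andP[h1 h2].
by apply/andP; split; lra.
Qed.

Lemma lebesgue_thicken_lty : lebesgue_rV n (thicken 1) < +oo.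
Proof.
have [r [r0 Xr]] := compact_sub_rbox.
apply: (@le_lt_trans _ _ (lebesgue_rV n (rbox 0 (r + 1)%R))); last first.
  by rewrite lebesgue_rbox ?ltry// addr_ge0// ltW.
apply: le_measure; rewrite ?inE; [exact: measurable_thicken|exact: measurable_rbox|].
move=> z [x /Xr xr [_ xz]] i; have := xr i; have := xz ord0 i.
by rewrite /ball/= !mxE ltr_distl => /andP[h1 h2] /andP[h3 h4]; apply/andP; split; lra.
Qed.

Lemma bigcap_thicken : \bigcap_k thicken (k.+1%:R^-1) = X.
Proof.
apply/seteqP; split => [z zX|x Xx k _]; last first.
  by exists x => //; apply: ballxx; rewrite invr_gt0.
have clX : closed X by apply: compact_closed => //; exact: norm_hausdorff.
apply: clX => U /nbhs_ballP[e /= e0 eU].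
have [k _ /(_ k (leqnn k)) ke] := near_infty_natSinv_lt (PosNum e0).
have [x Xx xz] := zX k I; exists x; split => //; apply: eU.
by apply: ball_sym; exact: le_ball (ltW ke) _ xz.
Qed.

(** Continuity from above along the radii 1/(k+1): the neighbourhood of radius 1 has finite volume,
    and the intersection is X because X is closed. *)
Lemma lebesgue_thicken_le (e : R) : (0 < e)%R ->
  exists2 d : R, (0 < d)%R & lebesgue_rV n (thicken d) <= lebesgue_rV n X + e%:E.
Proof.
move=> e0; pose F k := thicken (k.+1%:R^-1).
have F0 k : (0 < k.+1%:R^-1 :> R)%R by rewrite invr_gt0.
have Foo : lebesgue_rV n (F 0%N) < +oo by rewrite /F invr1 lebesgue_thicken_lty.
have XF : X `<=` F 0%N by move=> x Xx; exists x => //; exact: ballxx.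
have mX := compact_measurable_rV cX.
have Xfin : lebesgue_rV n X \is a fin_num.
  rewrite ge0_fin_numE ?measure_ge0//; apply: le_lt_trans Foo.
  by apply: le_measure; rewrite ?inE//; exact: measurable_thicken.
have := @nonincreasing_cvg_mu _ _ _ (lebesgue_rV n) F Foo.
rewrite bigcap_thicken => /(_ _ mX) cF.
have {}cF : (lebesgue_rV n \o F) x @[x --> \oo] --> lebesgue_rV n X.
  apply: cF => [k|k m km]; first exact: measurable_thicken.
  apply/subsetPset => z [x Xx xz]; exists x => //; apply: le_ball xz.
  by rewrite lef_pV2 ?posrE// ler_nat.
have : \forall k \near \oo, (lebesgue_rV n \o F) k < lebesgue_rV n X + e%:E.
  apply: (cF [set y | y < lebesgue_rV n X + e%:E]); apply: open_nbhs_nbhs; split.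
    exact: open_ereal_lt_ereal.
  by rewrite /= -[ltLHS]adde0 lteD2lE// lte_fin.
move=> [k _ /(_ k (leqnn k)) /= kX]; exists (k.+1%:R^-1)%R => //.
exact: ltW.
Qed.

Section mixture.
Variables (d : measure_display) (S : measurableType d).
Variables (m : {sigma_finite_measure set S -> \bar R}) (w b : S -> R).
Hypotheses (mw : measurable_fun setT w) (mb : measurable_fun setT b) (w0 : forall s, (0 <= w s)%R).
Hypothesis wb : forall x y : 'rV[R]_n, (expR (- euclidean_dist x y))%:E =
     \int[m]_s ((w s)%:E * lebesgue_rV n (sball x (b s) `&` sball y (b s))).

Let G : R := (n`!%:R * fine (ballvol n))%R.

Let G0 : (0 < G)%R.
Proof.
rewrite mulr_gt0 ?ltr0n ?fact_gt0// fine_gt0// ballvol_gt0/= -ge0_fin_numE ?measure_ge0//.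
exact: ballvol_fin_num.
Qed.

Let f (s : S) : R := (w s * fine (cballvol n (b s)) ^+ 2)%R.

Let mf : measurable_fun setT (f : S -> measurableTypeR R).
Proof.
apply: measurable_funM => //; apply: measurable_funX; apply: measurableT_comp => //.
exact: (@measurable_cballvolb R n _ _ _ mb).
Qed.

Let f0 s : (0 <= f s)%R. Proof. by rewrite mulr_ge0// sqr_ge0. Qed.

Let fG : \int[m]_s (f s)%:E = G%:E.
Proof.
rewrite /G EFinM fineK ?ballvol_fin_num// -(mixture_mass mw mb w0 wb).
apply: eq_integral => s _; rewrite /f EFinM expr2 EFinM fineK//.
have [b0|b0] := leP 0%R (b s).
  by rewrite /cballvol lebesgue_sball// fin_numM// ballvol_fin_num.
by rewrite /cballvol sball_neg// measure0.
Qed.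

(** Monotone convergence along T = k: each [b s] is finite, so the truncations exhaust the index
    space, whose full mass is [G]. *)
Lemma trunc_mass_cvg (e : R) : (0 < e)%R -> exists T0 : R, forall T, (T0 <= T)%R ->
  exists2 M : R, (G - e < M)%R & trunc_mass (n := n) m w b T = M%:E.
Proof.
move=> e0.
pose A T : set S := [set s | (b s < T)%R].
have mA T : measurable (A T).
  rewrite (_ : A T = ~` [set s | (T <= b s)%R]).
    by apply: measurableC; exact: measurable_le_set.
  by apply/seteqP; split => s; rewrite /A/= ltNge => /negP.
have mg T : measurable_fun setT (fun s => (f s * \1_(A T) s)%:E).
  by apply/measurable_EFinP; apply: measurable_funM => //; exact: measurable_indic.
have g0 T s : 0 <= (f s * \1_(A T) s)%:E by rewrite lee_fin mulr_ge0.
have tmE T : trunc_mass (n := n) m w b T = \int[m]_s (f s * \1_(A T) s)%:E by [].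
have le_tm T T' : (T <= T')%R -> trunc_mass (n := n) m w b T <= trunc_mass (n := n) m w b T'.
  move=> TT'; rewrite !tmE; apply: ge0_le_integral => // s _.
  rewrite lee_fin ler_wpM2l// !indicE; case: (boolP (s \in A T)) => //; rewrite inE => sT.
  by rewrite mem_set//; exact: lt_le_trans TT'.
have tm_le T : trunc_mass (n := n) m w b T <= G%:E.
  rewrite tmE -fG; apply: ge0_le_integral => // [|s _]; first exact/measurable_EFinP.
  by rewrite lee_fin ler_piMr// indicE; case: (_ \in _).
have cv := @cvg_monotone_convergence _ S R m setT measurableT
  (fun k s => (f s * \1_(A k%:R) s)%:E) (fun k => mg _) (fun k s _ => g0 _ _).
have {}cv : trunc_mass (n := n) m w b k%:R @[k --> \oo] --> G%:E.
  rewrite -fG (_ : \int[m]_s (f s)%:E = \int[m]_s (limn (fun k => (f s * \1_(A k%:R) s)%:E))).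
    apply: cv => s _ k k' kk'; rewrite lee_fin ler_wpM2l// !indicE.
    case: (boolP (s \in A k%:R)) => //; rewrite inE => sT.
    by rewrite mem_set//; apply: (lt_le_trans sT); rewrite ler_nat.
  apply: eq_integral => s _; apply/esym/cvg_lim => //.
  apply: cvg_near_cst; near=> k; rewrite indicE mem_set ?mulr1//= /A/=.
  by near: k; exact: nbhs_infty_gtr.
have : \forall k \near \oo, (G - e)%:E < trunc_mass (n := n) m w b k%:R.
  apply: (cv [set y | (G - e)%:E < y]); apply: open_nbhs_nbhs; split.
    exact: open_ereal_gt_ereal.
  by rewrite /= lte_fin ltrBlDr ltrDl.
move=> [k _ /(_ k (leqnn k)) /= kG]; exists k%:R => T kT.
have Tfin : trunc_mass (n := n) m w b T \is a fin_num.
  rewrite ge0_fin_numE; last by rewrite tmE; apply: integral_ge0 => s _; exact: g0.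
  by rewrite (le_lt_trans (tm_le T))// ltry.
exists (fine (trunc_mass (n := n) m w b T)); last by rewrite fineK.
by rewrite -lte_fin fineK// (lt_le_trans kG)// le_tm.
Unshelve. all: by end_near. Qed.

End mixture.
End asymptotics.

(** * Two-sided bounds of order t^n *)

Section asymptotic_bounds.
Context {R : realType} {n : nat}.
Variables (X : set 'rV[R]_n) (V : R).
Hypotheses (cX : compact X) (V0 : (0 < V)%R) (XV : lebesgue_rV n X = V%:E).
Local Notation dist t := (scale_dist t (@euclidean_dist R n)).

Let mX : measurable X. Proof. exact: compact_measurable_rV. Qed.

Let G : R := (n`!%:R * fine (ballvol n))%R.

Let GE : G%:E = (n`!%:R)%:E * ballvol n.
Proof. by rewrite EFinM fineK// ballvol_fin_num. Qed.

Let G0 : (0 < G)%R.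
Proof. by rewrite -lte_fin GE mule_gt0 ?ballvol_gt0// lte_fin ltr0n fact_gt0. Qed.

Let L : R := (V / G)%R.

Let L0 : (0 < L)%R. Proof. by rewrite divr_gt0. Qed.

(** X is bounded, so the kernel is at least exp(- t D) on it with [D] a bound on the diameter. This
    supplies [kmin] in the diversity bounds. *)
Lemma rtypicality_ge t (mu : probability 'rV[R]_n R) : mu X = 1 -> (0 < t)%R ->
  exists2 kmin : R, (0 < kmin)%R & forall x, X x -> (kmin <= rtypicality X t mu x)%R.
Proof.
move=> muX t0; have [r [r0 Xr]] := compact_sub_rbox cX.
pose D := Num.sqrt (n%:R * (2 * r) ^+ 2)%R.
exists (expR (- (t * D)))%R; first exact: expR_gt0.
move=> x Xx; rewrite -lee_fin -typicalityE// -[leLHS]mule1 -muX -integral_cst//.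
apply: ge0_le_integral => //.
- by move=> y _; rewrite /= lee_fin expR_ge0.
- by apply/measurable_EFinP; apply: measurable_funTS; exact: measurable_expR_dist.
move=> y Xy; rewrite lee_fin ler_expR lerN2 ler_pM2l//.
rewrite euclidean_distE ler_wsqrtr//.
suff : sball y (n%:R * (2 * r) ^+ 2)%R x by [].
apply: rbox_sub_sball => [|i]; first by rewrite mulr_ge0// ltW.
have := Xr _ Xx i; have := Xr _ Xy i; rewrite !mxE => /andP[h1 h2] /andP[h3 h4].
by apply/andP; split; lra.
Qed.

Lemma eventual_upper_bound (eta : R) : (0 < eta)%R ->
  exists2 t0 : R, (0 < t0)%R & forall t, (t0 < t)%R -> exists C : R,
  [/\ (0 < C)%R, (C <= (L + eta) * t ^+ n)%R,
   forall mu : probability 'rV[R]_n R, mu X = 1 ->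
     \int[mu]_(x in X) ((rtypicality X t mu x)^-1)%:E <= C%:E &
   forall N (x : 'I_N -> 'rV[R]_n) (v : 'I_N -> R), (forall i, X (x i)) ->
   ((\sum_i v i) ^+ 2 <= C * \sum_i \sum_j v i * v j * expR (- dist t (x i) (x j)))%R].
Proof.
move=> eta0.
have [d [S [m [w [b [mw mb w0 wb]]]]]] := @hat_mixtureT R n.
(* Solved from (L + eta) (G - e) = V + eps: half of eta G pays for the excess volume of the
   neighbourhood, the other half for the truncated mass. *)
pose eps := (eta * G / 2)%R; pose e := (eps / (L + eta))%R.
have eps0 : (0 < eps)%R by rewrite divr_gt0// mulr_gt0.
have Le0 : (0 < L + eta)%R by rewrite addr_gt0.
have e0 : (0 < e)%R by rewrite divr_gt0.
have eG : (e < G)%R.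
  rewrite ltr_pdivrMr// /eps -mulrA mulrCA ltr_pM2l//.
  by have := L0; have := eta0; lra.
have [del del0 Xdel] := lebesgue_thicken_le cX eps0.
have [T0 HT0] := trunc_mass_cvg mw mb w0 wb e0.
have mdel := measurable_thicken X del0.
pose W := fine (lebesgue_rV n (thicken X del)).
have WE : lebesgue_rV n (thicken X del) = W%:E.
  rewrite fineK// ge0_fin_numE ?measure_ge0// (le_lt_trans Xdel)// XV -EFinD.
  by rewrite ltry.
have VW : (V <= W)%R.
  rewrite -lee_fin -XV -WE le_measure ?inE// => x Xx; exists x => //; exact: ballxx.
have W0 : (0 < W)%R by rewrite (lt_le_trans V0).
have WV : (W <= V + eps)%R by rewrite -lee_fin -WE (le_trans Xdel)// XV.
(* The truncation bound is the squared radius (t del)^2. From t del > |T0| + 1 >= 1 it follows that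
   (t del)^2 >= t del >= T0. *)
exists ((`|T0| + 1) / del)%R; first by rewrite divr_gt0// ltr_wpDl.
move=> t tt0.
have td : (`|T0| + 1 < t * del)%R by rewrite -ltr_pdivrMr.
have td1 : (1 < t * del)%R by rewrite (le_lt_trans _ td)// lerDr.
have td0 : (0 < t * del)%R by rewrite (lt_trans _ td1).
have t0 : (0 < t)%R by rewrite -(pmulr_lgt0 _ del0).
have T0td : (T0 <= (t * del) ^+ 2)%R.
  rewrite (le_trans (ler_norm _))// (@le_trans _ _ (t * del)%R)//.
    by rewrite (le_trans _ (ltW td))// lerDl.
  by rewrite expr2 ler_peMl// ltW.
have [M GM ME] := HT0 _ T0td.
have M0 : (0 < M)%R by rewrite (le_lt_trans _ GM)// subr_ge0 ltW.
pose Y : set 'rV[R]_n := [set z | thicken X del (t^-1 *: z)%R].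
have mY : measurable Y.
  by apply: (measurable_preimT _ mdel); exact: measurable_rVZ.
have YE : lebesgue_rV n Y = (t ^+ n * W)%:E.
  have := @lebesgue_rV_affine R n t^-1 0%R _ _ mdel.
  rewrite invr_gt0 => /(_ t0); rewrite WE -EFinM exprVn invrK => <-.
  by congr (lebesgue_rV n _); apply/seteqP; split => z /=; rewrite addr0.
have XY x z : X x -> (sqn (z - t *: x) < (t * del) ^+ 2)%R -> Y z.
  move=> Xx h; exists x => //; split => // i j; rewrite ord1 /ball/= !mxE.
  have h1 : ((z - t *: x)%R ord0 j ^+ 2 < (t * del) ^+ 2)%R.
    apply: le_lt_trans h; rewrite /sqn (bigD1 j)//= lerDl.
    by apply: sumr_ge0 => k _; exact: sqr_ge0.
  move: h1; rewrite -[ltLHS]real_normK ?num_real// ltr_sqr ?nnegrE ?(ltW td0)// !mxE => h1.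
  rewrite -(ltr_pM2l t0) -[X in (X * `|_|)%R](gtr0_norm t0) -normrM mulrBr mulVKf ?gt_eqF//.
  by rewrite distrC.
have Mn0 : M != 0%R by rewrite gt_eqF.
(* This is the volume of [Y], the dilate by t of the neighbourhood of X, divided by the truncated
   mass. *)
exists (t ^+ n * W / M)%R; split.
- by rewrite divr_gt0// mulr_gt0// exprn_gt0.
- rewrite -mulrA mulrC ler_pM2r ?exprn_gt0// ler_pdivrMr//.
  apply: (le_trans WV); apply: (@le_trans _ _ ((L + eta) * (G - e)))%R; last first.
    by rewrite ler_pM2l// ltW.
  rewrite (_ : _ * _ = V + eps)%R// /e /L /eps.
  by field; rewrite !gt_eqF//= addr_gt0// mulr_gt0.
- move=> mu muX; have := integral_rtypicality_inv_le mw mb w0 wb t0 mY XY M0 ME mX muX.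
  by rewrite YE -EFinM mulrC.
- move=> N x v Xx; apply: (sqr_sum_le_similarity mw mb w0 wb t0 mY XY M0 ME v Xx YE).
  by rewrite mulr_gt0// exprn_gt0.
Qed.

Lemma diversity_upper (q : \bar R) (t C : R) (mu : probability 'rV[R]_n R) :
  0 <= q -> (0 < t)%R -> (0 < C)%R -> mu X = 1 ->
  \int[mu]_(x in X) ((rtypicality X t mu x)^-1)%:E <= C%:E ->
  diversity X (dist t) q mu <= C%:E.
Proof.
move=> q0 t0 C0 muX KC; have [kmin kmin0 kminX] := rtypicality_ge muX t0.
apply: (@diversity_le _ _ _ X (dist t) mu (rtypicality X t mu) kmin) => //.
- exact: measurable_rtypicality.
- by move=> x; exact: rtypicality_gt0.
- by move=> x; rewrite -lee_fin -typicalityE//; exact: typicality_le1.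
- by move=> x; exact: typicalityE.
Qed.

Lemma max_diversity_upper (q : \bar R) (t C : R) : 0 <= q -> (0 < t)%R -> (0 < C)%R ->
  (forall mu : probability 'rV[R]_n R, mu X = 1 ->
     \int[mu]_(x in X) ((rtypicality X t mu x)^-1)%:E <= C%:E) ->
  max_diversity X (dist t) q <= C%:E.
Proof.
move=> q0 t0 C0 KC; apply: ge_ereal_sup => _ [mu muX <-].
by apply: diversity_upper => //; exact: KC.
Qed.

Local Notation nu := (normalized_lebesgue cX).

Let nuX : nu X = 1. Proof. exact: normalized_lebesgue1 XV. Qed.

Let typ_nu t x : (0 < t)%R -> typicality X (dist t) nu x <= ((L * t ^+ n)^-1)%:E.
Proof.
move=> t0; apply: (le_trans (typicality_normalized_le cX V0 XV x t0)).
rewrite -GE -!EFinM lee_fin le_eqVlt; apply/orP; left; apply/eqP.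
by rewrite /L; field; rewrite !gt_eqF// exprn_gt0.
Qed.

Lemma diversity_normalized_ge (q : \bar R) (t : R) : 0 <= q -> (0 < t)%R ->
  (L * t ^+ n)%:E <= diversity X (dist t) q nu.
Proof.
move=> q0 t0; have [kmin kmin0 kminX] := rtypicality_ge nuX t0.
have Lt0 : (0 < L * t ^+ n)%R by rewrite mulr_gt0// exprn_gt0.
rewrite -[X in X%:E]invrK.
apply: (@diversity_ge _ _ _ X (dist t) nu (rtypicality X t nu) kmin) => //.
- exact: measurable_rtypicality.
- by move=> x; exact: rtypicality_gt0.
- by move=> x; rewrite -lee_fin -typicalityE//; exact: typicality_le1.
- by move=> x; exact: typicalityE.
- by rewrite invr_gt0.
- by move=> x _; rewrite -lee_fin -typicalityE// typ_nu.
Qed.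

Lemma diversity_le_max (q : \bar R) (t : R) :
  diversity X (dist t) q nu <= max_diversity X (dist t) q.
Proof. by apply: ereal_sup_ubound; exists nu. Qed.

Lemma magnitude_lower (t C : R) : (0 < t)%R -> (0 < C)%R ->
  (forall N (x : 'I_N -> 'rV[R]_n) (v : 'I_N -> R), (forall i, X (x i)) ->
   ((\sum_i v i) ^+ 2 <= C * \sum_i \sum_j v i * v j * expR (- dist t (x i) (x j)))%R) ->
  (L * t ^+ n)%:E <= magnitude (dist t) X.
Proof.
move=> t0 C0 quad.
have Lt0 : (0 < L * t ^+ n)%R by rewrite mulr_gt0// exprn_gt0.
rewrite -[X in X%:E]invrK.
apply: (magnitude_ge cX t0 C0 quad nuX) => [|x]; first by rewrite invr_gt0.
exact: typ_nu.
Qed.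

End asymptotic_bounds.

(** * From two-sided bounds to limits *)

Section limits.
Context {R : realType} (n : nat) (L : R).
Hypothesis L0 : (0 < L)%R.

(** The slack [eta] is only in the upper bound: the lower one, obtained from normalised Lebesgue
    measure, holds at every t > 0. *)
Definition asymp (F : R -> \bar R) := forall eta : R, (0 < eta)%R ->
  exists2 t0 : R, (0 < t0)%R & forall t, (t0 < t)%R ->
  (L * t ^+ n)%:E <= F t <= ((L + eta) * t ^+ n)%:E.

(** The bounds make [F] eventually finite and positive, so that quotients in the extended reals
    reduce to quotients of real functions. *)
Lemma asymp_cvg (F : R -> \bar R) : asymp F ->
  exists f : R -> R, [/\ \forall t \near +oo%R, F t = (f t * t ^+ n)%:E,
    (\forall t \near +oo%R, 0 < f t)%R & f t @[t --> +oo%R] --> L].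
Proof.
move=> aF; exists (fun t => fine (F t) / t ^+ n)%R.
have FE t : (0 < t)%R -> F t \is a fin_num -> F t = (fine (F t) / t ^+ n * t ^+ n)%:E.
  by move=> t0 Ft; rewrite divfK ?fineK// expf_neq0// gt_eqF.
have bnd eta t : (0 < t)%R -> (L * t ^+ n)%:E <= F t <= ((L + eta) * t ^+ n)%:E ->
    F t \is a fin_num /\ (L <= fine (F t) / t ^+ n <= L + eta)%R.
  move=> t0 /andP[h1 h2]; have tn0 : (0 < t ^+ n)%R by rewrite exprn_gt0.
  have Ft : F t \is a fin_num.
    by rewrite fin_numE gt_eqF ?lt_eqF// ?(le_lt_trans h2) ?ltry// (lt_le_trans _ h1)// ltNyr.
  split => //; rewrite ler_pdivlMr// ler_pdivrMr// -!lee_fin fineK//.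
  by rewrite h1 h2.
have [t0 t00 Ht0] := aF 1%R ltr01.
split.
- near=> t; have tt0 : (t0 < t)%R by near: t; apply: nbhs_pinfty_gt; rewrite num_real.
  have t0' : (0 < t)%R by rewrite (lt_trans t00).
  by apply: FE => //; have [] := bnd _ _ t0' (Ht0 _ tt0).
- near=> t; have tt0 : (t0 < t)%R by near: t; apply: nbhs_pinfty_gt; rewrite num_real.
  have t0' : (0 < t)%R by rewrite (lt_trans t00).
  by have [_ /andP[h _]] := bnd _ _ t0' (Ht0 _ tt0); exact: lt_le_trans h.
- apply/cvgrPdist_le => eta eta0.
  have [t1 t10 Ht1] := aF eta eta0.
  near=> t; have tt1 : (t1 < t)%R by near: t; apply: nbhs_pinfty_gt; rewrite num_real.
  have t0' : (0 < t)%R by rewrite (lt_trans t10).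
  have [_ /andP[h1 h2]] := bnd _ _ t0' (Ht1 _ tt1).
  by rewrite distrC ger0_norm ?subr_ge0//; lra.
Unshelve. all: by end_near. Qed.

Lemma asymp_ratio (F F' : R -> \bar R) : asymp F -> asymp F' ->
  F t / F' t @[t --> +oo%R] --> 1.
Proof.
move=> /asymp_cvg[f [FE f0 fL]] /asymp_cvg[f' [FE' f0' fL']].
have : (f t / f' t)%:E @[t --> +oo%R] --> 1.
  apply: cvg_EFin; first exact: nearW.
  have Ln0 : L != 0%R by rewrite gt_eqF.
  rewrite -(divff Ln0); apply: (cvgM fL).
  exact: (cvgV Ln0 fL').
apply: cvg_trans; apply: near_eq_cvg; near=> t.
have t0 : (0 < t)%R by near: t; apply: nbhs_pinfty_gt; rewrite num_real.
have tn0 : (0 < t ^+ n)%R by rewrite exprn_gt0.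
have ft0 : (0 < f' t)%R by near: t.
rewrite (near FE t)// (near FE' t)// inver gt_eqF ?mulr_gt0// -EFinM; congr EFin.
by field; rewrite !gt_eqF.
Unshelve. all: by end_near. Qed.

Lemma asymp_pow (F : R -> \bar R) : asymp F ->
  F t / (t ^+ n)%:E @[t --> +oo%R] --> L%:E.
Proof.
move=> /asymp_cvg[f [FE f0 fL]].
have : (f t)%:E @[t --> +oo%R] --> L%:E by apply: cvg_EFin => //; exact: nearW.
apply: cvg_trans; apply: near_eq_cvg; near=> t.
have t0 : (0 < t)%R by near: t; apply: nbhs_pinfty_gt; rewrite num_real.
have tn0 : (0 < t ^+ n)%R by rewrite exprn_gt0.
rewrite (near FE t)// inver gt_eqF// -EFinM; congr EFin.
by field; rewrite !gt_eqF.
Unshelve. all: by end_near. Qed.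

End limits.

Theorem proposition9p7 (R : realType) (n : nat) (X : set 'rV[R]_n)
    (cX : compact X) (X_neq0 : lebesgue_rV n X != 0) (p : \bar R) (p_ge0 : 0 <= p) :
  let tdist (t : R) := scale_dist t (@euclidean_dist R n) in
  [/\ max_diversity X (tdist t) p / magnitude (tdist t) X @[t --> +oo%R] --> 1,
      max_diversity X (tdist t) p / (t ^+ n)%:E @[t --> +oo%R] -->
        lebesgue_rV n X / ((n`!%:R)%:E * unit_ball_volume R n) &
      forall q : \bar R, 0 <= q ->
        diversity X (tdist t) q (normalized_lebesgue cX)
          / max_diversity X (tdist t) p @[t --> +oo%R] --> 1].
Proof.
move=> tdist; pose V := fine (lebesgue_rV n X).
have XV : lebesgue_rV n X = V%:E.
  rewrite fineK// ge0_fin_numE ?measure_ge0//.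
  apply: le_lt_trans (lebesgue_thicken_lty cX).
  apply: le_measure; rewrite ?inE; [exact: compact_measurable_rV|exact: measurable_thicken|].
  by move=> x Xx; exists x => //; exact: ballxx.
have V0 : (0 < V)%R by rewrite -lte_fin -XV lt_neqAle eq_sym X_neq0 measure_ge0.
pose G : R := (n`!%:R * fine (ballvol n))%R; pose L := (V / G)%R.
have bv0 : (0 < fine (@ballvol R n))%R by rewrite -lte_fin fineK ?ballvol_fin_num// ballvol_gt0.
have G0 : (0 < G)%R by rewrite mulr_gt0 ?ltr0n ?fact_gt0.
have L0 : (0 < L)%R by rewrite divr_gt0.
(* The diversity of normalised Lebesgue measure, the maximum diversity and the magnitude are all
   [asymp] with the same [L], so their quotients tend to 1. *)
have Dq q : 0 <= q -> asymp n L (fun t => diversity X (tdist t) q (normalized_lebesgue cX)).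
  move=> q0 eta eta0; have [t0 t00 H] := eventual_upper_bound cX V0 XV eta0.
  exists t0 => // t tt0; have t0' := lt_trans t00 tt0; have [C [C0 CL HC _]] := H _ tt0.
  rewrite (diversity_normalized_ge cX V0 XV q0 t0')/=.
  apply: (@le_trans _ _ C%:E); last by rewrite lee_fin.
  have nuX := normalized_lebesgue1 cX V0 XV.
  by apply: (diversity_upper cX q0 t0' C0 nuX); exact: HC.
have Dmax : asymp n L (fun t => max_diversity X (tdist t) p).
  move=> eta eta0; have [t0 t00 H] := eventual_upper_bound cX V0 XV eta0.
  exists t0 => // t tt0; have t0' := lt_trans t00 tt0; have [C [C0 CL HC _]] := H _ tt0.
  rewrite (le_trans (diversity_normalized_ge cX V0 XV p_ge0 t0') (diversity_le_max cX V0 XV _ _))/=.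
  apply: (@le_trans _ _ C%:E); last by rewrite lee_fin.
  exact: max_diversity_upper.
have mag : asymp n L (fun t => magnitude (tdist t) X).
  move=> eta eta0; have [t0 t00 H] := eventual_upper_bound cX V0 XV eta0.
  exists t0 => // t tt0; have t0' := lt_trans t00 tt0; have [C [C0 CL _ HC]] := H _ tt0.
  rewrite (magnitude_lower cX V0 XV t0' C0 HC)/=.
  apply: (@le_trans _ _ C%:E); last by rewrite lee_fin.
  exact: magnitude_le.
split; [exact: asymp_ratio Dmax mag| |by move=> q q0; exact: asymp_ratio (Dq q q0) Dmax].
rewrite XV unit_ball_volumeE -(fineK (ballvol_fin_num n)) -EFinM inver gt_eqF// -EFinM.
exact: asymp_pow Dmax.
Qed.
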